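(* Let $N(c)$ be a $(2m+1)$-dimensional $(\kappa,\mu)$-contact space form of constant $\varphi$-sectional curvature $c$, endowed with the connection $\overline{\widetilde{\nabla}}_XY=\widehat{\overline{\nabla}}_XY+a\pi(X)Y+b\pi(Y)X$, and let $M^n$, $n\ge 3$, be an $n$-dimensional submanifold of $N(c)$. Then for each $x\in M$ and each unit vector $X\in T_xM$, \begin{align*} \widetilde{\mathrm{Ric}}(X)\le{}& \frac{(n-1)(c+3)}{4}+\frac{3(c-1)}{4}\|\widehat{P}X\|^2-\frac{c+3-4\kappa}{4}\left[(n-2)\eta(X)^2+\|\xi^\top\|^2\right]\\ &+\frac12\left[\|(\varphi h'X)^\top\|^2-\|(h'X)^\top\|^2+g(X,h'X)\mathrm{tr}((h')^\top)-g(X,\varphi h'X)\mathrm{tr}((\varphi h')^\top)\right]\\ &+(n-2-\|\xi^\top\|^2+\mu\|\xi^\top\|^2)g(X,h'X)+(1-\eta(X)^2+\mu\eta(X)^2)\mathrm{tr}((h')^\top)\\ &+(2-2\mu)\eta(X)g(X,h'(\xi^\top))-b\lambda'+b\alpha'(X,X)+b^2\|P^\top\|^2\\ &-b^2\pi(X)^2-nb\,\pi(\widetilde H)+b\,\pi(\widetilde h(X,X))+\frac{n^2}{4}\|\widetilde H\|^2 . \end{align*}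
   Context: **Ambient manifold.** A Riemannian manifold $(N^{2m+1},g)$ has an almost contact metric structure $(\varphi,\xi,\eta,g)$ if $\varphi$ is a $(1,1)$-tensor field, $\xi$ a vector field, $\eta$ a $1$-form with $\varphi^2X=-X+\eta(X)\xi$, $\eta(\xi)=1$, $\varphi\xi=0$, $\eta\circ\varphi=0$, $g(X,\varphi Y)=-g(\varphi X,Y)$, $g(X,\xi)=\eta(X)$. It is a contact metric manifold if $\Phi=d\eta$, where $\Phi(X,Y)=g(X,\varphi Y)$. Let $\widehat{\overline{\nabla}}$ be the Levi-Civita connection of $g$ and $\widehat{\overline{R}}$ its curvature tensor. The tensor $h'$ defined by $2h'=\mathcal L_\xi\varphi$ is symmetric, and $h'\xi=0$, $h'\varphi+\varphi h'=0$, $\widehat{\overline{\nabla}}\xi=-\varphi-\varphi h'$, and $h'$ and $\varphi h'$ are trace-free on $TN$. $N$ is a $(\kappa,\mu)$-contact metric manifold ($\kappa,\mu$ real constants) if $\widehat{\overline{R}}(X,Y)\xi=\kappa[\eta(Y)X-\eta(X)Y]+\mu[\eta(Y)h'X-\eta(X)h'Y]$. A $\varphi$-section is a plane spanned by $X,\varphi X$ with $X$ a unit vector orthogonal to $\xi$; its sectional curvature is a $\varphi$-sectional curvature. If a $(\kappa,\mu)$-contact metric manifold has constant $\varphi$-sectional curvature $c$ it is called a $(\kappa,\mu)$-contact space form $N(c)$, and its Levi-Civita curvature tensor is \begin{align*}\widehat{\overline{R}}(X,Y)Z={}&\tfrac{c+3}{4}[g(Y,Z)X-g(X,Z)Y]+\tfrac{c+3-4\kappa}{4}[\eta(X)\eta(Z)Y-\eta(Y)\eta(Z)X+g(X,Z)\eta(Y)\xi-g(Y,Z)\eta(X)\xi]\\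 &+\tfrac{c-1}{4}[2g(X,\varphi Y)\varphi Z+g(X,\varphi Z)\varphi Y-g(Y,\varphi Z)\varphi X]\\ &+\tfrac12[g(h'Y,Z)h'X-g(h'X,Z)h'Y+g(\varphi h'X,Z)\varphi h'Y-g(\varphi h'Y,Z)\varphi h'X]\\ &-g(X,Z)h'Y+g(Y,Z)h'X+\eta(X)\eta(Z)h'Y-\eta(Y)\eta(Z)h'X-g(h'X,Z)Y+g(h'Y,Z)X\\ &-g(h'Y,Z)\eta(X)\xi+g(h'X,Z)\eta(Y)\xi\\ &+\mu[\eta(Y)\eta(Z)h'X-\eta(X)\eta(Z)h'Y+g(h'Y,Z)\eta(X)\xi-g(h'X,Z)\eta(Y)\xi].\end{align*} **Connection.** $P$ is a vector field on $N$, $\pi(X)=g(P,X)$, $a,b$ are real constants, and $\overline{\widetilde{\nabla}}_XY=\widehat{\overline{\nabla}}_XY+a\pi(X)Y+b\pi(Y)X$. Put $\alpha'(X,Y)=(\widehat{\overline{\nabla}}_X\pi)(Y)$. **Submanifold.** For tangent $X,Y$ on $M$, $\overline{\widetilde{\nabla}}_XY=\widetilde\nabla_XY+\widetilde h(X,Y)$ is the decomposition into tangential part (induced connection $\widetilde\nabla$) and normal part $\widetilde h$; $\widetilde h$ equals the usual second fundamental form $\widehat h$. $\widetilde R(X,Y)Z=\widetilde\nabla_X\widetilde\nabla_YZ-\widetilde\nabla_Y\widetilde\nabla_XZ-\widetilde\nabla_{[X,Y]}Z$ and $\widetilde R(X,Y,Z,W)=g(\widetilde R(X,Y)Z,W)$.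 Let $e_1,\dots,e_n$ be an orthonormal basis of $T_xM$. $\widetilde H=\frac1n\sum_i\widetilde h(e_i,e_i)$. For a unit vector $X\in T_xM$, choosing the orthonormal basis with $e_1=X$, $\widetilde{\mathrm{Ric}}(X)=\sum_{j=2}^n\widetilde R(e_1,e_j,e_j,e_1)$. **Notation.** $\lambda'=\mathrm{tr}(\alpha')=\sum_{i=1}^n\alpha'(e_i,e_i)$ (trace over $T_xM$). $(\cdot)^\top$ denotes the tangential part; $\xi^\top$, $P^\top$ are the tangential parts of $\xi$, $P$; $\widehat PX=(\varphi X)^\top$, $(h')^\top X=(h'X)^\top$, $(\varphi h')^\top X=(\varphi h'X)^\top$ for tangent $X$; $\mathrm{tr}(\vartheta)=\sum_{i=1}^n g(e_i,\vartheta e_i)$ for $\vartheta\in\{(h')^\top,(\varphi h')^\top\}$. *)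

(* Defs.v *)
From HB Require Import structures.
From mathcomp Require Import all_boot all_order all_algebra.
From mathcomp Require Import all_classical all_reals all_analysis.
Set Implicit Arguments.
Unset Strict Implicit.
Unset Printing Implicit Defensive.
Import Order.TTheory GRing.Theory Num.Theory numFieldNormedType.Exports.
Local Open Scope classical_set_scope.
Local Open Scope ring_scope.

(* Vectors of R^d are row vectors and matrices act on the right: the value of
   an endomorphism A at v is v *m A. *)

Definition iterD (R : realType) (d : nat) (V : normedModType R)
    (vs : seq 'rV[R]_d) (f : 'rV[R]_d -> V) : 'rV[R]_d -> V :=
  foldr (fun v h => fun u => 'D_v h u) f vs.

(* On an open U this is C^oo: differentiable functions are continuous, and
   conversely continuous partial derivatives imply differentiability. *)
Definition smooth_on (R : realType) (d : nat) (V : normedModType R)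
    (U : set 'rV[R]_d) (f : 'rV[R]_d -> V) : Prop :=
  forall (vs : seq 'rV[R]_d) (u : 'rV[R]_d),
    U u -> differentiable (iterD vs f) u.

Record chart (R : realType) (d : nat) (T : topologicalType) := Chart {
  cdom : set T ;
  cim : set 'rV[R]_d ;
  cmap : T -> 'rV[R]_d ;
  cinv : 'rV[R]_d -> T ;
  cdom_open : open cdom ;
  cim_open : open cim ;
  cmap_cim : forall x, cdom x -> cim (cmap x) ;
  cinv_cdom : forall u, cim u -> cdom (cinv u) ;
  cmapK : forall x, cdom x -> cinv (cmap x) = x ;
  cinvK : forall u, cim u -> cmap (cinv u) = u ;
  cmap_continuous : forall x, cdom x -> {for x, continuous cmap} ;
  cinv_continuous : forall u, cim u -> {for u, continuous cinv} }.

Definition overlap (R : realType) (d : nat) (T : topologicalType)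
    (k l : chart R d T) : set 'rV[R]_d :=
  [set u | cim k u /\ cdom l (cinv k u)].

Definition transition (R : realType) (d : nat) (T : topologicalType)
    (k l : chart R d T) : 'rV[R]_d -> 'rV[R]_d :=
  fun u => cmap l (cinv k u).

Record smoothManifold (R : realType) (d : nat) := SmoothManifold {
  carrier :> topologicalType ;
  carrier_hausdorff : hausdorff_space carrier ;
  carrier_second_countable : @second_countable carrier ;
  chart_index : Type ;
  atlas : chart_index -> chart R d carrier ;
  atlas_cover : forall x : carrier, exists i, cdom (atlas i) x ;
  atlas_smooth : forall i j,
    smooth_on (overlap (atlas i) (atlas j)) (transition (atlas i) (atlas j)) }.

Record vectorField (R : realType) (d : nat) (N : smoothManifold R d) :=
  VectorField {
  vcomp :> chart_index N -> 'rV[R]_d -> 'rV[R]_d ;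
  vcomp_smooth : forall i, smooth_on (cim (atlas i)) (vcomp i) ;
  vcomp_compat : forall i j u, overlap (atlas i) (atlas j) u ->
    let t := transition (atlas i) (atlas j) in
    vcomp j (t u) = 'D_(vcomp i u) t u }.

Definition evform (R : realType) (d : nat) (w : 'cV[R]_d) (v : 'rV[R]_d) : R :=
  (v *m w) 0 0.

Record oneForm (R : realType) (d : nat) (N : smoothManifold R d) :=
  OneForm {
  ocomp :> chart_index N -> 'rV[R]_d -> 'cV[R]_d ;
  ocomp_smooth : forall i, smooth_on (cim (atlas i)) (ocomp i) ;
  ocomp_compat : forall i j u v, overlap (atlas i) (atlas j) u ->
    let t := transition (atlas i) (atlas j) in
    evform (ocomp i u) v = evform (ocomp j (t u)) ('D_v t u) }.

Record endoField (R : realType) (d : nat) (N : smoothManifold R d) :=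
  EndoField {
  ecomp :> chart_index N -> 'rV[R]_d -> 'M[R]_d ;
  ecomp_smooth : forall i, smooth_on (cim (atlas i)) (ecomp i) ;
  ecomp_compat : forall i j u v, overlap (atlas i) (atlas j) u ->
    let t := transition (atlas i) (atlas j) in
    'D_(v *m ecomp i u) t u = 'D_v t u *m ecomp j (t u) }.

Definition inner (R : realType) (d : nat) (G : 'M[R]_d) (v w : 'rV[R]_d) : R :=
  (v *m G *m w^T) 0 0.

Record metric (R : realType) (d : nat) (N : smoothManifold R d) := Metric {
  mcomp :> chart_index N -> 'rV[R]_d -> 'M[R]_d ;
  mcomp_smooth : forall i, smooth_on (cim (atlas i)) (mcomp i) ;
  mcomp_sym : forall i u, cim (atlas i) u -> (mcomp i u)^T = mcomp i u ;
  mcomp_pos : forall i u v, cim (atlas i) u -> v != 0 ->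
    0 < inner (mcomp i u) v v ;
  mcomp_compat : forall i j u v w, overlap (atlas i) (atlas j) u ->
    let t := transition (atlas i) (atlas j) in
    inner (mcomp i u) v w = inner (mcomp j (t u)) ('D_v t u) ('D_w t u) }.

(* Below, X, Y, Z are vector fields given by their components on an open set
   of R^d. Tensorial expressions are evaluated at vectors x, y, z by means of
   the fields [cst x], [cst y], [cst z] with constant components. *)

Definition lie_bracket (R : realType) (d : nat) (X Y : 'rV[R]_d -> 'rV[R]_d) :
    'rV[R]_d -> 'rV[R]_d :=
  fun u => 'D_(X u) Y u - 'D_(Y u) X u.

(* dw(X,Y) = (X(w(Y)) - Y(w(X)) - w([X,Y])) / 2. The factor 1/2 is the
   convention of contact metric geometry; it is the one for which
   Phi = d eta and 2 h' = L_xi phi give nabla xi = - phi - phi h'. *)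
Definition dform (R : realType) (d : nat) (w : 'rV[R]_d -> 'cV[R]_d)
    (X Y : 'rV[R]_d -> 'rV[R]_d) : 'rV[R]_d -> R :=
  fun u => ('D_(X u) (fun q => evform (w q) (Y q)) u
            - 'D_(Y u) (fun q => evform (w q) (X q)) u
            - evform (w u) (lie_bracket X Y u)) / 2.

(* (L_Z A) X = [Z, A X] - A [Z, X] *)
Definition lie_endo (R : realType) (d : nat) (Z : 'rV[R]_d -> 'rV[R]_d)
    (A : 'rV[R]_d -> 'M[R]_d) (X : 'rV[R]_d -> 'rV[R]_d) :
    'rV[R]_d -> 'rV[R]_d :=
  fun u => lie_bracket Z (fun q => X q *m A q) u - lie_bracket Z X u *m A u.

(* A connection is given in a chart by its coefficients C: the value at u of
   nabla_X Y is D_X Y + C u X Y. *)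
Definition covd (R : realType) (d : nat)
    (C : 'rV[R]_d -> 'rV[R]_d -> 'rV[R]_d -> 'rV[R]_d)
    (X Y : 'rV[R]_d -> 'rV[R]_d) : 'rV[R]_d -> 'rV[R]_d :=
  fun u => 'D_(X u) Y u + C u (X u) (Y u).

(* Levi-Civita connection, by the Koszul formula for constant fields:
   2 g(C u v w, e_k) = D_v g(w, e_k) + D_w g(v, e_k) - D_{e_k} g(v, w). *)
Definition christoffel (R : realType) (d : nat) (g : 'rV[R]_d -> 'M[R]_d)
    (u v w : 'rV[R]_d) : 'rV[R]_d :=
  (\row_(k < d)
     (('D_v (fun q => inner (g q) w (delta_mx 0 k)) u
       + 'D_w (fun q => inner (g q) v (delta_mx 0 k)) u
       - 'D_(delta_mx 0 k) (fun q => inner (g q) v w) u) / 2))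
  *m invmx (g u).

Definition curv (R : realType) (d : nat)
    (nabla : ('rV[R]_d -> 'rV[R]_d) -> ('rV[R]_d -> 'rV[R]_d) ->
             ('rV[R]_d -> 'rV[R]_d))
    (X Y Z : 'rV[R]_d -> 'rV[R]_d) : 'rV[R]_d -> 'rV[R]_d :=
  fun u => nabla X (nabla Y Z) u - nabla Y (nabla X Z) u
           - nabla (lie_bracket X Y) Z u.

Definition riem (R : realType) (d : nat) (g : 'rV[R]_d -> 'M[R]_d)
    (u x y z : 'rV[R]_d) : 'rV[R]_d :=
  curv (covd (christoffel g)) (cst x) (cst y) (cst z) u.

Definition sectional (R : realType) (d : nat) (g : 'rV[R]_d -> 'M[R]_d)
    (u x y : 'rV[R]_d) : R :=
  inner (g u) (riem g u x y y) x
  / (inner (g u) x x * inner (g u) y y - inner (g u) x y ^+ 2).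

Definition hprime (R : realType) (d : nat) (phi : 'rV[R]_d -> 'M[R]_d)
    (xi : 'rV[R]_d -> 'rV[R]_d) (u x : 'rV[R]_d) : 'rV[R]_d :=
  2^-1 *: lie_endo xi phi (cst x) u.

Definition almost_contact_metric (R : realType) (d : nat)
    (N : smoothManifold R d) (phi : endoField N) (xi : vectorField N)
    (eta : oneForm N) (g : metric N) : Prop :=
  forall i u, cim (atlas i) u ->
  [/\ forall x, x *m phi i u *m phi i u = - x + evform (eta i u) x *: xi i u,
      evform (eta i u) (xi i u) = 1,
      xi i u *m phi i u = 0,
      forall x, evform (eta i u) (x *m phi i u) = 0 &
      (forall x y, inner (g i u) x (y *m phi i u)
                   = - inner (g i u) (x *m phi i u) y) /\
      (forall x, inner (g i u) x (xi i u) = evform (eta i u) x)].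

Definition contact_metric (R : realType) (d : nat)
    (N : smoothManifold R d) (phi : endoField N) (xi : vectorField N)
    (eta : oneForm N) (g : metric N) : Prop :=
  almost_contact_metric phi xi eta g /\
  forall i u x y, cim (atlas i) u ->
    inner (g i u) x (y *m phi i u) = dform (eta i) (cst x) (cst y) u.

Definition kappa_mu_contact_metric (R : realType) (d : nat)
    (N : smoothManifold R d) (phi : endoField N) (xi : vectorField N)
    (eta : oneForm N) (g : metric N) (kappa mu : R) : Prop :=
  contact_metric phi xi eta g /\
  forall i u x y, cim (atlas i) u ->
    let et := evform (eta i u) in
    let h' := hprime (phi i) (xi i) u in
    riem (g i) u x y (xi i u)
    = kappa *: (et y *: x - et x *: y) + mu *: (et y *: h' x - et x *: h' y).

Definition kappa_mu_space_form (R : realType) (d : nat)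
    (N : smoothManifold R d) (phi : endoField N) (xi : vectorField N)
    (eta : oneForm N) (g : metric N) (kappa mu c : R) : Prop :=
  kappa_mu_contact_metric phi xi eta g kappa mu /\
  forall i u x, cim (atlas i) u ->
    inner (g i u) x x = 1 -> inner (g i u) x (xi i u) = 0 ->
    sectional (g i) u x (x *m phi i u) = c.

Definition pi_form (R : realType) (d : nat) (g : 'rV[R]_d -> 'M[R]_d)
    (P : 'rV[R]_d -> 'rV[R]_d) (u x : 'rV[R]_d) : R :=
  inner (g u) (P u) x.

Definition semisym (R : realType) (d : nat) (g : 'rV[R]_d -> 'M[R]_d)
    (P : 'rV[R]_d -> 'rV[R]_d) (a b : R) (u x y : 'rV[R]_d) : 'rV[R]_d :=
  christoffel g u x y + (a * pi_form g P u x) *: y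
                      + (b * pi_form g P u y) *: x.

(* alpha'(x, y) = (nabla_x pi)(y), with nabla the Levi-Civita connection *)
Definition alpha' (R : realType) (d : nat) (g : 'rV[R]_d -> 'M[R]_d)
    (P : 'rV[R]_d -> 'rV[R]_d) (u x y : 'rV[R]_d) : R :=
  'D_x (fun q => pi_form g P q y) u
  - pi_form g P u (covd (christoffel g) (cst x) (cst y) u).

(* Local representation of f, defined on rep_dom f k l. *)
Definition local_rep (R : realType) (n d : nat) (M : smoothManifold R n)
    (N : smoothManifold R d) (f : M -> N)
    (k : chart_index M) (l : chart_index N) :
    'rV[R]_n -> 'rV[R]_d :=
  fun u => cmap (atlas l) (f (cinv (atlas k) u)).

Definition rep_dom (R : realType) (n d : nat) (M : smoothManifold R n)
    (N : smoothManifold R d) (f : M -> N)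
    (k : chart_index M) (l : chart_index N) :
    set 'rV[R]_n :=
  [set u | cim (atlas k) u /\ cdom (atlas l) (f (cinv (atlas k) u))].

Definition immersion (R : realType) (n d : nat) (M : smoothManifold R n)
    (N : smoothManifold R d) (f : M -> N) : Prop :=
  [/\ continuous f,
      forall k l, smooth_on (rep_dom f k l) (local_rep f k l) &
      forall k l u v, rep_dom f k l u -> 'D_v (local_rep f k l) u = 0 -> v = 0].

(* In the rest of the file F is the local representation of an immersion and
   g the metric of the ambient manifold in the chart of the target. A tangent
   vector v of the submanifold is identified with 'D_v F u in the ambient
   tangent space at F u. *)

Definition induced_metric (R : realType) (n d : nat)
    (g : 'rV[R]_d -> 'M[R]_d) (F : 'rV[R]_n -> 'rV[R]_d) (u : 'rV[R]_n) :
    'M[R]_n :=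
  'J F u *m g (F u) *m ('J F u)^T.

(* The orthogonal projection of w onto the image of the differential of F at
   u is 'D_v F u, where v = [tancoord g F u w] is the solution of the normal
   equations g('D_v F u, 'D_z F u) = g(w, 'D_z F u) for all z. *)
Definition tancoord (R : realType) (n d : nat) (g : 'rV[R]_d -> 'M[R]_d)
    (F : 'rV[R]_n -> 'rV[R]_d) (u : 'rV[R]_n) (w : 'rV[R]_d) : 'rV[R]_n :=
  w *m g (F u) *m ('J F u)^T *m invmx (induced_metric g F u).

Definition tanpart (R : realType) (n d : nat) (g : 'rV[R]_d -> 'M[R]_d)
    (F : 'rV[R]_n -> 'rV[R]_d) (u : 'rV[R]_n) (w : 'rV[R]_d) : 'rV[R]_d :=
  'D_(tancoord g F u w) F u.

Definition norpart (R : realType) (n d : nat) (g : 'rV[R]_d -> 'M[R]_d)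
    (F : 'rV[R]_n -> 'rV[R]_d) (u : 'rV[R]_n) (w : 'rV[R]_d) : 'rV[R]_d :=
  w - tanpart g F u w.

(* Derivative along the submanifold, for the ambient connection with
   coefficients C, of the tangent vector field with components Y. *)
Definition covd_along (R : realType) (n d : nat)
    (C : 'rV[R]_d -> 'rV[R]_d -> 'rV[R]_d -> 'rV[R]_d)
    (F : 'rV[R]_n -> 'rV[R]_d) (X Y : 'rV[R]_n -> 'rV[R]_n) :
    'rV[R]_n -> 'rV[R]_d :=
  fun u => 'D_(X u) (fun q => 'D_(Y q) F q) u
           + C (F u) ('D_(X u) F u) ('D_(Y u) F u).

Definition induced_conn (R : realType) (n d : nat) (g : 'rV[R]_d -> 'M[R]_d)
    (C : 'rV[R]_d -> 'rV[R]_d -> 'rV[R]_d -> 'rV[R]_d)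
    (F : 'rV[R]_n -> 'rV[R]_d) (X Y : 'rV[R]_n -> 'rV[R]_n) :
    'rV[R]_n -> 'rV[R]_n :=
  fun u => tancoord g F u (covd_along C F X Y u).

Definition second_ff (R : realType) (n d : nat) (g : 'rV[R]_d -> 'M[R]_d)
    (C : 'rV[R]_d -> 'rV[R]_d -> 'rV[R]_d -> 'rV[R]_d)
    (F : 'rV[R]_n -> 'rV[R]_d) (u x y : 'rV[R]_n) : 'rV[R]_d :=
  norpart g F u (covd_along C F (cst x) (cst y) u).

Definition induced_riem (R : realType) (n d : nat) (g : 'rV[R]_d -> 'M[R]_d)
    (C : 'rV[R]_d -> 'rV[R]_d -> 'rV[R]_d -> 'rV[R]_d)
    (F : 'rV[R]_n -> 'rV[R]_d) (u x y z w : 'rV[R]_n) : R :=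
  inner (induced_metric g F u)
    (curv (induced_conn g C F) (cst x) (cst y) (cst z) u) w.

Definition orthonormal_basis (R : realType) (n : nat) (G : 'M[R]_n)
    (e : 'I_n -> 'rV[R]_n) : Prop :=
  forall i j, inner G (e i) (e j) = (i == j)%:R.

(* Ric(e_{i1}) when e is an orthonormal basis. *)
Definition ricci (R : realType) (n d : nat) (g : 'rV[R]_d -> 'M[R]_d)
    (C : 'rV[R]_d -> 'rV[R]_d -> 'rV[R]_d -> 'rV[R]_d)
    (F : 'rV[R]_n -> 'rV[R]_d) (u : 'rV[R]_n) (e : 'I_n -> 'rV[R]_n)
    (i1 : 'I_n) : R :=
  \sum_(j < n | j != i1) induced_riem g C F u (e i1) (e j) (e j) (e i1).

Definition mean_curvature (R : realType) (n d : nat)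
    (g : 'rV[R]_d -> 'M[R]_d)
    (C : 'rV[R]_d -> 'rV[R]_d -> 'rV[R]_d -> 'rV[R]_d)
    (F : 'rV[R]_n -> 'rV[R]_d) (u : 'rV[R]_n) (e : 'I_n -> 'rV[R]_n) :
    'rV[R]_d :=
  n%:R^-1 *: \sum_(i < n) second_ff g C F u (e i) (e i).

(* Main.v *)
(* In a chart, a contact metric structure satisfies [nabla xi = - phi - S] with
   [S] self-adjoint and anticommuting with [phi]; here [S = phi h'] in the
   operator notation of the paper. On the distribution orthogonal to [xi] the
   (kappa, mu)-condition says that [R(x, y) xi = 0] and
   [S ^ 2 = (1 - kappa) id]; either [S = 0] or [S] is invertible there, and these
   two facts, rotated by [phi], determine [nabla phi]. Applying the Ricci
   identity to [phi] gives the commutator of [R(x, y)] with [phi]. The difference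
   between [R] and the model curvature tensor is therefore a Kaehler-like
   curvature tensor with vanishing holomorphic sectional curvature, hence its
   sectional curvatures vanish: this is the curvature formula of the space form.

   The theorem follows from the Gauss equation of the semi-symmetric connection,
   summed over an orthonormal frame. The terms of the second fundamental form
   are bounded by [g(t - s, s) <= |t| ^ 2 / 4], with [t] the sum of the
   [s e_j e_j] and [s = s e_1 e_1]. *)

Require Import Defs.
From HB Require Import structures.
From mathcomp Require Import all_boot all_order all_algebra.
From mathcomp Require Import all_classical all_reals all_analysis.
From mathcomp Require Import ring lra.
Set Implicit Arguments.
Unset Strict Implicit.
Unset Printing Implicit Defensive.
Import Order.TTheory GRing.Theory Num.Theory numFieldNormedType.Exports.
Local Open Scope classical_set_scope.
Local Open Scope ring_scope.

(** * Calculus of matrix-valued functions *)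

(** The definition of a space form prescribes only the sectional curvatures of the planes spanned by
    [x] and [phi x]. For Kaehler curvature tensors polarization recovers all sectional curvatures
    from these, but a contact metric curvature tensor commutes with [phi] only up to terms in
    [nabla phi]. This is why [nabla phi] must be known exactly: the model tensor has the same
    commutator with [phi] and the same values on [xi], so both defects cancel. Ricci curvature needs
    only values [g(R(x, y) y, x)], so sectional curvatures suffice.

    Analysis is kept apart from algebra. In a chart, each tensor identity arises by differentiating
    a relation that holds on a whole open set, such as [phi ^ 2 = - 1 + eta xi], [phi xi = 0],
    [d eta = Phi] or [S phi + phi S = 0]. The consequences at a single point are proved for an
    abstract symmetric bilinear form, where they reduce to linear arithmetic.

    Since matrices act on row vectors from the right, products appear in the reverse of the operator
    order. *)

Section MatrixCalculus.
Context {R : realType} {V : normedModType R}.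
Implicit Types (u v w : V).

(** The affine approximation of [f] at [u] also approximates [g], and [diff_unique] then identifies
    the differential of [g]. Smoothness and the structure equations are available on open sets only,
    so functions are constantly exchanged for others that agree with them near the point. *)
Lemma near_eq_differentiable {W : normedModType R} (f g : V -> W) u :
  (\near u, f u = g u) -> differentiable f u -> differentiable g u.
Proof.
move=> fg df.
have fgu : f u = g u := nbhs_singleton fg.
have H : g \o shift u = cst (g u) + 'd f u +o_ (0 : V) id.
  apply: (@eqaddoP R V W V (nbhs_filter_on (0 : V)) (g \o shift u)
    (cst (g u) + 'd f u) id).2 => _/posnumP[e].
  have fe := (@eqaddoP R V W V (nbhs_filter_on (0 : V)) (f \o shift u)
    (cst (f u) + 'd f u) id).1 (diff_locally df) _ (gt0 e).
  near=> h; rewrite !fctE /= -fgu.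
  have <- : f (h + u) = g (h + u).
    near: h; move: fg; rewrite (near_shift (0 : V)) /=.
    by apply: filterS => h /=; rewrite subr0.
  by near: h; exact: fe.
have gf := diff_unique (diff_continuous df) H.
by apply/diff_locallyP; rewrite gf; split=> //; exact: diff_continuous.
Unshelve. all: by end_near. Qed.

Lemma differentiable_entry p q (M : V -> 'M[R]_(p, q)) i j u :
  differentiable M u -> differentiable (fun x => M x i j) u.
Proof.
by move=> dM; exact: (differentiable_comp dM (differentiable_coord _ i j)).
Qed.

Lemma differentiable_mx p q (M : V -> 'M[R]_(p, q)) u :
  (forall i j, differentiable (fun x => M x i j) u) -> differentiable M u.
Proof.
move=> dM.
have -> : M = \sum_(i < p) \sum_(j < q) (fun x => M x i j *: delta_mx i j).
  apply/funext => x; rewrite fct_sumE [LHS]matrix_sum_delta.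
  by apply: eq_bigr => i _; rewrite fct_sumE.
apply: differentiable_sum => i; apply: differentiable_sum => j.
exact: differentiableZl.
Qed.

Lemma derive_entry p q (M : V -> 'M[R]_(p, q)) i j u v :
  differentiable M u -> ('D_v M u) i j = 'D_v (fun x => M x i j) u.
Proof.
by move=> dM; rewrite derive_mx ?mxE//; exact: diff_derivable.
Qed.

Lemma differentiable_bigsum {I : Type} (r : seq I) {W : normedModType R}
    (f : I -> V -> W) u :
  (forall i, differentiable (f i) u) ->
  differentiable (fun x => \sum_(i <- r) f i x) u.
Proof.
move=> df; elim: r => [|i r IH].
  by under eq_fun do rewrite big_nil; exact: differentiable_cst.
by under eq_fun do rewrite big_cons; apply: differentiableD.
Qed.

Lemma differentiable_bigprod {I : Type} (r : seq I) (f : I -> V -> R) u :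
  (forall i, differentiable (f i) u) ->
  differentiable (fun x => \prod_(i <- r) f i x) u.
Proof.
move=> df; elim: r => [|i r IH].
  by under eq_fun do rewrite big_nil; exact: differentiable_cst.
by under eq_fun do rewrite big_cons; apply: differentiableM.
Qed.

Lemma derive_bigsum {I : Type} (r : seq I) {W : normedModType R}
    (f : I -> V -> W) u v :
  (forall i, differentiable (f i) u) ->
  'D_v (fun x => \sum_(i <- r) f i x) u = \sum_(i <- r) 'D_v (f i) u.
Proof.
move=> df; elim: r => [|i r IH].
  by under eq_fun do rewrite big_nil; rewrite big_nil derive_cst.
under eq_fun do rewrite big_cons.
rewrite deriveD; [by rewrite IH big_cons|exact: diff_derivable|].
by apply: diff_derivable; exact: differentiable_bigsum.
Qed.

Lemma differentiable_mulmx p q r (M : V -> 'M[R]_(p, q))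
    (N : V -> 'M[R]_(q, r)) u :
  differentiable M u -> differentiable N u ->
  differentiable (fun x => M x *m N x) u.
Proof.
move=> dM dN; apply: differentiable_mx => i j.
under eq_fun do rewrite mxE.
by apply: differentiable_bigsum => k; apply: differentiableM;
  exact: differentiable_entry.
Qed.

Lemma derive_mulmx p q r (M : V -> 'M[R]_(p, q)) (N : V -> 'M[R]_(q, r)) u v :
  differentiable M u -> differentiable N u ->
  'D_v (fun x => M x *m N x) u = 'D_v M u *m N u + M u *m 'D_v N u.
Proof.
move=> dM dN; apply/matrixP => i j.
rewrite derive_entry; last exact: differentiable_mulmx.
under eq_fun do rewrite mxE.
rewrite derive_bigsum; last first.
  by move=> k; apply: differentiableM; exact: differentiable_entry.
rewrite !mxE -big_split/=; apply: eq_bigr => k _.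
rewrite deriveM; try by apply: diff_derivable; exact: differentiable_entry.
by rewrite !derive_entry// addrC /GRing.scale/= [N _ _ _ * _]mulrC.
Qed.

Lemma derive_mulmxr p q r (M : 'M[R]_(p, q)) (N : V -> 'M[R]_(q, r)) u v :
  differentiable N u -> 'D_v (fun x => M *m N x) u = M *m 'D_v N u.
Proof.
move=> dN; rewrite (derive_mulmx v (differentiable_cst M u) dN).
by rewrite derive_cst mul0mx add0r.
Qed.

Lemma differentiable_trmx p q (M : V -> 'M[R]_(p, q)) u :
  differentiable M u -> differentiable (fun x => (M x)^T) u.
Proof.
move=> dM; apply: differentiable_mx => i j.
by under eq_fun do rewrite mxE; exact: differentiable_entry.
Qed.

Lemma derive_trmx p q (M : V -> 'M[R]_(p, q)) u v :
  differentiable M u -> 'D_v (fun x => (M x)^T) u = ('D_v M u)^T.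
Proof.
move=> dM; apply/matrixP => i j; rewrite !mxE !derive_entry//.
  by under eq_fun do rewrite mxE.
exact: differentiable_trmx.
Qed.

Lemma differentiable_scale (k : V -> R) p q (M : V -> 'M[R]_(p, q)) u :
  differentiable k u -> differentiable M u ->
  differentiable (fun x => k x *: M x) u.
Proof.
move=> dk dM; apply: differentiable_mx => i j; under eq_fun do rewrite mxE.
by apply: differentiableM => //; exact: differentiable_entry.
Qed.

Lemma derive_scale (k : V -> R) p q (M : V -> 'M[R]_(p, q)) u v :
  differentiable k u -> differentiable M u ->
  'D_v (fun x => k x *: M x) u = 'D_v k u *: M u + k u *: 'D_v M u.
Proof.
move=> dk dM; apply/matrixP => i j.
rewrite derive_entry; last exact: differentiable_scale.
under eq_fun do rewrite mxE.
rewrite deriveM; [|exact: diff_derivable|]; last first.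
  by apply: diff_derivable; exact: differentiable_entry.
by rewrite !mxE !derive_entry// addrC /GRing.scale/= [M _ _ _ * _]mulrC.
Qed.

Lemma derive_scalel (c : R) {W : normedModType R} (f : V -> W) u v :
  differentiable f u -> 'D_v (fun x => c *: f x) u = c *: 'D_v f u.
Proof.
by move=> df; rewrite -[LHS]/('D_v (c \*: f) u) deriveZ//; exact: diff_derivable.
Qed.

Lemma differentiable_mulrl (c : R) (f : V -> R) u :
  differentiable f u -> differentiable (fun x => c * f x) u.
Proof.
by move=> df; rewrite -[X in differentiable X _]/(c \*: f); exact: differentiableZ.
Qed.

Lemma derive_mulrl (c : R) (f : V -> R) u v :
  differentiable f u -> 'D_v (fun x => c * f x) u = c * 'D_v f u.
Proof. exact: derive_scalel. Qed.

Lemma differentiable_det p (M : V -> 'M[R]_p) u :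
  differentiable M u -> differentiable (fun x => \det (M x)) u.
Proof.
move=> dM; apply: differentiable_bigsum => s.
apply: differentiableM; first exact: differentiable_cst.
by apply: differentiable_bigprod => i; exact: differentiable_entry.
Qed.

Lemma differentiable_adj p (M : V -> 'M[R]_p) u :
  differentiable M u -> differentiable (fun x => \adj (M x)) u.
Proof.
move=> dM; apply: differentiable_mx => i j; under eq_fun do rewrite mxE.
apply: differentiableM; first exact: differentiable_cst.
apply: differentiable_det; apply: differentiable_mx => k l.
by under eq_fun do rewrite !mxE; exact: differentiable_entry.
Qed.

Lemma derive_dirD {W : normedModType R} (f : V -> W) u v w :
  differentiable f u -> 'D_(v + w) f u = 'D_v f u + 'D_w f u.
Proof. by move=> df; rewrite !deriveE// linearD. Qed.

Lemma derive_dirZ {W : normedModType R} (f : V -> W) u v (k : R) :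
  differentiable f u -> 'D_(k *: v) f u = k *: 'D_v f u.
Proof. by move=> df; rewrite !deriveE// linearZ. Qed.

Lemma derive_comp {W W' : normedModType R} (f : V -> W) (g : W -> W') u v :
  differentiable f u -> differentiable g (f u) ->
  'D_v (fun x => g (f x)) u = 'D_('D_v f u) g (f u).
Proof.
move=> df dg.
have dgf : differentiable (g \o f) u by exact: differentiable_comp.
by rewrite (deriveE v dgf) diff_comp// !deriveE.
Qed.

End MatrixCalculus.

(** * Inverse matrices and symmetry of second derivatives *)

Section InvSchwarz.
Context {R : realType} {V : normedModType R}.
Implicit Types (u v w x y : V).

Lemma near_unitmx p (M : V -> 'M[R]_p) u :
  M u \in unitmx -> differentiable M u -> \near u, M u \in unitmx.
Proof.
rewrite unitmxE unitfE => Mu dM.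
have : {for u, continuous (fun x => \det (M x))}.
  exact/differentiable_continuous/differentiable_det.
move=> /cvgr_neq0 /(_ Mu); apply: filterS => x /= Mx.
by rewrite unitmxE unitfE.
Qed.

Lemma differentiable_invmx p (M : V -> 'M[R]_p) u :
  M u \in unitmx -> differentiable M u -> differentiable (fun x => invmx (M x)) u.
Proof.
move=> Mu dM.
apply: (@near_eq_differentiable _ _ _ (fun x => (\det (M x))^-1 *: \adj (M x))).
  have := near_unitmx Mu dM; apply: filterS => x Mx.
  by rewrite /invmx Mx.
apply: differentiable_scale; last exact: differentiable_adj.
apply: differentiableV; first exact: differentiable_det.
by move: Mu; rewrite unitmxE unitfE.
Qed.

(** Mean value theorem for [s |-> f(u + s x + t y) - f(u + s x)], then first-order expansion of
    ['D_x f] around [u] at the two points that occur; the parts linear in [s] cancel. The derivative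
    ['D_x f] is expanded at [u] only. *)
Lemma second_difference (f : V -> R) u x y (e : R) :
  0 < e -> (\near u, differentiable f u) -> differentiable ('D_x f) u ->
  \forall t \near 0^'+,
    `|f (u + t *: x + t *: y) - f (u + t *: x) - f (u + t *: y) + f u
      - t ^+ 2 * 'D_y ('D_x f) u| <= e * t ^+ 2.
Proof.
move=> e0 df dg; set g := 'D_x f.
(* For [0 <= s <= t] the product [t * k] bounds both [|s x + t y|] and [|s x|]; the summand 1 keeps
   [k] positive. Each of the two expansions may have the error [e / (2 * k) * (t * k)], so together
   they cost at most [e * t]. *)
pose k := `|x| + `|y| + 1.
have k0 : 0 < k by rewrite /k; have := normr_ge0 x; have := normr_ge0 y; lra.
have e1 : 0 < e / (2 * k) by rewrite divr_gt0// mulr_gt0.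
have ge := (@eqaddoP R V R V (nbhs_filter_on (0 : V)) (g \o shift u)
    (cst (g u) + 'd g u) id).1 (diff_locally dg) _ e1.
have {ge} /nbhs_ballP [d1 /= d10 ge] := ge.
have /nbhs_ballP [d2 /= d20 fd] := df.
pose d := Num.min d1 d2.
have d0 : 0 < d by rewrite lt_min d10.
near=> t.
have t0 : 0 < t by near: t; exact: nbhs_right_gt.
have td : t * k < d.
  rewrite -ltr_pdivlMr//; near: t; apply: nbhs_right_lt.
  by rewrite divr_gt0.
have gest (h : V) : `|h| <= t * k ->
    differentiable f (h + u) /\
    `|g (h + u) - g u - 'd g u h| <= e / (2 * k) * (t * k).
  move=> ht; have hd : `|h| < d by exact: le_lt_trans td.
  split.
    apply: fd; rewrite -ball_normE/ball_/= opprD addrCA subrr addr0.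
    by rewrite normrN (lt_le_trans hd)// ge_min lexx orbT.
  have := ge h; rewrite -ball_normE/ball_/= sub0r normrN !fctE/= opprD addrA.
  move=> /(_ _)/le_trans; apply.
    by rewrite (lt_le_trans hd)// ge_min lexx.
  by rewrite ler_wpM2l// ltW.
pose F s := f (s *: x + t *: y + u) - f (s *: x + u).
pose dF s := g (s *: x + t *: y + u) - g (s *: x + u).
have sk s : 0 <= s <= t -> `|s *: x + t *: y| <= t * k /\ `|s *: x| <= t * k.
  move=> /andP[s0 st].
  have sx : `|s *: x| <= t * `|x|.
    by rewrite normrZ ger0_norm// ler_wpM2r.
  have ty : `|t *: y| = t * `|y| by rewrite normrZ gtr0_norm.
  split.
    by rewrite (le_trans (ler_normD _ _))// ty /k; nra.
  rewrite (le_trans sx)// ler_wpM2l// ?ltW// /k.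
  by have := normr_ge0 y; lra.
have dline (z : V) s : differentiable f (s *: x + z) ->
    is_derive s 1 (fun s => f (s *: x + z)) (g (s *: x + z)).
  move=> dfz.
  have dsx : differentiable (fun s : R => id s *: x) s.
    by apply: differentiableZl; exact: ex_diff.
  have dl : differentiable (fun s : R => s *: x + z) s.
    by apply: differentiableD => //; exact: differentiable_cst.
  have Dl : 'D_1 (fun s : R => s *: x + z) s = x.
    rewrite deriveD; [|exact: diff_derivable|exact: derivable_cst].
    rewrite derive_cst addr0 (deriveE _ dsx) diffZl; last exact: ex_diff.
    by rewrite diff_val scale1r.
  apply: DeriveDef.
    by apply: diff_derivable; exact: (differentiable_comp dl dfz).
  by rewrite (derive_comp _ dl dfz) Dl.
have FdF s : 0 <= s <= t -> is_derive s 1 F (dF s).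
  move=> /sk [s1 s2].
  apply: is_deriveB.
    under eq_fun do rewrite -addrA.
    by rewrite -addrA; apply: dline; rewrite addrA; exact: (gest _ s1).1.
  by apply: dline; exact: (gest _ s2).1.
have [c ct Fc] : exists2 c, c \in `]0, t[%R & F t - F 0 = dF c * (t - 0).
  apply: MVT => // [s|].
    by rewrite in_itv/= => /andP[/ltW s0 /ltW st]; apply: FdF; rewrite s0.
  apply: derivable_within_continuous => s; rewrite in_itv/= => st.
  exact: (@ex_derive _ _ _ _ _ _ _ (FdF _ st)).
have /sk [c1 c2] : 0 <= c <= t.
  by move: ct; rewrite in_itv/= => /andP[/ltW -> /ltW ->].
have [_ g1] := gest _ c1; have [_ g2] := gest _ c2.
have -> : f (u + t *: x + t *: y) - f (u + t *: x) - f (u + t *: y) + f u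
   = dF c * t.
  rewrite -[in RHS](subr0 t) -Fc /F !scale0r !add0r.
  rewrite [t *: x + t *: y + u]addrC [t *: x + u]addrC [t *: y + u]addrC.
  by rewrite addrA; ring.
rewrite (deriveE _ dg) -/g /dF; move: g1 g2.
set A1 := g (_ + _ + u); set A2 := g (_ + u); set A0 := g u.
rewrite linearD !linearZ/= !scalerN; set A3 := 'd g u x; set A4 := 'd g u y.
rewrite /GRing.scale/=.
rewrite (_ : e / (2 * k) * (t * k) = e * t / 2); last by field; rewrite gt_eqF.
rewrite (_ : (A1 - A2) * t - t ^+ 2 * A4 = (A1 - A2 - t * A4) * t); last by ring.
rewrite (_ : e * t ^+ 2 = e * t * t); last by ring.
rewrite normrM (gtr0_norm t0) ler_pM2r// !ler_norml.
by move=> /andP[? ?] /andP[? ?]; apply/andP; split; lra.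
Unshelve. all: by end_near. Qed.

(** The second difference is symmetric in [x] and [y], so divided by [t ^ 2] it approximates both
    iterated derivatives. *)
Lemma schwarz_real (f : V -> R) u x y :
  (\near u, differentiable f u) ->
  differentiable ('D_x f) u -> differentiable ('D_y f) u ->
  'D_x ('D_y f) u = 'D_y ('D_x f) u.
Proof.
move=> df dx dy; apply/eqP; rewrite -subr_eq0 -normr_le0.
apply/ler_addgt0Pl => e e0; rewrite addr0.
have e2 : 0 < e / 2 by rewrite divr_gt0.
have Hx := second_difference y e2 df dx.
have Hy := second_difference x e2 df dy.
have Hxy : nbhs (0 : R)^'+ _ := filterI (filterI Hx Hy) (nbhs_right_gt 0).
have [t [[/= h1 h2] t0]] := filter_ex (Hxy _ _).
have t20 : 0 < t ^+ 2 by rewrite exprn_gt0.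
set A := 'D_x _ _ in h2 *; set B := 'D_y _ _ in h1 *.
move: A B h1 h2 => A B h1 h2.
rewrite -(ler_pM2r t20) -[X in `|_| * X]gtr0_norm// -normrM.
set D := _ - _ - _ + f u in h1.
have ED : f (u + t *: y + t *: x) - f (u + t *: y) - f (u + t *: x) + f u = D.
  by rewrite /D [u + t *: y + _]addrAC; ring.
rewrite ED in h2.
have -> : (A - B) * t ^+ 2 = D - t ^+ 2 * B - (D - t ^+ 2 * A) by ring.
rewrite (le_trans (ler_normB _ _))// (le_trans (lerD h1 h2))//.
by rewrite -mulrDl -splitr.
Qed.

Lemma schwarz p q (f : V -> 'M[R]_(p, q)) u x y :
  (\near u, differentiable f u) ->
  differentiable ('D_x f) u -> differentiable ('D_y f) u ->
  'D_x ('D_y f) u = 'D_y ('D_x f) u.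
Proof.
move=> df dx dy; apply/matrixP => i j.
have E z : \near u, 'D_z f u i j = 'D_z (fun x => f x i j) u.
  by apply: filterS df => v; exact: derive_entry.
have DE v z (dz : differentiable ('D_z f) u) :
    ('D_v ('D_z f) u) i j = 'D_v ('D_z (fun x => f x i j)) u.
  by rewrite (derive_entry _ _ _ dz); exact: near_eq_derive (E z).
apply: etrans (DE x y dy) _; apply: etrans (esym (DE y x dx)).
apply: schwarz_real.
- by apply: filterS df => v; exact: differentiable_entry.
- exact: near_eq_differentiable (E x) (differentiable_entry _ _ dx).
- exact: near_eq_differentiable (E y) (differentiable_entry _ _ dy).
Qed.

End InvSchwarz.

(* Unification would otherwise unfold derivatives into limits of difference
   quotients, and diverge. *)
Local Opaque derive diff.

(** * The Levi-Civita connection in a chart *)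

Section SmoothOn.
Context {R : realType} {d : nat} {V : normedModType R}.
Context (U : set 'rV[R]_d) (f : 'rV[R]_d -> V) (fU : smooth_on U f).

Lemma smooth_differentiable p : U p -> differentiable f p.
Proof. exact: (fU [::]). Qed.

Lemma smooth_differentiable1 p x : U p -> differentiable ('D_x f) p.
Proof. exact: (fU [:: x]). Qed.

Lemma smooth_differentiable2 p x y : U p -> differentiable ('D_x ('D_y f)) p.
Proof. exact: (fU [:: x; y]). Qed.

End SmoothOn.

Lemma smooth_schwarz (R : realType) (d p q : nat) (U : set 'rV[R]_d)
    (f : 'rV[R]_d -> 'M[R]_(p, q)) u x y :
  open U -> smooth_on U f -> U u -> 'D_x ('D_y f) u = 'D_y ('D_x f) u.
Proof.
move=> oU sf Uu; apply: schwarz.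
- by apply: filterS (open_nbhs_nbhs (conj oU Uu)) => v; exact: smooth_differentiable.
- exact: smooth_differentiable1 Uu.
- exact: smooth_differentiable1 Uu.
Qed.

Section MatrixLinear.
Context {R : realType} {p q : nat}.
Implicit Types (A B : 'M[R]_(p, q)).

Lemma addmx_entry A B i j : (A + B) i j = A i j + B i j.
Proof. by rewrite mxE. Qed.

Lemma oppmx_entry A i j : (- A) i j = - A i j.
Proof. by rewrite mxE. Qed.

Lemma scalemx_entry k A i j : (k *: A) i j = k * A i j.
Proof. by rewrite mxE. Qed.

Lemma zeromx_entry i j : (0 : 'M[R]_(p, q)) i j = 0.
Proof. by rewrite mxE. Qed.

Definition mx_linE := (addmx_entry, oppmx_entry, scalemx_entry, zeromx_entry).

End MatrixLinear.

Definition mulmx_linE := (mulmxDl, mulmxDr, mulmxBl, mulmxBr, mulNmx, mulmxN).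

(* For linear identities between variables: on terms containing derivatives
   [ring] would compare its atoms up to conversion, which is intractable. *)
Ltac mx_linear := intros; apply/matrixP => ? ?; rewrite !mx_linE; ring.

Section Inner.
Context {R : realType} {d : nat}.
Implicit Types (G : 'M[R]_d) (x y z : 'rV[R]_d).

Lemma innerDl G x y z : inner G (x + y) z = inner G x z + inner G y z.
Proof. by rewrite /inner !mulmxDl mxE. Qed.
Lemma innerDr G x y z : inner G z (x + y) = inner G z x + inner G z y.
Proof. by rewrite /inner linearD mulmxDr mxE. Qed.
Lemma innerNl G x z : inner G (- x) z = - inner G x z.
Proof. by rewrite /inner !mulNmx mxE. Qed.
Lemma innerNr G x z : inner G z (- x) = - inner G z x.
Proof. by rewrite /inner linearN mulmxN mxE. Qed.
Lemma innerBl G x y z : inner G (x - y) z = inner G x z - inner G y z.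
Proof. by rewrite innerDl innerNl. Qed.
Lemma innerBr G x y z : inner G z (x - y) = inner G z x - inner G z y.
Proof. by rewrite innerDr innerNr. Qed.
Lemma innerZl G k x z : inner G (k *: x) z = k * inner G x z.
Proof. by rewrite /inner -!scalemxAl mxE. Qed.
Lemma innerZr G k x z : inner G z (k *: x) = k * inner G z x.
Proof. by rewrite /inner linearZ -scalemxAr mxE. Qed.
Lemma inner0l G x : inner G 0 x = 0.
Proof. by rewrite /inner !mul0mx mxE. Qed.
Lemma inner0r G x : inner G x 0 = 0.
Proof. by rewrite /inner trmx0 mulmx0 mxE. Qed.

Lemma innerC G x y : G^T = G -> inner G x y = inner G y x.
Proof.
move=> GT; rewrite /inner -[in LHS](trmxK (x *m G *m y^T)) [LHS]mxE.
by rewrite !trmx_mul trmxK GT mulmxA.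
Qed.

Lemma inner_mulmxr G x y (A : 'M[R]_d) :
  inner G x (y *m A) = inner (G *m A^T) x y.
Proof. by rewrite /inner trmx_mul !mulmxA. Qed.

Lemma inner_mulmxl G x y (A : 'M[R]_d) :
  inner G (x *m A) y = inner (A *m G) x y.
Proof. by rewrite /inner !mulmxA. Qed.

Lemma innerMD G G' x y : inner (G + G') x y = inner G x y + inner G' x y.
Proof. by rewrite /inner mulmxDr mulmxDl mxE. Qed.

Lemma innerMN G x y : inner (- G) x y = - inner G x y.
Proof. by rewrite /inner mulmxN mulNmx mxE. Qed.

Lemma innerMT G x y : inner G^T x y = inner G y x.
Proof.
rewrite /inner -[in LHS](trmxK (x *m G^T *m y^T)) [LHS]mxE.
by rewrite !trmx_mul !trmxK mulmxA.
Qed.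

Lemma derive_inner n (G : 'rV[R]_n -> 'M[R]_d) (X Y : 'rV[R]_n -> 'rV[R]_d) u v :
  differentiable G u -> differentiable X u -> differentiable Y u ->
  'D_v (fun q => inner (G q) (X q) (Y q)) u =
  inner ('D_v G u) (X u) (Y u) + inner (G u) ('D_v X u) (Y u)
  + inner (G u) (X u) ('D_v Y u).
Proof.
move=> dG dX dY; rewrite /inner.
have dXG : differentiable (fun q => X q *m G q) u by exact: differentiable_mulmx.
have dYt : differentiable (fun q => (Y q)^T) u by exact: differentiable_trmx.
rewrite -derive_entry; last exact: differentiable_mulmx.
rewrite (derive_mulmx v dXG dYt) (derive_mulmx v dX dG) (derive_trmx v dY).
by rewrite mulmxDl !mx_linE; ring.
Qed.

Lemma differentiable_inner n (G : 'rV[R]_n -> 'M[R]_d)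
    (X Y : 'rV[R]_n -> 'rV[R]_d) u :
  differentiable G u -> differentiable X u -> differentiable Y u ->
  differentiable (fun q => inner (G q) (X q) (Y q)) u.
Proof.
move=> dG dX dY; apply: differentiable_entry.
by apply: differentiable_mulmx; [exact: differentiable_mulmx|exact: differentiable_trmx].
Qed.

End Inner.

Definition innerE := (@innerDl, @innerDr, @innerBl, @innerBr, @innerNl, @innerNr,
  @innerZl, @innerZr).

(** * Connections as matrix-valued functions *)

Section ConnectionMatrix.
Context {R : realType} {d n : nat}.
Implicit Types (A B : 'rV[R]_n -> 'M[R]_d) (V : 'rV[R]_n -> 'rV[R]_d).

(** Curvature of the connection with matrix [A] along [x] and [B] along [y]; the action from the
    right turns the commutator into [B A - A B]. *)
Definition conn_curv (x y : 'rV[R]_n) A B (u : 'rV[R]_n) : 'M[R]_d :=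
  'D_x B u - 'D_y A u + B u *m A u - A u *m B u.

(** Covariant derivative in a constant direction. Base and fibre have separate dimensions [n] and
    [d], so that it serves both for a chart of the ambient manifold and for fields along an
    immersion. *)
Definition along x A V : 'rV[R]_n -> 'rV[R]_d := fun u => 'D_x V u + V u *m A u.

Lemma along_differentiable x A V u :
  differentiable V u -> differentiable ('D_x V) u -> differentiable A u ->
  differentiable (along x A V) u.
Proof.
by move=> dV dxV dA; apply: differentiableD => //; exact: differentiable_mulmx.
Qed.

Lemma alongD x A V V' u : differentiable V u -> differentiable V' u ->
  along x A (fun q => V q + V' q) u = along x A V u + along x A V' u.
Proof.
move=> dV dV'; rewrite /along mulmxDl.
have -> : 'D_x (fun q => V q + V' q) u = 'D_x V u + 'D_x V' u.
  by apply: deriveD; exact: diff_derivable.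
exact: addrACA.
Qed.

Lemma along_scale x A (k : 'rV[R]_n -> R) V u :
  differentiable k u -> differentiable V u ->
  along x A (fun q => k q *: V q) u = 'D_x k u *: V u + k u *: along x A V u.
Proof.
by move=> dk dV; rewrite /along (derive_scale x dk dV) -scalemxAl scalerDr addrA.
Qed.

Lemma alongB x A V V' u : differentiable V u -> differentiable V' u ->
  along x A (fun q => V q - V' q) u = along x A V u - along x A V' u.
Proof.
move=> dV dV'; rewrite /along mulmxBl.
have -> : 'D_x (fun q => V q - V' q) u = 'D_x V u - 'D_x V' u.
  by apply: deriveB; exact: diff_derivable.
by rewrite opprD addrACA.
Qed.

Lemma ricci_identity x y A B V u :
  (\near u, differentiable V u) ->
  differentiable ('D_x V) u -> differentiable ('D_y V) u ->
  differentiable A u -> differentiable B u ->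
  along x A (along y B V) u - along y B (along x A V) u
  = V u *m conn_curv x y A B u.
Proof.
move=> dV dxV dyV dA dB; have dVu := nbhs_singleton dV.
rewrite {1 3}/along deriveD; [|exact: diff_derivable|]; last first.
  by apply: diff_derivable; exact: differentiable_mulmx.
rewrite [X in _ - (X + _)]deriveD; [|exact: diff_derivable|]; last first.
  by apply: diff_derivable; exact: differentiable_mulmx.
rewrite (schwarz dV dxV dyV) !(derive_mulmx _ dVu)// /conn_curv /along.
rewrite !mulmx_linE !mulmxA.
have E (a b c e f g h : 'rV[R]_d) :
    a + (b + c) + (e + f) - (a + (e + g) + (b + h)) = c - g + f - h by mx_linear.
exact: E.
Qed.

Lemma derive_inner_along (M : 'rV[R]_n -> 'M[R]_d) x A V V' u :
  differentiable M u -> differentiable V u -> differentiable V' u ->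
  'D_x M u = A u *m M u + M u *m (A u)^T ->
  'D_x (fun q => inner (M q) (V q) (V' q)) u =
  inner (M u) (along x A V u) (V' u) + inner (M u) (V u) (along x A V' u).
Proof.
move=> dM dV dV' DM; rewrite (derive_inner x dM dV dV') DM.
rewrite innerMD -inner_mulmxl -inner_mulmxr /along innerDl innerDr.
have L (a b c e : R) : a + b + c + e = c + a + (e + b) by ring.
exact: L.
Qed.

End ConnectionMatrix.

Section Christoffel.
Context {R : realType} {d : nat}.
Context (U : set 'rV[R]_d) (G : 'rV[R]_d -> 'M[R]_d).
Context (oU : open U) (sG : smooth_on U G).
Context (Gsym : forall p, U p -> (G p)^T = G p).
Context (Gpos : forall p x, U p -> x != 0 -> 0 < inner (G p) x x).
Implicit Types (p x y z : 'rV[R]_d).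

Let nearU p : U p -> \near p, U p.
Proof. by move=> Up; exact: open_nbhs_nbhs. Qed.

Lemma metric_unit p : U p -> G p \in unitmx.
Proof.
move=> Up; rewrite -row_free_unit -kermx_eq0; apply/rowV0P => x /sub_kermxP xG.
apply/eqP; apply: contraT => /(Gpos Up); rewrite /inner xG mul0mx mxE.
by rewrite ltxx.
Qed.

Lemma inner_injl p x y : U p -> (forall z, inner (G p) x z = inner (G p) y z) -> x = y.
Proof.
move=> Up xy; apply/eqP; rewrite -subr_eq0; apply: contraT => /(Gpos Up).
by rewrite innerBl xy subrr ltxx.
Qed.

Let dGsym p x : U p -> ('D_x G p)^T = 'D_x G p.
Proof.
move=> Up; rewrite -derive_trmx; last exact: smooth_differentiable sG _ Up.
by apply: near_eq_derive; apply: filterS (nearU Up) => q; exact: Gsym.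
Qed.

(** The bilinear form [(y, z) |-> (D_y g)(x, z)]. Together with its transpose it supplies two of the
    three Koszul terms. *)
Definition dmetric_mx p x : 'M[R]_d :=
  \matrix_(i, k) (x *m 'D_(delta_mx 0 i) G p) 0 k.

(* Locked: otherwise rewriting with [mulmxA] looks inside. *)
Fact christoffel_key : unit. Proof. exact: tt. Qed.

(** The connection form evaluated at [x], as an endomorphism: the matrix of [y |-> Gamma(x, y)]. *)
Definition christoffel_mx p x : 'M[R]_d := locked_with christoffel_key
  ((2^-1 *: ('D_x G p + dmetric_mx p x - (dmetric_mx p x)^T)) *m invmx (G p)).

Lemma dmetric_mxE p x y : U p -> y *m dmetric_mx p x = x *m 'D_y G p.
Proof.
move=> Up; have dG := smooth_differentiable sG Up.
have -> : 'D_y G p = \sum_i y 0 i *: 'D_(delta_mx 0 i) G p.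
  rewrite {1}[y]row_sum_delta deriveE// linear_sum/=; apply: eq_bigr => i _.
  by rewrite linearZ/= -deriveE.
rewrite mulmx_sumr; apply/rowP => k; rewrite summxE mxE.
by apply: eq_bigr => i _; rewrite [dmetric_mx _ _ _ _]mxE -scalemxAr mx_linE.
Qed.

Lemma inner_dmetric_mx p x y z : U p ->
  inner (dmetric_mx p x) y z = inner ('D_y G p) x z.
Proof. by move=> Up; rewrite /inner dmetric_mxE. Qed.

Lemma mulmx_entry_inner (M : 'M[R]_d) x k :
  (x *m M) 0 k = inner M x (delta_mx 0 k).
Proof. by rewrite /inner trmx_delta -colE [RHS]mxE. Qed.

Let christoffel_lower p x y k : U p ->
  (y *m ('D_x G p + dmetric_mx p x - (dmetric_mx p x)^T)) 0 k =
  inner ('D_x G p) y (delta_mx 0 k) + inner ('D_y G p) x (delta_mx 0 k)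
  - inner ('D_(delta_mx 0 k) G p) x y.
Proof.
move=> Up; rewrite mulmx_entry_inner !innerMD innerMN innerMT.
rewrite !inner_dmetric_mx//.
Qed.

Lemma christoffelE p x y : U p -> christoffel G p x y = y *m christoffel_mx p x.
Proof.
move=> Up; rewrite /christoffel /christoffel_mx !locked_withE mulmxA; congr (_ *m _).
have dG := smooth_differentiable sG Up.
have cst_inner a b c : 'D_a (fun q => inner (G q) b c) p = inner ('D_a G p) b c.
  rewrite (derive_inner a dG (differentiable_cst b p) (differentiable_cst c p)).
  by rewrite !derive_cst inner0l inner0r !addr0.
apply/rowP => k; rewrite mxE !cst_inner -scalemxAr mx_linE christoffel_lower//.
by rewrite mulrC.
Qed.

(** Vanishing torsion: exchanging [x] and [y] exchanges two Koszul terms, and the third is symmetric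
    because derivatives of [G] are. *)
Lemma christoffel_mx_sym p x y : U p ->
  y *m christoffel_mx p x = x *m christoffel_mx p y.
Proof.
move=> Up; rewrite /christoffel_mx !locked_withE !mulmxA; congr (_ *m _).
apply/rowP => k; rewrite -!scalemxAr !mx_linE !christoffel_lower//.
rewrite [X in _ = _ * (X - _)]addrC; congr (_ * (_ - _)).
exact: innerC (dGsym _ Up).
Qed.

Lemma christoffel_mxG p x : U p ->
  christoffel_mx p x *m G p
  = 2^-1 *: ('D_x G p + dmetric_mx p x - (dmetric_mx p x)^T).
Proof. by move=> Up; rewrite /christoffel_mx !locked_withE mulmxKV// metric_unit. Qed.

(** The part [dmetric_mx - dmetric_mx^T] is skew and disappears when [christoffel_mx *m G] is added
    to its transpose, while the half of the symmetric ['D_x G] is doubled. *)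
Lemma metric_compat p x : U p ->
  'D_x G p = christoffel_mx p x *m G p + G p *m (christoffel_mx p x)^T.
Proof.
move=> Up; rewrite -{2}(Gsym Up) -trmx_mul christoffel_mxG//.
have half_sym (A B : 'M[R]_d) : A^T = A ->
    A = 2^-1 *: (A + B - B^T) + (2^-1 *: (A + B - B^T))^T.
  by move=> /matrixP AT; apply/matrixP => i j; have := AT i j; rewrite !mxE => ->; field.
exact: half_sym (dGsym x Up).
Qed.

Let dmetric_mxD p x y : dmetric_mx p (x + y) = dmetric_mx p x + dmetric_mx p y.
Proof.
apply/matrixP => i j; rewrite mx_linE [LHS]mxE mulmxDl mx_linE.
by congr (_ + _); rewrite [RHS]mxE.
Qed.

Let dmetric_mxZ p k x : dmetric_mx p (k *: x) = k *: dmetric_mx p x.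
Proof.
apply/matrixP => i j; rewrite mx_linE [LHS]mxE -scalemxAl mx_linE.
by congr (_ * _); rewrite [RHS]mxE.
Qed.

Lemma christoffel_mxD p x y : U p ->
  christoffel_mx p (x + y) = christoffel_mx p x + christoffel_mx p y.
Proof.
move=> Up; have dG := smooth_differentiable sG Up.
rewrite /christoffel_mx !locked_withE -mulmxDl -scalerDr derive_dirD//; congr (_ *: _ *m _).
by rewrite dmetric_mxD linearD/= [in LHS]addrACA opprD [LHS]addrACA.
Qed.

Lemma christoffel_mxZ p k x : U p ->
  christoffel_mx p (k *: x) = k *: christoffel_mx p x.
Proof.
move=> Up; have dG := smooth_differentiable sG Up.
rewrite /christoffel_mx !locked_withE scalemxAl scalerA [k * _]mulrC -scalerA derive_dirZ//.
by rewrite dmetric_mxZ linearZ/= -scalerDr -scalerBr.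
Qed.

Lemma christoffel_mx_sum p x : U p ->
  christoffel_mx p x = \sum_i x 0 i *: christoffel_mx p (delta_mx 0 i).
Proof.
move=> Up; have -> : christoffel_mx p x
    = christoffel_mx p (\sum_i x 0 i *: delta_mx 0 i) by rewrite -row_sum_delta.
elim/big_ind2: _ => [|a A b B <- <-|i _].
- by rewrite -(scale0r 0) christoffel_mxZ// scale0r.
- exact: christoffel_mxD.
- exact: christoffel_mxZ.
Qed.

Lemma differentiable_christoffel_mx p x : U p ->
  differentiable (christoffel_mx^~ x) p.
Proof.
move=> Up; have dD := smooth_differentiable1 sG _ Up.
have dN : differentiable (dmetric_mx^~ x) p.
  apply: differentiable_mx => i j; under eq_fun do rewrite mxE.
  have dxD := differentiable_mulmx (differentiable_cst x p) (dD (delta_mx 0 i)).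
  exact: differentiable_entry dxD.
rewrite /christoffel_mx; under eq_fun do rewrite locked_withE.
apply: differentiable_mulmx.
  apply: differentiableZ; apply: differentiableB; first exact: differentiableD.
  exact: differentiable_trmx.
apply: differentiable_invmx; first exact: metric_unit.
exact: smooth_differentiable Up.
Qed.

End Christoffel.

Section LieBracketCst.
Context {R : realType} {d : nat}.

Lemma lie_bracket_cst (x y u : 'rV[R]_d) : lie_bracket (cst x) (cst y) u = 0.
Proof. by rewrite /lie_bracket !derive_cst subrr. Qed.

End LieBracketCst.

(** * Symmetries of the Riemann tensor *)

Section Riemann.
Context {R : realType} {d : nat}.
Context (U : set 'rV[R]_d) (G : 'rV[R]_d -> 'M[R]_d).
Context (oU : open U) (sG : smooth_on U G).
Context (Gsym : forall p, U p -> (G p)^T = G p).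
Context (Gpos : forall p x, U p -> x != 0 -> 0 < inner (G p) x x).
Implicit Types (p x y z w : 'rV[R]_d).

Let nearU p : U p -> \near p, U p.
Proof. by move=> Up; exact: open_nbhs_nbhs. Qed.

Notation Gam := (christoffel_mx G).

Let dGam p x : U p -> differentiable (Gam^~ x) p.
Proof. exact: (differentiable_christoffel_mx sG Gpos). Qed.

Definition riem_mx p x y : 'M[R]_d := conn_curv x y (Gam^~ x) (Gam^~ y) p.

Lemma riemE p x y z : U p -> riem G p x y z = z *m riem_mx p x y.
Proof.
move=> Up; rewrite /riem /curv.
have E v q : U q -> covd (christoffel G) (cst v) (cst z) q = z *m Gam q v.
  by move=> Uq; rewrite /covd derive_cst add0r (christoffelE sG).
have DE v w : 'D_v (covd (christoffel G) (cst w) (cst z)) p = z *m 'D_v (Gam^~ w) p.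
  rewrite -derive_mulmxr; last exact: dGam.
  by apply: near_eq_derive; apply: filterS (nearU Up) => q; exact: E.
have -> : covd (christoffel G) (lie_bracket (cst x) (cst y)) (cst z) p = 0.
  rewrite /covd lie_bracket_cst derive0 add0r (christoffelE sG)//.
  have -> : Gam p 0 = 0.
    by rewrite -{1}(scale0r (0 : 'rV[R]_d)) (christoffel_mxZ sG)// scale0r.
  by rewrite mulmx0.
have E2 v w : covd (christoffel G) (cst v) (covd (christoffel G) (cst w) (cst z)) p
    = z *m 'D_v (Gam^~ w) p + z *m Gam p w *m Gam p v.
  by rewrite -DE -E// -(christoffelE sG).
rewrite subr0 !E2.
rewrite /riem_mx /conn_curv !mulmx_linE !mulmxA.
have L (e1 e2 e3 e4 : 'rV[R]_d) : e1 + e2 - (e3 + e4) = e1 - e3 + e2 - e4.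
  by mx_linear.
exact: L.
Qed.

Lemma riem_mx_skew p x y : riem_mx p y x = - riem_mx p x y.
Proof.
rewrite /riem_mx /conn_curv.
have L (e1 e2 e3 e4 : 'M[R]_d) : e1 - e2 + e3 - e4 = - (e2 - e1 + e4 - e3).
  by mx_linear.
exact: L.
Qed.

Lemma riem_mxD p x x' y : U p ->
  riem_mx p (x + x') y = riem_mx p x y + riem_mx p x' y.
Proof.
move=> Up; rewrite /riem_mx /conn_curv (derive_dirD _ _ (dGam y Up)).
have -> : 'D_y (Gam^~ (x + x')) p = 'D_y (Gam^~ x) p + 'D_y (Gam^~ x') p.
  rewrite -deriveD; [|by apply: diff_derivable; exact: dGam..].
  apply: near_eq_derive; apply: filterS (nearU Up) => q Uq.
  exact: (christoffel_mxD sG).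
rewrite (christoffel_mxD sG _ _ Up) !mulmx_linE.
have L (a b e f h k l m : 'M[R]_d) :
  a + b - (e + f) + (h + k) - (l + m) = a - e + h - l + (b - f + k - m) by mx_linear.
exact: L.
Qed.

Lemma riem_mxZ p k x y : U p -> riem_mx p (k *: x) y = k *: riem_mx p x y.
Proof.
move=> Up; rewrite /riem_mx /conn_curv (derive_dirZ _ _ (dGam y Up)).
have -> : 'D_y (Gam^~ (k *: x)) p = k *: 'D_y (Gam^~ x) p.
  rewrite -(derive_scalel k _ (dGam x Up)).
  apply: near_eq_derive; apply: filterS (nearU Up) => q Uq.
  exact: (christoffel_mxZ sG).
rewrite (christoffel_mxZ sG _ _ Up) -scalemxAl -scalemxAr.
have L (a e h l : 'M[R]_d) :
  k *: a - k *: e + k *: h - k *: l = k *: (a - e + h - l) by mx_linear.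
exact: L.
Qed.

(** Vanishing torsion and its first derivative let the twelve terms cancel in pairs. *)
Lemma riem_bianchi p x y z : U p ->
  z *m riem_mx p x y + x *m riem_mx p y z + y *m riem_mx p z x = 0.
Proof.
move=> Up; have E v w v' : v' *m 'D_v (Gam^~ w) p = w *m 'D_v (Gam^~ v') p.
  rewrite -!derive_mulmxr; [|exact: dGam..].
  apply: near_eq_derive; apply: filterS (nearU Up) => q Uq.
  exact: (christoffel_mx_sym oU sG Gsym).
suff alg (D : 'rV[R]_d -> 'rV[R]_d -> 'M[R]_d) (C : 'rV[R]_d -> 'M[R]_d) :
    (forall v w v', v' *m D v w = w *m D v v') ->
    (forall v w, w *m C v = v *m C w) ->
    z *m (D x y - D y x + C y *m C x - C x *m C y)
    + x *m (D y z - D z y + C z *m C y - C y *m C z)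
    + y *m (D z x - D x z + C x *m C z - C z *m C x) = 0.
  apply: (alg (fun v w => 'D_v (Gam^~ w) p) (Gam p)) => // v w.
  exact: (christoffel_mx_sym oU sG Gsym).
move=> DE CE; rewrite !mulmx_linE !mulmxA (DE y x z) (DE z y x) (DE x z y).
rewrite (CE x z) (CE y x) (CE z y).
have L (a b c e f h : 'rV[R]_d) :
  a - b + e - f + (b - c + f - h) + (c - a + h - e) = 0 by mx_linear.
exact: L.
Qed.

(** Differentiating [metric_compat] expresses the second derivatives of [G] through the connection,
    and these commute. After [metric_compat] is substituted for the remaining first derivatives, the
    equality says that [riem_mx] times [G] is a skew matrix. *)
Lemma riem_inner_skew p x y z w : U p ->
  inner (G p) (z *m riem_mx p x y) w = - inner (G p) z (w *m riem_mx p x y).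
Proof.
move=> Up; rewrite inner_mulmxl inner_mulmxr -innerMN; congr (inner _ z w).
have dG := smooth_differentiable sG Up.
have D v w' : 'D_v ('D_w' G) p =
    'D_v (Gam^~ w') p *m G p + Gam p w' *m 'D_v G p
    + ('D_v G p *m (Gam p w')^T + G p *m ('D_v (Gam^~ w') p)^T).
  have -> : 'D_v ('D_w' G) p =
     'D_v (fun q => Gam q w' *m G q + G q *m (Gam q w')^T) p.
    apply: near_eq_derive; apply: filterS (nearU Up) => q Uq.
    exact: (metric_compat oU sG Gsym Gpos).
  have dGw := dGam w' Up; have dGwT := differentiable_trmx dGw.
  rewrite deriveD; [|by apply: diff_derivable; exact: differentiable_mulmx..].
  by rewrite !derive_mulmx// derive_trmx.
suff alg (E : 'rV[R]_d -> 'rV[R]_d -> 'M[R]_d) (C : 'rV[R]_d -> 'M[R]_d)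
    (M : 'M[R]_d) (dM : 'rV[R]_d -> 'M[R]_d) :
    (forall v, dM v = C v *m M + M *m (C v)^T) ->
    E x y *m M + C y *m dM x + (dM x *m (C y)^T + M *m (E x y)^T)
    = E y x *m M + C x *m dM y + (dM y *m (C x)^T + M *m (E y x)^T) ->
    (E x y - E y x + C y *m C x - C x *m C y) *m M
    = - (M *m (E x y - E y x + C y *m C x - C x *m C y)^T).
  apply: (alg (fun v w => 'D_v (Gam^~ w) p) (Gam p) (G p) (fun v => 'D_v G p)).
    by move=> v; exact: (metric_compat oU sG Gsym Gpos).
  exact: etrans (esym (D x y)) (etrans (smooth_schwarz x y oU sG Up) (D y x)).
have trmxD (A B : 'M[R]_d) : (A + B)^T = A^T + B^T by exact: linearD.
have trmxN (A : 'M[R]_d) : (- A)^T = - A^T by exact: linearN.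
move=> dME; rewrite !dME !trmxD !trmxN !trmx_mul !mulmx_linE !mulmxA.
have L (a a' b b' c c' d' e f' f g g' : 'M[R]_d) :
    a + (b + c) + (c' + f + a') = e + (b' + c') + (c + f' + g) ->
    a - e + b - b' = - (a' - g + f - f').
  by move=> /matrixP H; apply/matrixP => i j; have := H i j; rewrite !mx_linE; lra.
exact: L.
Qed.

End Riemann.

(** * Pull-back of the Levi-Civita connection along a map *)

Section Pullback.
Context {R : realType} {d n : nat}.
Context (U : set 'rV[R]_d) (G : 'rV[R]_d -> 'M[R]_d).
Context (oU : open U) (sG : smooth_on U G).
Context (Gsym : forall p, U p -> (G p)^T = G p).
Context (Gpos : forall p x, U p -> x != 0 -> 0 < inner (G p) x x).
Context (W : set 'rV[R]_n) (F : 'rV[R]_n -> 'rV[R]_d).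
Context (oW : open W) (sF : smooth_on W F) (FU : forall u, W u -> U (F u)).
Implicit Types (u x y z w : 'rV[R]_n).

Let nearW u : W u -> \near u, W u.
Proof. by move=> Wu; exact: open_nbhs_nbhs. Qed.

Let nearU p : U p -> \near p, U p.
Proof. by move=> Up; exact: open_nbhs_nbhs. Qed.

Notation Gam := (christoffel_mx G).

Definition pull_mx x : 'rV[R]_n -> 'M[R]_d := fun q => Gam (F q) ('D_x F q).

Let pull_sum y q : W q ->
  pull_mx y q = \sum_i 'D_y F q 0 i *: Gam (F q) (delta_mx 0 i).
Proof. by move=> Wq; exact: (christoffel_mx_sum sG _ (FU Wq)). Qed.

Let dF u : W u -> differentiable F u.
Proof. exact: smooth_differentiable. Qed.

Let dDF y u : W u -> differentiable ('D_y F) u.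
Proof. exact: smooth_differentiable1. Qed.

Let dGami i u : W u -> differentiable (fun q => Gam (F q) (delta_mx 0 i)) u.
Proof.
move=> Wu; have dG := differentiable_christoffel_mx sG Gpos (delta_mx 0 i) (FU Wu).
exact: (differentiable_comp (dF Wu) dG).
Qed.

Lemma differentiable_pull_mx y u : W u -> differentiable (pull_mx y) u.
Proof.
move=> Wu; apply: (@near_eq_differentiable _ _ _
  (fun q => \sum_i 'D_y F q 0 i *: Gam (F q) (delta_mx 0 i))).
  by apply: filterS (nearW Wu) => q Wq; rewrite pull_sum.
apply: differentiable_bigsum => i; apply: differentiable_scale; last exact: dGami.
exact: differentiable_entry (dDF y Wu).
Qed.

(** [pull_mx y] depends on the point through [F q] and through the direction ['D_y F q]. Expanding
    the direction in the standard basis separates these two dependences into the two terms of a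
    product rule. *)
Lemma derive_pull_mx x y u : W u ->
  'D_x (pull_mx y) u = 'D_('D_x F u) (Gam^~ ('D_y F u)) (F u)
                       + Gam (F u) ('D_x ('D_y F) u).
Proof.
move=> Wu; have Up := FU Wu.
have dE i : differentiable (fun q => 'D_y F q 0 i) u.
  exact: differentiable_entry (dDF y Wu).
have -> : 'D_x (pull_mx y) u = 'D_x (fun q =>
    \sum_i 'D_y F q 0 i *: Gam (F q) (delta_mx 0 i)) u.
  by apply: near_eq_derive; apply: filterS (nearW Wu) => q Wq; rewrite pull_sum.
rewrite derive_bigsum; last first.
  by move=> i; apply: differentiable_scale; [exact: dE|exact: dGami].
have -> : 'D_('D_x F u) (Gam^~ ('D_y F u)) (F u) = 'D_('D_x F u) (fun p =>
    \sum_i 'D_y F u 0 i *: Gam p (delta_mx 0 i)) (F u).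
  apply: near_eq_derive; apply: filterS (nearU Up) => p Uq.
  exact: (christoffel_mx_sum sG).
have dG i : differentiable (Gam^~ (delta_mx 0 i)) (F u).
  exact: (differentiable_christoffel_mx sG Gpos).
rewrite derive_bigsum; last by move=> i; apply: differentiableZ; exact: dG.
rewrite (christoffel_mx_sum sG _ Up) -big_split/=; apply: eq_bigr => i _.
rewrite (derive_scale _ (dE i) (dGami i Wu)) addrC; congr (_ + _).
  by congr (_ *: _); exact: esym (derive_entry 0 i x (dDF y Wu)).
apply: etrans (esym (derive_scalel _ _ (dG i))).
by congr (_ *: _); exact: derive_comp (dF Wu) (dG i).
Qed.

(** The second summands of [derive_pull_mx] are symmetric in [x] and [y] by Schwarz, so they
    cancel. *)
Lemma conn_curv_pull x y u : W u ->
  conn_curv x y (pull_mx x) (pull_mx y) u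
  = riem_mx G (F u) ('D_x F u) ('D_y F u).
Proof.
move=> Wu; have L (a a' b b' c c' e f : 'M[R]_d) :
    a' = a + b -> c' = c + b' -> b = b' -> a' - c' + e - f = a - c + e - f.
  by move=> -> -> ->; congr (_ + _ - _); rewrite opprD addrACA subrr addr0.
apply: L (derive_pull_mx x y Wu) (derive_pull_mx y x Wu) _.
exact: (f_equal (Gam (F u)) (smooth_schwarz x y oW sF Wu)).
Qed.

Lemma along_compat x (V1 V2 : 'rV[R]_n -> 'rV[R]_d) u : W u ->
  differentiable V1 u -> differentiable V2 u ->
  'D_x (fun q => inner (G (F q)) (V1 q) (V2 q)) u =
  inner (G (F u)) (along x (pull_mx x) V1 u) (V2 u)
  + inner (G (F u)) (V1 u) (along x (pull_mx x) V2 u).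
Proof.
move=> Wu dV1 dV2; have dG := smooth_differentiable sG (FU Wu).
have dGF : differentiable (fun q => G (F q)) u := differentiable_comp (dF Wu) dG.
have DG := metric_compat oU sG Gsym Gpos ('D_x F u) (FU Wu).
have DGF := etrans (derive_comp x (dF Wu) dG) DG.
exact: (derive_inner_along (A := pull_mx x) dGF dV1 dV2 DGF).
Qed.

Lemma along_sym x y u : W u ->
  along x (pull_mx x) ('D_y F) u = along y (pull_mx y) ('D_x F) u.
Proof.
move=> Wu; apply: (f_equal2 +%R); first exact: smooth_schwarz x y oW sF Wu.
exact: (christoffel_mx_sym oU sG Gsym _ _ (FU Wu)).
Qed.

End Pullback.

(** * Contact metric geometry at a point *)

Section ContactPoint.
Context {R : realFieldType} {V : lmodType R}.
Context (g : V -> V -> R) (xi : V) (J A : V -> V) (F : V -> V -> V -> R).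
Implicit Types (x y z w : V).

Hypothesis gDl : forall x y z, g (x + y) z = g x z + g y z.
Hypothesis gZl : forall k x z, g (k *: x) z = k * g x z.
Hypothesis gC : forall x y, g x y = g y x.
Hypothesis g_inj : forall x y, (forall z, g x z = g y z) -> x = y.
Hypothesis J2 : forall x, J (J x) = - x + g x xi *: xi.
Hypothesis Jxi : J xi = 0.
Hypothesis gJ : forall x y, g (J x) y = - g x (J y).

Let gDr x y z : g z (x + y) = g z x + g z y.
Proof. by rewrite gC gDl !(gC z). Qed.
Let gZr k x z : g z (k *: x) = k * g z x.
Proof. by rewrite gC gZl gC. Qed.
Let gNl x z : g (- x) z = - g x z.
Proof. by rewrite -scaleN1r gZl mulN1r. Qed.
Let gNr x z : g z (- x) = - g z x.
Proof. by rewrite gC gNl gC. Qed.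
Let g0l z : g 0 z = 0.
Proof. by rewrite -(scale0r (0 : V)) gZl mul0r. Qed.
Let g0r z : g z 0 = 0.
Proof. by rewrite gC g0l. Qed.
Let gE := (gDl, gDr, gNl, gNr, gZl, gZr).

Lemma gJxi x : g (J x) xi = 0.
Proof. by rewrite gJ Jxi g0r oppr0. Qed.

Lemma gJJ x y : g (J x) (J y) = g x y - g x xi * g y xi.
Proof. by rewrite gJ J2 !gE (gC y xi); ring. Qed.

(* [A x] is the covariant derivative of [xi] along [x], and [F x y z] is
   [g (nabla_x J y) z]. *)
Hypothesis dA : forall x y, g (A x) y - g (A y) x = 2 * g x (J y).
Hypothesis gAxi : forall x, g (A x) xi = 0.
Hypothesis FDr : forall x y z w, F x y (z + w) = F x y z + F x y w.
Hypothesis FZr : forall x y k z, F x y (k *: z) = k * F x y z.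
Hypothesis Fskew : forall x y z, F x y z = - F x z y.
Hypothesis Fcyc : forall x y z, F x y z + F y z x + F z x y = 0.
Hypothesis Fxi : forall x z, F x xi z = - g (J (A x)) z.
Hypothesis FJ : forall x y z,
  F x (J y) z - F x y (J z) = g (A x) y * g xi z + g y xi * g (A x) z.

Let FNr x y z : F x y (- z) = - F x y z.
Proof. by rewrite -scaleN1r FZr mulN1r. Qed.

Lemma A_xi : A xi = 0.
Proof.
apply: g_inj => z; rewrite g0l; have := dA xi z; have := gAxi z.
rewrite (gC xi (J z)) gJxi; lra.
Qed.

Let F_xiE y z : F xi y z = g (J (A z)) y - g (J (A y)) z.
Proof.
have := Fcyc xi y z; rewrite (Fskew y z xi) !Fxi; lra.
Qed.

(** Applying [J] to both arguments changes the sign of [F xi] by the derivative of [J ^ 2] ([H1]),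
    and preserves [F xi] by its expression through [nabla xi] ([H2]). *)
Lemma F_xi0 y z : F xi y z = 0.
Proof.
have J0 : g (J (A xi)) y = 0 by rewrite gJ A_xi g0l oppr0.
have Fyxi w : F xi w xi = 0.
  by rewrite F_xiE gJxi A_xi gJ g0l; ring.
have H1 : F xi (J y) (J z) = - F xi y z.
  have := FJ xi y (J z); rewrite J2 FDr FNr FZr Fyxi A_xi !g0l; lra.
have H2 : F xi (J y) (J z) = F xi y z.
  rewrite !F_xiE !gJJ !gAxi; have := dA (J y) z; have := dA (J z) y.
  have := gJJ y z; have := gJJ z y; rewrite (gC z y) !(gJ (A _)); lra.
lra.
Qed.

Lemma JA_sym y z : g (J (A y)) z = g (J (A z)) y.
Proof. by have := F_xi0 y z; rewrite F_xiE; lra. Qed.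

(** By [dA] the skew part of [A] is [- J], so [- S] is its symmetric part. *)
Let S x := - (A x + J x).

Lemma S_sym x y : g (S x) y = g x (S y).
Proof.
by rewrite (gC x (S y)) /S !gE; have := dA x y; have := gJ x y;
  rewrite (gC (J x) y) (gC x (J y)) (gC (J y) x); lra.
Qed.

Lemma S_xi : S xi = 0.
Proof. by rewrite /S A_xi Jxi addr0 oppr0. Qed.

Hypothesis JD : forall x y, J (x + y) = J x + J y.
Hypothesis JN : forall x, J (- x) = - J x.

(** [J A] is symmetric by [JA_sym], and so is [J ^ 2]; hence [J S] is symmetric. With [J] skew and
    [S] symmetric, this means that they anticommute. *)
Lemma S_J x : S (J x) = - J (S x).
Proof.
apply: g_inj => z; rewrite /S JN opprK JD !gE J2 !gE.
have := JA_sym x z; have := dA z (J x); rewrite J2 !gE.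
rewrite (gJ (A z) x) (gC z xi) (gC z x); lra.
Qed.

End ContactPoint.

(** * Consequences of the (kappa, mu)-condition at a point *)

Section KappaMuPoint.
Context {R : realFieldType} {V : lmodType R}.
Context (g : V -> V -> R) (xi : V) (J S : V -> V) (F S3 : V -> V -> V -> R).
Context (kappa mu : R).
Implicit Types (x y z w : V).

Hypothesis gDl : forall x y z, g (x + y) z = g x z + g y z.
Hypothesis gZl : forall k x z, g (k *: x) z = k * g x z.
Hypothesis gC : forall x y, g x y = g y x.
Hypothesis g_inj : forall x y, (forall z, g x z = g y z) -> x = y.
Hypothesis gxi : g xi xi = 1.
Hypothesis J2 : forall x, J (J x) = - x + g x xi *: xi.
Hypothesis Jxi : J xi = 0.
Hypothesis gJ : forall x y, g (J x) y = - g x (J y).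
Hypothesis JD : forall x y, J (x + y) = J x + J y.
Hypothesis JZ : forall k x, J (k *: x) = k *: J x.
Hypothesis SD : forall x y, S (x + y) = S x + S y.
Hypothesis SZ : forall k x, S (k *: x) = k *: S x.
Hypothesis S_sym : forall x y, g (S x) y = g x (S y).
Hypothesis S_xi : S xi = 0.
Hypothesis S_J : forall x, S (J x) = - J (S x).

(** This is the tensor [h'], recovered from [S = phi h'] by applying [- J]. *)
Let h x := - J (S x).
Let A x := - (S x + J x).

Let gDr x y z : g z (x + y) = g z x + g z y.
Proof. by rewrite gC gDl !(gC z). Qed.
Let gZr k x z : g z (k *: x) = k * g z x.
Proof. by rewrite gC gZl gC. Qed.
Let gNl x z : g (- x) z = - g x z.
Proof. by rewrite -scaleN1r gZl mulN1r. Qed.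
Let gNr x z : g z (- x) = - g z x.
Proof. by rewrite gC gNl gC. Qed.
Let g0l z : g 0 z = 0.
Proof. by rewrite -(scale0r (0 : V)) gZl mul0r. Qed.
Let g0r z : g z 0 = 0.
Proof. by rewrite gC g0l. Qed.
Let gE := (gDl, gDr, gNl, gNr, gZl, gZr).
Let JN x : J (- x) = - J x.
Proof. by rewrite -scaleN1r JZ scaleN1r. Qed.
Let SN x : S (- x) = - S x.
Proof. by rewrite -scaleN1r SZ scaleN1r. Qed.
Let Jx0 x : g (J x) xi = 0.
Proof. by rewrite gJ Jxi g0r oppr0. Qed.
Let gJJ' x y : g (J x) (J y) = g x y - g x xi * g y xi.
Proof. by rewrite gJ J2 !gE (gC y xi); ring. Qed.
Let Sx0 x : g (S x) xi = 0.
Proof. by rewrite S_sym S_xi g0r. Qed.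

Hypothesis FDr : forall x y z w, F x y (z + w) = F x y z + F x y w.
Hypothesis FZr : forall x y k z, F x y (k *: z) = k * F x y z.
Hypothesis FDl : forall x y z w, F (x + w) y z = F x y z + F w y z.
Hypothesis FZl : forall x y k z, F (k *: x) y z = k * F x y z.
Hypothesis Fskew : forall x y z, F x y z = - F x z y.
Hypothesis Fcyc : forall x y z, F x y z + F y z x + F z x y = 0.
Hypothesis Fxi : forall x z, F x xi z = - g (J (A x)) z.
Hypothesis FJ : forall x y z,
  F x (J y) z - F x y (J z) = g (A x) y * g xi z + g y xi * g (A x) z.
Hypothesis S3N : forall x y z, S3 x y (- z) = - S3 x y z.
Hypothesis S3J : forall x y z,
  S3 x (J y) z - S3 x y (J z) = - F x y (S z) - F x (S y) z.
Hypothesis F_xi : forall y z, F xi y z = 0.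
(* [g (R(x, y) xi) z], expressed by the derivatives of [J] and [S], vanishes
   for [x] and [y] orthogonal to [xi]. *)
Hypothesis nullity : forall x y z, g x xi = 0 -> g y xi = 0 ->
  F z x y = S3 x y z - S3 y x z.
Hypothesis nullity_xi : forall x z, g x xi = 0 ->
  kappa * g x z + mu * g (h x) z = g (J (A x)) z + g (S (A x)) z + S3 xi x z.

Let FNr x y z : F x y (- z) = - F x y z.
Proof. by rewrite -scaleN1r FZr mulN1r. Qed.

Let FNl x y z : F (- x) y z = - F x y z.
Proof. by rewrite -scaleN1r FZl mulN1r. Qed.

Let J2D x : g x xi = 0 -> J (J x) = - x.
Proof. by move=> x0; rewrite J2 x0 scale0r addr0. Qed.

(** Add [nullity_xi] at [(x, z)] and at [(J x, J z)]. The terms with [mu] and with the derivative of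
    [S] along [xi] change sign under this rotation and cancel, which leaves
    [kappa * g x z = g x z - g (S (S x)) z]. *)
Let SS_D x z : g x xi = 0 -> g z xi = 0 -> g (S (S x)) z = (1 - kappa) * g x z.
Proof.
move=> x0 z0; have H1 := nullity_xi z x0.
have H2 := nullity_xi (J z) (Jx0 x).
have H3 := S3J xi x (J z); rewrite !F_xi (J2D z0) S3N in H3.
have AJ : A (J x) = J (S x) + x by rewrite /A S_J (J2D x0) opprD !opprK.
rewrite /h S_J JN opprK (J2D (Sx0 x)) AJ JD SD S_J gJJ' z0 in H2.
move: H1 H2 H3; rewrite /h /A JN JD (J2D x0) SN SD S_J !gE !gJJ' z0.
by rewrite !(gJ (S x)); lra.
Qed.

Lemma SS x : g x xi = 0 -> S (S x) = (1 - kappa) *: x.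
Proof.
move=> x0; apply: g_inj => z; have := SS_D x0 (Jx0 (J z)).
by rewrite J2 !gE Sx0 x0; lra.
Qed.

Lemma SS_eq0 : kappa = 1 -> (forall x, g x x = 0 -> x = 0) -> forall x, S x = 0.
Proof.
move=> k1 gpos x; apply: gpos; rewrite S_sym.
have -> : S x = - S (J (J x)) by rewrite J2 SD SN SZ S_xi scaler0 addr0 opprK.
by rewrite SN SS ?Jx0// k1 subrr scale0r oppr0 g0r.
Qed.

Let FJ1 x y z : g y xi = 0 -> g z xi = 0 -> F x (J y) z = F x y (J z).
Proof. by move=> y0 z0; have := FJ x y z; rewrite (gC xi z) y0 z0; lra. Qed.

Let FJ2 x y z : g y xi = 0 -> g z xi = 0 -> F x (J y) (J z) = - F x y z.
Proof. by move=> y0 z0; rewrite FJ1// J2D// FNr. Qed.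

(* Almost Kaehler implies quasi-Kaehler. *)
Let quasi_kaehler x y z : g x xi = 0 -> g y xi = 0 -> g z xi = 0 ->
  F (J x) (J y) z = - F x y z.
Proof.
move=> x0 y0 z0; have := Fcyc x y z; have := Fcyc (J x) (J y) z.
have := Fcyc (J x) y (J z); have := Fcyc x (J y) (J z).
have := FJ1 (J x) y0 z0; have := FJ1 (J y) z0 x0; have := FJ1 (J z) x0 y0.
have := FJ2 x y0 z0; have := FJ2 y z0 x0; have := FJ2 z x0 y0; lra.
Qed.

Let FJl x y z : g x xi = 0 -> g y xi = 0 -> g z xi = 0 ->
  F (J x) y z = F x y (J z).
Proof.
move=> x0 y0 z0; have := quasi_kaehler x0 (Jx0 y) z0.
rewrite (J2D y0) (Fskew _ (- y)) FNr -Fskew (FJ1 _ y0 z0); have := Fskew (J x) y z.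
lra.
Qed.

(** Write [N(z; x, y)] for the identity [nullity]. In [N(z; x, y) - N(z; J x, J y) + N(J z; x, J y)
    + N(J z; J x, y)] the left sides add up to 0. On the right, [S3J] and [FJl] turn the derivatives
    of [S] into [2 * (F y x w - F x y w)] with [w = S (J z)], and this is [2 * F w x y] by the
    cyclic identity. *)
Let F_SJ x y z : g x xi = 0 -> g y xi = 0 -> g z xi = 0 -> F (S (J z)) x y = 0.
Proof.
move=> x0 y0 z0.
have := nullity z x0 y0; have := nullity z (Jx0 x) (Jx0 y).
have := nullity (J z) x0 (Jx0 y); have := nullity (J z) (Jx0 x) y0.
have := S3J x y (J z); have := S3J (J x) y z.
have := S3J y x (J z); have := S3J (J y) x z.
rewrite (J2D z0) !S3N S_J !FNr FNl.
have := FJl x0 y0 (Sx0 z); have := FJl y0 x0 (Sx0 z).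
have := FJl x0 (Sx0 y) z0; have := FJl y0 (Sx0 x) z0.
have := quasi_kaehler z0 x0 y0; have := FJ1 (J z) x0 y0; have := FJ2 z x0 y0.
have := Fcyc x y (J (S z)); have := Fskew y (J (S z)) x; lra.
Qed.

Hypothesis S3_eq0 : kappa = 1 -> forall x y z, S3 x y z = 0.

(* If [kappa <> 1], every [x] orthogonal to [xi] is of the form [S (J z)], by [SS]. *)
Let F_D x y z : g x xi = 0 -> g y xi = 0 -> g z xi = 0 -> F x y z = 0.
Proof.
move=> x0 y0 z0; have [k1|k1] := eqVneq kappa 1.
  by rewrite nullity// !S3_eq0// subrr.
have k0 : 1 - kappa != 0 by rewrite subr_eq0 eq_sym.
have -> : x = S (J (- (1 - kappa)^-1 *: J (S x))).
  by rewrite JZ SZ J2D ?Sx0// SN SS// scalerN scaleNr opprK scalerA mulVf// scale1r.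
by apply: F_SJ => //; rewrite gZl Jx0 mulr0.
Qed.

Let decomp x : x = - J (J x) + g x xi *: xi.
Proof. by rewrite J2 opprD opprK -addrA addNr addr0. Qed.

(** By [F_xi] and [F_D], the only components of [F] that survive have [x] orthogonal to [xi] and
    exactly one of [y], [z] along [xi]; they are given by [Fxi]. In operator form, [(nabla_x phi) y
    = g(x + h x, y) xi - eta(y) (x + h x)]. *)
Lemma nabla_phi x y z :
  F x y z = g (x + h x) y * g z xi - g y xi * g (x + h x) z.
Proof.
have Fx : F x y z = F (- J (J x)) y z.
  by rewrite {1}(decomp x) FDl FZl F_xi mulr0 addr0.
set x' := - J (J x) in Fx; have x'0 : g x' xi = 0 by rewrite /x' !gE Jx0 oppr0.
have y'0 : g (- J (J y)) xi = 0 by rewrite !gE Jx0 oppr0.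
have z'0 : g (- J (J z)) xi = 0 by rewrite !gE Jx0 oppr0.
have hE : h x' = h x.
  by rewrite /h /x' SN !J2 SD SN SZ S_xi scaler0 addr0 opprK.
have Fxi' w : F x' xi w = - g (x' + h x) w.
  by rewrite Fxi /A -hE /h !(JD, JN, gE, opprK) J2D// !gE; ring.
have Fy w : F x' y w = F x' (- J (J y)) w + g y xi * F x' xi w.
  by rewrite Fskew {1}(decomp y) FDr FZr opprD -!Fskew (Fskew x' w xi) mulrN opprK.
have Fy'z : F x' (- J (J y)) z = - (g z xi * F x' xi (- J (J y))).
  rewrite {1}(decomp z) FDr FZr (F_D x'0 y'0 z'0) add0r.
  by rewrite (Fskew x' (- J (J y))) mulrN.
rewrite Fx Fy Fy'z !Fxi' /x' /h !J2 !gE gxi !(gC xi) !Jx0; ring.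
Qed.

End KappaMuPoint.

(** * Curvature tensors of Kaehler type *)

Section KaehlerLike.
Context {R : realFieldType} {V : lmodType R}.
Context (Q : V -> V -> V -> V -> R) (J : V -> V).
Implicit Types (x y z w t : V).
Hypothesis Qadd : forall x t y z w, Q (x + t) y z w = Q x y z w + Q t y z w.
Hypothesis Qopp : forall x y z w, Q (- x) y z w = - Q x y z w.
Hypothesis Qskew12 : forall x y z w, Q y x z w = - Q x y z w.
Hypothesis Qskew34 : forall x y z w, Q x y w z = - Q x y z w.
Hypothesis Qbianchi : forall x y z w, Q x y z w + Q y z x w + Q z x y w = 0.

(** Octahedron argument: combine the four cyclic identities that have [w], [x], [y] and [z] in the
    last place; skew symmetry cancels everything but these two values. *)
Lemma curvature_pair_sym x y z w : Q z w x y = Q x y z w.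
Proof.
have := Qbianchi x y z w; have := Qbianchi y z w x.
have := Qbianchi z w x y; have := Qbianchi w x y z.
have := Qskew12 x w y z; have := Qskew12 y x w z; have := Qskew12 z y x w.
have := Qskew12 w z x y; have := Qskew12 w y z x; have := Qskew12 z x y w.
have := Qskew34 x y z w; have := Qskew34 y z x w; have := Qskew34 z x y w.
have := Qskew34 x w y z; have := Qskew34 z w x y; have := Qskew34 w y z x.
have := Qskew34 x z w y; have := Qskew12 x z w y; have := Qskew12 x z y w.
have := Qskew34 w x y z; have := Qskew34 w x z y.
have := Qskew34 y w x z; have := Qskew34 y w z x; have := Qskew12 y w x z.
have := Qskew34 x z y w; have := Qskew34 z x w y; have := Qskew34 y x z w.
lra.
Qed.

Hypothesis JD : forall x y, J (x + y) = J x + J y.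
Hypothesis JN : forall x, J (- x) = - J x.
Hypothesis QJ : forall x y z w, Q x y (J z) w = - Q x y z (J w).
(** Stands in for [J ^ 2 = - 1], which fails on [xi] in the application; there the tensor vanishes
    whenever an argument is [xi]. *)
Hypothesis QJJ : forall x y z w, Q x y (J (J z)) w = - Q x y z w.
Hypothesis Qhol : forall x, Q x (J x) (J x) x = 0.

Let Qadd2 x t y z w : Q y (x + t) z w = Q y x z w + Q y t z w.
Proof.
have := Qadd x t y z w; have := Qskew12 y (x + t) z w.
have := Qskew12 y x z w; have := Qskew12 y t z w; lra.
Qed.
Let Qadd3 x t y z w : Q z w (x + t) y = Q z w x y + Q z w t y.
Proof. by rewrite curvature_pair_sym Qadd !(curvature_pair_sym z w). Qed.
Let Qadd4 x t y z w : Q z w y (x + t) = Q z w y x + Q z w y t.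
Proof. by rewrite Qskew34 Qadd3 (Qskew34 z w y x) (Qskew34 z w y t); ring. Qed.
Let Qopp2 x y z w : Q y (- x) z w = - Q y x z w.
Proof. by rewrite Qskew12 Qopp (Qskew12 y x) opprK. Qed.
Let Qopp3 x y z w : Q z w (- x) y = - Q z w x y.
Proof. by rewrite curvature_pair_sym Qopp curvature_pair_sym. Qed.
Let Qopp4 x y z w : Q z w y (- x) = - Q z w y x.
Proof. by rewrite Qskew34 Qopp3 (Qskew34 z w y x) opprK. Qed.
Let QE := (Qadd, Qadd2, Qadd3, Qadd4, Qopp, Qopp2, Qopp3, Qopp4, JD, JN).

(** Adding [Qhol] at [x + y] and at [x - y] isolates the part of degree two in each of [x] and
    [y]. *)
Let Qpol x y :
  Q y (J y) (J x) x + Q y (J x) (J y) x + Q y (J x) (J x) y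
  + Q x (J y) (J y) x + Q x (J y) (J x) y + Q x (J x) (J y) y = 0.
Proof.
have := Qhol (x + y); have := Qhol (x - y); rewrite !QE.
have := Qhol x; have := Qhol y; lra.
Qed.

Let QJ34 x y z w : Q x y (J z) (J w) = Q x y z w.
Proof. by rewrite QJ Qskew34 QJJ (Qskew34 x y z w); ring. Qed.

Let QJ12 x y z w : Q (J x) (J y) z w = Q x y z w.
Proof. by rewrite -curvature_pair_sym QJ34 curvature_pair_sym. Qed.

Let QJ1 x y z w : Q (J x) y z w = - Q x (J y) z w.
Proof. by rewrite -curvature_pair_sym QJ curvature_pair_sym. Qed.

(** With [K(u, v) = Q u v v u], polarization and the cyclic identity give [K(u, v) = - 3 K(u, J v)].
    Using this for [(x, y)] and for [(x, J y)], where [K(x, J (J y)) = K(x, y)], yields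
    [K = 9 K]. *)
Lemma kaehler_like_eq0 x y : Q x y y x = 0.
Proof.
have H u v : 2 * Q u v v u + 6 * Q u (J v) (J v) u = 0.
  have := Qpol u v; have := Qbianchi u (J u) (J v) v.
  have := curvature_pair_sym v (J v) (J u) u; have := Qskew12 u (J u) v (J v).
  have := Qskew34 u (J u) v (J v); have := QJ1 v u u (J v).
  have := QJ v (J u) u v; have := Qskew12 u (J v) u (J v).
  have := Qskew34 u (J v) u (J v); have := QJ u (J v) u v.
  have := QJ v (J u) v u; have := Qskew34 v (J u) v (J u).
  have := QJ12 u v u v; have := Qskew34 u v u v.
  have := Qskew12 u (J v) (J u) v; lra.
have := H x y; have := H x (J y).
rewrite (_ : Q x (J (J y)) (J (J y)) x = Q x y y x); first lra.
have := QJJ x (J (J y)) y x; have := curvature_pair_sym x (J (J y)) y x.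
have := Qskew34 y x (J (J y)) x; have := QJJ y x y x.
have := Qskew34 y x y x; have := curvature_pair_sym x y y x; lra.
Qed.

End KaehlerLike.

(** * Comparison with the model curvature tensor at a point *)

Section SpaceFormPoint.
Context {R : realFieldType} {V : lmodType R}.
Context (g : V -> V -> R) (xi : V) (J h : V -> V) (R4 : V -> V -> V -> V -> R).
Context (kappa mu c : R).
Implicit Types (x y z w t : V).

Hypothesis gDl : forall x y z, g (x + y) z = g x z + g y z.
Hypothesis gZl : forall k x z, g (k *: x) z = k * g x z.
Hypothesis gC : forall x y, g x y = g y x.
Hypothesis gxi : g xi xi = 1.
Hypothesis J2 : forall x, J (J x) = - x + g x xi *: xi.
Hypothesis Jxi : J xi = 0.
Hypothesis gJ : forall x y, g (J x) y = - g x (J y).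
Hypothesis JD : forall x y, J (x + y) = J x + J y.
Hypothesis JZ : forall k x, J (k *: x) = k *: J x.
Hypothesis hD : forall x y, h (x + y) = h x + h y.
Hypothesis hZ : forall k x, h (k *: x) = k *: h x.
Hypothesis h_sym : forall x y, g (h x) y = g x (h y).
Hypothesis h_xi : h xi = 0.
Hypothesis h_J : forall x, h (J x) = - J (h x).

Hypothesis RD : forall x t y z w, R4 (x + t) y z w = R4 x y z w + R4 t y z w.
Hypothesis RZ : forall k x y z w, R4 (k *: x) y z w = k * R4 x y z w.
Hypothesis Rskew12 : forall x y z w, R4 y x z w = - R4 x y z w.
Hypothesis Rskew34 : forall x y z w, R4 x y w z = - R4 x y z w.
Hypothesis Rbianchi : forall x y z w, R4 x y z w + R4 y z x w + R4 z x y w = 0.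
Hypothesis Rxi : forall x y w, R4 x y xi w =
  kappa * (g y xi * g x w - g x xi * g y w)
  + mu * (g y xi * g (h x) w - g x xi * g (h y) w).
(** The Ricci identity for [phi], with [nabla phi] replaced by its value in terms of [x + h x]. *)
Hypothesis RJ : forall x y z w, g z xi = 0 -> g w xi = 0 ->
  R4 x y (J z) w + R4 x y z (J w) =
  - g (y + h y) z * g (J (x + h x)) w + g (J (x + h x)) z * g (y + h y) w
  + g (x + h x) z * g (J (y + h y)) w - g (J (y + h y)) z * g (x + h x) w.
Hypothesis Rhol : forall x, g x xi = 0 -> R4 x (J x) (J x) x = c * g x x ^+ 2.

Let gDr x y z : g z (x + y) = g z x + g z y.
Proof. by rewrite gC gDl !(gC z). Qed.
Let gZr k x z : g z (k *: x) = k * g z x.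
Proof. by rewrite gC gZl gC. Qed.
Let gNl x z : g (- x) z = - g x z.
Proof. by rewrite -scaleN1r gZl mulN1r. Qed.
Let gNr x z : g z (- x) = - g z x.
Proof. by rewrite gC gNl gC. Qed.
Let g0l z : g 0 z = 0.
Proof. by rewrite -(scale0r (0 : V)) gZl mul0r. Qed.
Let g0r z : g z 0 = 0.
Proof. by rewrite gC g0l. Qed.
Let gE := (gDl, gDr, gNl, gNr, gZl, gZr).
Let JN x : J (- x) = - J x.
Proof. by rewrite -scaleN1r JZ scaleN1r. Qed.
Let Jx0 x : g (J x) xi = 0.
Proof. by rewrite gJ Jxi g0r oppr0. Qed.
Let hx0 x : g (h x) xi = 0.
Proof. by rewrite h_sym h_xi g0r. Qed.

(* [g (R(x, y) z) w] for the curvature tensor [R] of a contact space form. *)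
Definition model_curv x y z w : R :=
  (c + 3) / 4 * (g y z * g x w - g x z * g y w)
  + (c + 3 - 4 * kappa) / 4 *
    (g x xi * g z xi * g y w - g y xi * g z xi * g x w
     + g x z * g y xi * g w xi - g y z * g x xi * g w xi)
  + (c - 1) / 4 * (2 * g x (J y) * g (J z) w + g x (J z) * g (J y) w
                   - g y (J z) * g (J x) w)
  + 2^-1 * (g (h y) z * g (h x) w - g (h x) z * g (h y) w
            + g (J (h x)) z * g (J (h y)) w - g (J (h y)) z * g (J (h x)) w)
  - g x z * g (h y) w + g y z * g (h x) w
  + g x xi * g z xi * g (h y) w - g y xi * g z xi * g (h x) w
  - g (h x) z * g y w + g (h y) z * g x w
  - g (h y) z * g x xi * g w xi + g (h x) z * g y xi * g w xi
  + mu * (g y xi * g z xi * g (h x) w - g x xi * g z xi * g (h y) w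
          + g (h y) z * g x xi * g w xi - g (h x) z * g y xi * g w xi).

Let hC x y : g (h x) y = g (h y) x.
Proof. by rewrite h_sym gC. Qed.
Let gJr x y : g x (J y) = - g (J x) y.
Proof. by rewrite gJ opprK. Qed.
Let JC x y : g (J x) y = - g (J y) x.
Proof. by rewrite gJ gC. Qed.
Let sC x y : g (J (h x)) y = g (J (h y)) x.
Proof. by rewrite gJ h_sym h_J gNr opprK gC. Qed.

Let Q x y z w := R4 x y z w - model_curv x y z w.

Let Q12 x y z w : Q y x z w = - Q x y z w.
Proof. by rewrite /Q /model_curv Rskew12 !gJr (JC y x); field. Qed.

Let Q34 x y z w : Q x y w z = - Q x y z w.
Proof.
by rewrite /Q /model_curv Rskew34 !gJr (JC w z); field.
Qed.

Let Qb x y z w : Q x y z w + Q y z x w + Q z x y w = 0.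
Proof.
have := Rbianchi x y z w; rewrite /Q /model_curv !gJr.
rewrite (gC z x) (gC z y) (gC y x) (hC z x) (hC z y) (hC y x) (JC z x) (JC z y) (JC y x).
rewrite (sC z x) (sC z y) (sC y x) => H.
by rewrite -[RHS]H; field.
Qed.

Let Qxi x y w : Q x y xi w = 0.
Proof.
by rewrite /Q /model_curv Rxi Jxi !hx0 gxi !Jx0 !g0l !g0r; field.
Qed.

Let QJD x y z w : g z xi = 0 -> g w xi = 0 -> Q x y (J z) w + Q x y z (J w) = 0.
Proof.
move=> z0 w0; have := RJ x y z0 w0; rewrite /Q => H.
rewrite addrACA H /model_curv !JD !J2 z0 w0 !scale0r !addr0 !gE !gJr !J2 !Jx0.
by rewrite !gE !hx0 ?(gC xi z) ?(gC xi w) ?z0 ?w0; field.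
Qed.

Let Qadd x t y z w : Q (x + t) y z w = Q x y z w + Q t y z w.
Proof. by rewrite /Q RD /model_curv hD !JD !gE; field. Qed.

Let Qscale k x y z w : Q (k *: x) y z w = k * Q x y z w.
Proof. by rewrite /Q RZ /model_curv hZ !JZ !gE; field. Qed.

Let Qopp x y z w : Q (- x) y z w = - Q x y z w.
Proof. by rewrite -scaleN1r Qscale mulN1r. Qed.

Let Qpair := curvature_pair_sym Q12 Q34 Qb.

Let decomp x : x = - J (J x) + g x xi *: xi.
Proof. by rewrite J2 opprD opprK -addrA addNr addr0. Qed.

Let Qxi1 x y z : Q xi y z x = 0.
Proof. by rewrite -Qpair Qxi. Qed.

Let Q_D x y z w : Q x y z w = Q (- J (J x)) y z w.
Proof. by rewrite {1}(decomp x) Qadd Qscale Qxi1 mulr0 addr0. Qed.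

Let Q_D3 x y z w : Q x y z w = Q x y (- J (J z)) w.
Proof. by rewrite -Qpair Q_D Qpair. Qed.

Let Q_D4 x y z w : Q x y z w = Q x y z (- J (J w)).
Proof. by rewrite -[LHS]opprK -Q34 Q_D3 Q34 opprK. Qed.

Let JJJ x : J (- J (J x)) = J x.
Proof. by rewrite JN (J2 (J x)) Jx0 scale0r addr0 opprK. Qed.

(** [Q] does not see components along [xi], so each argument may be replaced by its projection
    [- J (J _)]; this extends [QJD] from vectors orthogonal to [xi] to all vectors. *)
Let QJ x y z w : Q x y (J z) w = - Q x y z (J w).
Proof.
have D0 t : g (- J (J t)) xi = 0 by rewrite gNl Jx0 oppr0.
have := QJD x y (D0 z) (D0 w); rewrite !JJJ => H.
by rewrite Q_D4 [in RHS]Q_D3; apply/eqP; rewrite -addr_eq0 H.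
Qed.

Let QJJ x y z w : Q x y (J (J z)) w = - Q x y z w.
Proof. by rewrite [in RHS]Q_D3 -[in RHS]Qpair Qopp Qpair opprK. Qed.

(** All terms in [h] cancel, because [h] anticommutes with [J]: for instance
    [g (h (J x)) (J x) = - g (h x) x]. The rest is [(c + 3) / 4 + 3 * (c - 1) / 4 = c]. *)
Lemma model_curv_hol x : g x xi = 0 -> model_curv x (J x) (J x) x = c * g x x ^+ 2.
Proof.
move=> x0; have J0 : g (J x) x = 0 by have := JC x x; lra.
have JJ : J (J x) = - x by rewrite J2 x0 scale0r addr0.
have JJh : J (J (h x)) = - h x by rewrite J2 hx0 scale0r addr0.
rewrite /model_curv !h_J !JN JJh !JJ !gE !gJr !JJ !JJh !gE !J0 x0 !Jx0.
by field.
Qed.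

Let Qhol x : Q x (J x) (J x) x = 0.
Proof.
have : g (- J (J x)) xi = 0 by rewrite gNl Jx0 oppr0.
rewrite Q_D Q_D4; move: (JJJ x); move: (- J (J x)) => y <- y0.
by rewrite /Q Rhol// model_curv_hol// subrr.
Qed.

Theorem space_form_curv x y : R4 x y y x = model_curv x y y x.
Proof.
apply/eqP; rewrite -subr_eq0 -/(Q x y y x).
by rewrite (@kaehler_like_eq0 _ _ Q J)// => *; rewrite ?Q12 ?Q34 ?opprK.
Qed.

End SpaceFormPoint.

(** * Contact metric structures in a chart *)

Section ContactChart.
Context {R : realType} {d : nat}.
Context (U : set 'rV[R]_d) (G : 'rV[R]_d -> 'M[R]_d).
Context (oU : open U) (sG : smooth_on U G).
Context (Gsym : forall p, U p -> (G p)^T = G p).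
Context (Gpos : forall p x, U p -> x != 0 -> 0 < inner (G p) x x).
Implicit Types (p q x y z w : 'rV[R]_d) (T : 'rV[R]_d -> 'M[R]_d).

Let nearU p : U p -> \near p, U p.
Proof. by move=> Up; exact: open_nbhs_nbhs. Qed.

Notation Gam := (christoffel_mx G).

Let dGam p x : U p -> differentiable (Gam^~ x) p.
Proof. exact: (differentiable_christoffel_mx sG Gpos). Qed.

Let dG p : U p -> differentiable G p.
Proof. exact: smooth_differentiable. Qed.

(** Covariant derivative of an endomorphism acting from the right,
    [y |-> nabla_x (y T) - (nabla_x y) T]. It is locked like [christoffel_mx]. *)
Definition nabla_end T p x : 'M[R]_d := locked_with christoffel_key
  ('D_x T p + T p *m Gam p x - Gam p x *m T p).

Lemma nabla_endE T p x :
  nabla_end T p x = 'D_x T p + T p *m Gam p x - Gam p x *m T p.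
Proof. by rewrite /nabla_end locked_withE. Qed.

Lemma nabla_endM T T' p x : differentiable T p -> differentiable T' p ->
  nabla_end (fun q => T q *m T' q) p x
  = nabla_end T p x *m T' p + T p *m nabla_end T' p x.
Proof.
move=> dT dT'; rewrite !nabla_endE (derive_mulmx x dT dT').
rewrite !mulmx_linE !mulmxA.
have L (a b c e f : 'M[R]_d) : a + b + c - e = a + f - e + (b + c - f) by mx_linear.
exact: L.
Qed.

Lemma nabla_endD T T' p x : differentiable T p -> differentiable T' p ->
  nabla_end (fun q => T q + T' q) p x = nabla_end T p x + nabla_end T' p x.
Proof.
move=> dT dT'; rewrite !nabla_endE.
have -> : 'D_x (fun q => T q + T' q) p = 'D_x T p + 'D_x T' p.
  by apply: deriveD; exact: diff_derivable.
rewrite !mulmx_linE.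
have L (a b c e f h : 'M[R]_d) :
  a + b + (c + e) - (f + h) = a + c - f + (b + e - h) by mx_linear.
exact: L.
Qed.

Lemma nabla_endN T p x : differentiable T p ->
  nabla_end (fun q => - T q) p x = - nabla_end T p x.
Proof.
move=> dT; rewrite !nabla_endE.
have -> : 'D_x (fun q => - T q) p = - 'D_x T p.
  by apply: deriveN; exact: diff_derivable.
by rewrite !mulmx_linE !opprD !opprK.
Qed.

Lemma near_eq_nabla_end T T' p x : (\near p, T p = T' p) ->
  nabla_end T p x = nabla_end T' p x.
Proof.
move=> TT'; rewrite !nabla_endE (nbhs_singleton TT').
exact: (f_equal (fun M => M + _ - _) (near_eq_derive x TT')).
Qed.

Lemma nabla_end0 p x : nabla_end (cst 0) p x = 0.
Proof. by rewrite nabla_endE derive_cst mulmx0 mul0mx addr0 subr0. Qed.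

Lemma along_mulmx T p x y : differentiable T p ->
  along x (Gam^~ x) (fun q => y *m T q) p
  = y *m nabla_end T p x + y *m Gam p x *m T p.
Proof.
move=> dT; rewrite /along !nabla_endE (derive_mulmxr y x dT) !mulmx_linE !mulmxA.
by rewrite subrK.
Qed.

Lemma along_cst p x y : along x (Gam^~ x) (cst y) p = y *m Gam p x.
Proof. by rewrite /along derive_cst add0r. Qed.

Lemma derive_metric x (V V' : 'rV[R]_d -> 'rV[R]_d) p : U p ->
  differentiable V p -> differentiable V' p ->
  'D_x (fun q => inner (G q) (V q) (V' q)) p =
  inner (G p) (along x (Gam^~ x) V p) (V' p)
  + inner (G p) (V p) (along x (Gam^~ x) V' p).
Proof.
move=> Up dV dV'; apply: (derive_inner_along (A := Gam^~ x) (dG Up) dV dV').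
exact: (metric_compat oU sG Gsym Gpos x Up).
Qed.

(* Both [k = 1] (symmetric) and [k = -1] (skew-symmetric) are used. *)
Lemma nabla_end_sym (k : R) T p x y z : U p -> differentiable T p ->
  (forall q y z, U q -> inner (G q) (y *m T q) z = k * inner (G q) y (z *m T q)) ->
  inner (G p) (y *m nabla_end T p x) z = k * inner (G p) y (z *m nabla_end T p x).
Proof.
move=> Up dT TG.
have dzT (v : 'rV[R]_d) : differentiable (fun q => v *m T q) p.
  by apply: differentiable_mulmx => //; exact: differentiable_cst.
have dc (v : 'rV[R]_d) : differentiable (cst v) p by exact: differentiable_cst.
have E1 := derive_metric x Up (dzT y) (dc z).
have E2 := derive_metric x Up (dc y) (dzT z).
have E3 : 'D_x (fun q => inner (G q) (y *m T q) (cst z q)) p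
   = k * 'D_x (fun q => inner (G q) (cst y q) (z *m T q)) p.
  have dI := differentiable_inner (dG Up) (dc y) (dzT z).
  apply: etrans (derive_scalel k x dI).
  by apply: near_eq_derive; apply: filterS (nearU Up) => q Uq; exact: TG.
have E4 := etrans (esym E1) (etrans E3 (f_equal ( *%R k) E2)).
rewrite !along_mulmx// !along_cst !innerE in E4.
have := TG _ (y *m Gam p x) z Up; have := TG _ y (z *m Gam p x) Up.
have L (a a' b b' c c' : R) : a + b + c = k * (b' + (a' + c')) ->
  c = k * c' -> b = k * b' -> a = k * a'.
  by move=> H cE bE; move: H; rewrite cE bE; lra.
exact: L E4.
Qed.

Context (phi : 'rV[R]_d -> 'M[R]_d) (xi : 'rV[R]_d -> 'rV[R]_d)
  (eta : 'rV[R]_d -> 'cV[R]_d).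
Context (sphi : smooth_on U phi) (sxi : smooth_on U xi) (seta : smooth_on U eta).
Hypothesis phi2 : forall p x, U p ->
  x *m phi p *m phi p = - x + evform (eta p) x *: xi p.
Hypothesis eta_xi : forall p, U p -> evform (eta p) (xi p) = 1.
Hypothesis xi_phi : forall p, U p -> xi p *m phi p = 0.
Hypothesis phi_skew : forall p x y, U p ->
  inner (G p) x (y *m phi p) = - inner (G p) (x *m phi p) y.
Hypothesis inner_xi : forall p x, U p -> inner (G p) x (xi p) = evform (eta p) x.
Hypothesis d_eta : forall p x y, U p ->
  inner (G p) x (y *m phi p) = dform eta (cst x) (cst y) p.

Let dphi p : U p -> differentiable phi p.
Proof. exact: smooth_differentiable. Qed.
Let dxi p : U p -> differentiable xi p.
Proof. exact: smooth_differentiable. Qed.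
Let deta p : U p -> differentiable eta p.
Proof. exact: smooth_differentiable. Qed.

Lemma derive_evform (w : 'rV[R]_d -> 'cV[R]_d) p x y : differentiable w p ->
  'D_x (fun q => evform (w q) y) p = evform ('D_x w p) y.
Proof.
move=> dw; rewrite /evform -(derive_mulmxr y x dw).
by apply: esym; apply: derive_entry; apply: differentiable_mulmx.
Qed.

Definition nabla_xi p : 'M[R]_d :=
  \matrix_(i < d) ('D_(delta_mx 0 i) xi p + xi p *m Gam p (delta_mx 0 i)).

Lemma nabla_xiE p x : U p -> x *m nabla_xi p = along x (Gam^~ x) xi p.
Proof.
move=> Up; rewrite mulmx_sum_row /along (christoffel_mx_sum sG _ Up) mulmx_sumr.
have -> : 'D_x xi p = \sum_i x 0 i *: 'D_(delta_mx 0 i) xi p.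
  rewrite {1}[x]row_sum_delta deriveE ?linear_sum/=; last exact: dxi.
  by apply: eq_bigr => i _; rewrite linearZ/= -deriveE//; exact: dxi.
rewrite -big_split/=; apply: eq_bigr => i _.
by rewrite rowK scalerDr -scalemxAr.
Qed.

Lemma differentiable_nabla_xi p : U p -> differentiable nabla_xi p.
Proof.
move=> Up; apply: differentiable_mx => i j; under eq_fun do rewrite mxE.
apply: differentiable_entry; apply: differentiableD.
  exact: smooth_differentiable1 Up.
by apply: differentiable_mulmx; [exact: dxi|exact: dGam].
Qed.

(** Since [eta = g(_, xi)] and the torsion vanishes, [2 d eta (x, y) = g(nabla_x xi, y) - g(nabla_y
    xi, x)]. *)
Lemma nabla_xi_skew p x y : U p ->
  inner (G p) (x *m nabla_xi p) y - inner (G p) (y *m nabla_xi p) x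
  = 2 * inner (G p) x (y *m phi p).
Proof.
move=> Up; rewrite d_eta// /dform lie_bracket_cst.
have dc (v : 'rV[R]_d) : differentiable (cst v) p by exact: differentiable_cst.
have D v w : 'D_v (fun q => evform (eta q) w) p
    = inner (G p) (w *m Gam p v) (xi p) + inner (G p) w (v *m nabla_xi p).
  have E : 'D_v (fun q => evform (eta q) w) p
      = 'D_v (fun q => inner (G q) (cst w q) (xi q)) p.
    apply: near_eq_derive; apply: filterS (nearU Up) => q Uq.
    exact: esym (inner_xi w Uq).
  apply: etrans E _; apply: etrans (derive_metric v Up (dc w) (dxi Up)) _.
  by rewrite along_cst nabla_xiE.
have -> : evform (eta p) 0 = 0 by rewrite /evform mul0mx mxE.
have DE := D x y; have DE' := D y x; rewrite /= in DE DE' *.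
have S := christoffel_mx_sym oU sG Gsym x y Up.
have C1 := innerC (x *m nabla_xi p) y (Gsym Up).
have C2 := innerC (y *m nabla_xi p) x (Gsym Up).
have L (a b c e f h k : R) : a = f + c -> b = f + e -> h = c -> k = e ->
  h - k = 2 * ((a - b - 0) / 2) by move=> *; lra.
apply: (L _ _ _ _ (inner (G p) (x *m Gam p y) (xi p)) _ _ _ DE' C1 C2).
by rewrite DE S.
Qed.

(** The derivative of [g(xi, xi) = 1]. *)
Lemma nabla_xi_xi p x : U p -> inner (G p) (x *m nabla_xi p) (xi p) = 0.
Proof.
move=> Up; have := derive_metric x Up (dxi Up) (dxi Up).
have -> : 'D_x (fun q => inner (G q) (xi q) (xi q)) p = 'D_x (cst (1 : R)) p.
  apply: near_eq_derive; apply: filterS (nearU Up) => q Uq.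
  by rewrite inner_xi// eta_xi.
rewrite derive_cst -nabla_xiE// (innerC _ (x *m _) (Gsym Up)).
have L (a : R) : 0 = a + a -> a = 0 by lra.
exact: L.
Qed.

Definition dphi_form p x y z : R := inner (G p) (y *m nabla_end phi p x) z.

Lemma dphi_form_skew p x y z : U p -> dphi_form p x y z = - dphi_form p x z y.
Proof.
move=> Up; rewrite /dphi_form (innerC _ y (Gsym Up)) -[RHS]mulN1r.
apply: nabla_end_sym => //; first exact: dphi.
by move=> q v w Uq; rewrite mulN1r phi_skew// opprK.
Qed.

Lemma xi_nabla_end T p x : U p -> differentiable T p ->
  (forall q, U q -> xi q *m T q = 0) ->
  xi p *m nabla_end T p x = - (x *m nabla_xi p *m T p).
Proof.
move=> Up dT xiT; rewrite nabla_xiE// nabla_endE /along.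
have : 'D_x (fun q => xi q *m T q) p = 'D_x (cst (0 : 'rV[R]_d)) p.
  by apply: near_eq_derive; apply: filterS (nearU Up) => q Uq; exact: xiT.
rewrite derive_cst (derive_mulmx x (dxi Up) dT) !mulmx_linE !mulmxA xiT// mul0mx addr0.
have L (a b c : 'rV[R]_d) : a + b = 0 -> b - c = - (a + c).
  by move=> /eqP; rewrite addr_eq0 => /eqP ->; rewrite opprD opprK.
exact: L.
Qed.

Lemma dphi_form_xi p x z : U p ->
  dphi_form p x (xi p) z = - inner (G p) (x *m nabla_xi p *m phi p) z.
Proof.
by move=> Up; rewrite /dphi_form xi_nabla_end ?innerNl//; exact: dphi.
Qed.

(** This is [d Phi = d (d eta) = 0]: second derivatives of [eta] commute, and the Christoffel terms
    cancel in the cyclic sum because the torsion vanishes. *)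
Lemma dphi_form_cyc p x y z : U p ->
  dphi_form p x y z + dphi_form p y z x + dphi_form p z x y = 0.
Proof.
move=> Up; have dc (v : 'rV[R]_d) : differentiable (cst v) p by exact: differentiable_cst.
have dvphi (v : 'rV[R]_d) : differentiable (fun q => v *m phi q) p.
  by apply: differentiable_mulmx => //; exact: dphi.
have deta1 v : differentiable ('D_v eta) p by exact: smooth_differentiable1 Up.
have dev v w : differentiable (fun q => evform ('D_v eta q) w) p.
  by apply: differentiable_entry; apply: differentiable_mulmx.
have E u v w : 'D_u (fun q => inner (G q) (cst v q) (w *m phi q)) p =
    2^-1 * (evform ('D_u ('D_v eta) p) w - evform ('D_u ('D_w eta) p) v).
  have -> : 'D_u (fun q => inner (G q) (cst v q) (w *m phi q)) p =
      'D_u (2^-1 \*: ((fun q => evform ('D_v eta q) w)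
                      - (fun q => evform ('D_w eta q) v))) p.
    apply: near_eq_derive; apply: filterS (nearU Up) => q Uq.
    rewrite d_eta// /dform lie_bracket_cst /= !derive_evform//; [|exact: deta..].
    by rewrite /evform mul0mx [X in _ - X]mxE subr0 mulrC.
  rewrite deriveZ; last by apply: derivableB; exact: diff_derivable.
  rewrite deriveB; [|exact: diff_derivable..].
  by rewrite !derive_evform.
have E2 u v w : 'D_u (fun q => inner (G q) (cst v q) (w *m phi q)) p =
    inner (G p) (v *m Gam p u) (w *m phi p)
    + (dphi_form p u w v - inner (G p) (w *m Gam p u) (v *m phi p)).
  apply: etrans (derive_metric u Up (dc v) (dvphi w)) _.
  rewrite along_cst along_mulmx ?innerDr; last exact: dphi.
  rewrite (phi_skew v (w *m Gam p u) Up) (innerC v (w *m nabla_end _ _ _) (Gsym Up)).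
  by rewrite (innerC (v *m phi p) _ (Gsym Up)).
have S v w := christoffel_mx_sym oU sG Gsym v w Up.
have Sch v w := smooth_schwarz v w oU seta Up.
have D1 := etrans (esym (E2 x z y)) (E x z y).
have D2 := etrans (esym (E2 y x z)) (E y x z).
have D3 := etrans (esym (E2 z y x)) (E z y x).
move: D1 D2 D3; rewrite (S x z) (S y x) (S z y).
have H (f : 'rV[R]_d -> 'rV[R]_d -> 'cV[R]_d) (a1 a2 a3 f1 f2 f3 : R) :
    (forall v w, f v w = f w v) ->
    a1 + (f1 - a2) = 2^-1 * (evform (f x z) y - evform (f x y) z) ->
    a2 + (f2 - a3) = 2^-1 * (evform (f y x) z - evform (f y z) x) ->
    a3 + (f3 - a1) = 2^-1 * (evform (f z y) x - evform (f z x) y) ->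
    f1 + f2 + f3 = 0.
  by move=> fC; rewrite (fC z x) (fC y x) (fC z y) => *; lra.
exact: (H (fun v w => 'D_v ('D_w eta) p)).
Qed.

(** Covariant derivative of [phi (phi y) = - y + eta(y) xi]. *)
Lemma dphi_form_phi p x y z : U p ->
  dphi_form p x (y *m phi p) z - dphi_form p x y (z *m phi p) =
  inner (G p) (x *m nabla_xi p) y * inner (G p) (xi p) z
  + inner (G p) y (xi p) * inner (G p) (x *m nabla_xi p) z.
Proof.
move=> Up; have dp := dphi Up.
have deq : 'D_x (fun q => y *m (phi q *m phi q)) p
   = 'D_x (fun q => - y + inner (G q) (cst y q) (xi q) *: xi q) p.
  apply: near_eq_derive; apply: filterS (nearU Up) => q Uq.
  by rewrite mulmxA phi2// -inner_xi.
have dpp : differentiable (fun q => phi q *m phi q) p by exact: differentiable_mulmx.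
have dc : differentiable (cst y) p by exact: differentiable_cst.
have dI := differentiable_inner (dG Up) dc (dxi Up).
have dIx := differentiable_scale dI (dxi Up).
have DI : 'D_x (fun q => inner (G q) (cst y q) (xi q)) p
    = inner (G p) (y *m Gam p x) (xi p) + inner (G p) y (x *m nabla_xi p).
  by rewrite (derive_metric x Up dc (dxi Up)) along_cst nabla_xiE.
have D1 : 'D_x (fun q => - y + inner (G q) (cst y q) (xi q) *: xi q) p
   = 'D_x (fun q => inner (G q) (cst y q) (xi q)) p *: xi p
     + inner (G p) y (xi p) *: 'D_x xi p.
  rewrite deriveD; [|exact: derivable_cst|exact: diff_derivable].
  by rewrite derive_cst add0r; exact: (derive_scale x dI (dxi Up)).
have A1 := along_mulmx x y dpp; rewrite nabla_endM// /along in A1.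
have {}A1 := etrans (esym A1) (f_equal (fun M => M + _) (etrans deq D1)).
rewrite DI in A1.
have H : y *m nabla_end phi p x *m phi p + y *m phi p *m nabla_end phi p x =
  inner (G p) y (x *m nabla_xi p) *: xi p + inner (G p) y (xi p) *: (x *m nabla_xi p).
  move: A1; rewrite nabla_xiE// /along mulmxDr !mulmxA !phi2// -!inner_xi//.
  rewrite mulmxDl mulNmx -scalemxAl.
  have L (a b c e f h : 'rV[R]_d) (i j k : R) :
      a + b + (- c + i *: e) = (i + j) *: e + k *: f + (- c + k *: h) ->
      a + b = j *: e + k *: (f + h).
    move=> H; have -> : a + b = a + b + (- c + i *: e) - (- c + i *: e) by rewrite addrK.
    by rewrite H; mx_linear.
  exact: L.
have := f_equal (fun v => inner (G p) v z) H; rewrite !innerE.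
rewrite (innerC (y *m nabla_end phi p x *m phi p) z (Gsym Up)) phi_skew//.
rewrite (innerC (z *m phi p) (y *m nabla_end phi p x) (Gsym Up)).
rewrite (innerC y (x *m nabla_xi p) (Gsym Up)).
by move=> <-; rewrite addrC.
Qed.

Let J2 p x : U p -> x *m phi p *m phi p = - x + inner (G p) x (xi p) *: xi p.
Proof. by move=> Up; rewrite phi2// inner_xi//. Qed.

Let gC p x y : U p -> inner (G p) x y = inner (G p) y x.
Proof. by move=> Up; exact: innerC (Gsym Up). Qed.

Let gxi p : U p -> inner (G p) (xi p) (xi p) = 1.
Proof. by move=> Up; rewrite inner_xi// eta_xi. Qed.

Let gJ p x y : U p -> inner (G p) (x *m phi p) y = - inner (G p) x (y *m phi p).
Proof. by move=> Up; rewrite phi_skew// opprK. Qed.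

Let g_inj p : U p -> forall x y,
  (forall z, inner (G p) x z = inner (G p) y z) -> x = y.
Proof. by move=> Up x y xy; exact: (inner_injl Gpos Up xy). Qed.

Let FDr p x y z w : dphi_form p x y (z + w) = dphi_form p x y z + dphi_form p x y w.
Proof. exact: innerDr. Qed.

Let FZr p x y k z : dphi_form p x y (k *: z) = k * dphi_form p x y z.
Proof. exact: innerZr. Qed.

Let gD p x y z : inner (G p) (x + y) z = inner (G p) x z + inner (G p) y z.
Proof. exact: innerDl. Qed.

Let gZ p k x z : inner (G p) (k *: x) z = k * inner (G p) x z.
Proof. exact: innerZl. Qed.

Let JD p x y : (x + y) *m phi p = x *m phi p + y *m phi p.
Proof. exact: mulmxDl. Qed.

Let JZ p k x : (k *: x) *m phi p = k *: (x *m phi p).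
Proof. by rewrite scalemxAl. Qed.

Let JN p x : - x *m phi p = - (x *m phi p).
Proof. exact: mulNmx. Qed.

Lemma dphi_form_xi0 p y z : U p -> dphi_form p (xi p) y z = 0.
Proof.
move=> Up.
exact: (F_xi0 (g := inner (G p)) (J := fun x => x *m phi p)
  (A := fun x => x *m nabla_xi p) (@gD p) (@gZ p) (fun x y => gC x y Up)
  (g_inj Up) (fun x => J2 x Up) (xi_phi Up) (fun x y => gJ x y Up)
  (fun x y => nabla_xi_skew x y Up) (fun x => nabla_xi_xi x Up)
  (@FDr p) (@FZr p) (fun x y z => dphi_form_skew x y z Up)
  (fun x y z => dphi_form_cyc x y z Up) (fun x z => dphi_form_xi x z Up)
  (fun x y z => dphi_form_phi x y z Up)).
Qed.

Definition shape_xi p : 'M[R]_d := - (nabla_xi p + phi p).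

Lemma shape_xiE p x : x *m shape_xi p = - (x *m nabla_xi p + x *m phi p).
Proof. by rewrite /shape_xi mulmxN mulmxDr. Qed.

Lemma nabla_xi_shape p x : x *m nabla_xi p = - (x *m shape_xi p + x *m phi p).
Proof. by rewrite shape_xiE opprD opprK addrK. Qed.

Lemma shape_xi_sym p x y : U p ->
  inner (G p) (x *m shape_xi p) y = inner (G p) x (y *m shape_xi p).
Proof.
move=> Up; rewrite !shape_xiE.
exact: (S_sym (g := inner (G p)) (J := fun x => x *m phi p)
  (A := fun x => x *m nabla_xi p) (@gD p) (@gZ p) (fun x y => gC x y Up)
  (fun x y => gJ x y Up) (fun x y => nabla_xi_skew x y Up)).
Qed.

Lemma shape_xi_xi p : U p -> xi p *m shape_xi p = 0.
Proof.
move=> Up; rewrite shape_xiE.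
exact: (S_xi (g := inner (G p)) (J := fun x => x *m phi p)
  (A := fun x => x *m nabla_xi p) (@gZ p) (fun x y => gC x y Up) (g_inj Up)
  (xi_phi Up) (fun x y => gJ x y Up) (fun x y => nabla_xi_skew x y Up)
  (fun x => nabla_xi_xi x Up)).
Qed.

Lemma shape_xi_phi p x : U p -> x *m phi p *m shape_xi p = - (x *m shape_xi p *m phi p).
Proof.
move=> Up; rewrite !shape_xiE.
exact: (S_J (g := inner (G p)) (J := fun x => x *m phi p)
  (A := fun x => x *m nabla_xi p) (@gD p) (@gZ p) (fun x y => gC x y Up)
  (g_inj Up) (fun x => J2 x Up) (xi_phi Up) (fun x y => gJ x y Up)
  (fun x y => nabla_xi_skew x y Up) (fun x => nabla_xi_xi x Up)
  (@FDr p) (@FZr p) (fun x y z => dphi_form_skew x y z Up)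
  (fun x y z => dphi_form_cyc x y z Up) (fun x z => dphi_form_xi x z Up)
  (fun x y z => dphi_form_phi x y z Up) (@JD p) (@JN p)).
Qed.

Lemma differentiable_shape_xi p : U p -> differentiable shape_xi p.
Proof.
move=> Up; apply: differentiableN; apply: differentiableD; last exact: dphi.
exact: differentiable_nabla_xi.
Qed.

(** [2 h' x = (nabla_xi phi) x - nabla_(phi x) xi + phi (nabla_x xi)]. The first term vanishes, and
    [nabla xi = - phi - S] turns the others into [S phi x - phi S x = - 2 phi S x]. *)
Lemma hprimeE p x : U p -> hprime phi xi p x = - (x *m shape_xi p *m phi p).
Proof.
move=> Up; have dp := dphi Up.
have F0 : x *m nabla_end phi p (xi p) = 0.
  by apply: (g_inj Up) => z; rewrite inner0l; exact: dphi_form_xi0.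
rewrite /hprime /lie_endo /lie_bracket !derive_cst /= (derive_mulmxr _ _ dp).
move: F0; rewrite nabla_endE !mulmx_linE !mulmxA => F0.
have E y : 'D_y xi p = y *m nabla_xi p - y *m Gam p (xi p).
  by rewrite nabla_xiE// /along (christoffel_mx_sym oU sG Gsym y (xi p) Up) addrK.
rewrite !E mul0mx sub0r mulmxBl.
have := shape_xi_phi x Up; rewrite !shape_xiE mulNmx mulmxDl => SJ.
have L (a b c e f h : 'rV[R]_d) :
   a + b - c = 0 -> - (e + f) = - - (h + f) ->
   2^-1 *: (a - (e - b) - - (h - c)) = - - (h + f).
  move=> /matrixP H1 /matrixP H2; apply/matrixP => i j.
  by have := H1 i j; have := H2 i j; rewrite !mx_linE; lra.
exact: L F0 SJ.
Qed.

Definition dshape_form p x y z : R := inner (G p) (y *m nabla_end shape_xi p x) z.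

(** Covariant derivative of [S phi + phi S = 0]. *)
Lemma dshape_form_phi p x y z : U p ->
  dshape_form p x (y *m phi p) z - dshape_form p x y (z *m phi p)
  = - dphi_form p x y (z *m shape_xi p) - dphi_form p x (y *m shape_xi p) z.
Proof.
move=> Up; have dS := differentiable_shape_xi Up; have dp := dphi Up.
have dSp : differentiable (fun q => shape_xi q *m phi q) p by exact: differentiable_mulmx.
have dpS : differentiable (fun q => phi q *m shape_xi q) p by exact: differentiable_mulmx.
have E : nabla_end (fun q => shape_xi q *m phi q + phi q *m shape_xi q) p x
   = nabla_end (cst 0) p x.
  apply: near_eq_nabla_end; apply: filterS (nearU Up) => q Uq.
  apply/row_matrixP => i; rewrite !rowE mulmxDr !mulmxA shape_xi_phi// subrr.
  by rewrite mulmx0.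
move: E; rewrite nabla_endD// !nabla_endM// nabla_end0 => /(f_equal (fun M => y *m M)).
rewrite mulmx0 !mulmxDr !mulmxA => /(f_equal (fun v => inner (G p) v z)).
rewrite inner0l !innerDl (gJ _ z Up) (shape_xi_sym _ z Up).
rewrite /dshape_form /dphi_form.
have L (a b c e : R) : - a + b + (c + e) = 0 -> e - a = - c - b by move=> *; lra.
exact: L.
Qed.

(** Ricci identity for [xi], with [nabla xi = - S - phi] differentiated once more. *)
Lemma riem_xiE p x y : U p -> xi p *m riem_mx G p x y =
  x *m nabla_end phi p y - y *m nabla_end phi p x
  + (x *m nabla_end shape_xi p y - y *m nabla_end shape_xi p x).
Proof.
move=> Up; have dN := differentiable_nabla_xi Up.
have dvN v : differentiable (fun q => v *m nabla_xi q : 'rV[R]_d) p.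
  by apply: differentiable_mulmx => //; exact: differentiable_cst.
have nxi : \near p, differentiable xi p.
  by apply: filterS (nearU Up) => q Uq; exact: dxi.
have dDxi v : differentiable ('D_v xi) p by exact: smooth_differentiable1 Up.
have RI := ricci_identity nxi (dDxi x) (dDxi y) (dGam x Up) (dGam y Up).
rewrite /riem_mx -RI.
have E v w : along v (Gam^~ v) (along w (Gam^~ w) xi) p
    = w *m nabla_end nabla_xi p v + w *m Gam p v *m nabla_xi p.
  rewrite -along_mulmx//.
  have EN : \near p, along w (Gam^~ w) xi p = w *m nabla_xi p.
    by apply: filterS (nearU Up) => q Uq; rewrite nabla_xiE.
  apply: (f_equal2 +%R); first exact: near_eq_derive EN.
  by rewrite (nbhs_singleton EN).
rewrite !E (christoffel_mx_sym oU sG Gsym x y Up).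
have EN v : nabla_end nabla_xi p v = - (nabla_end shape_xi p v + nabla_end phi p v).
  rewrite -nabla_endD; [|exact: differentiable_shape_xi|exact: dphi].
  rewrite -nabla_endN; last first.
    by apply: differentiableD; [exact: differentiable_shape_xi|exact: dphi].
  apply: near_eq_nabla_end; near=> q.
  by rewrite /shape_xi opprD opprK addrK.
rewrite !EN !mulmxN !mulmxDr.
have L (a b c e h : 'rV[R]_d) : - (a + b) + h - (- (c + e) + h) = e - b + (c - a).
  by mx_linear.
exact: L.
Unshelve. all: by end_near. Qed.

Lemma hprime_sym p x y : U p ->
  inner (G p) (hprime phi xi p x) y = inner (G p) x (hprime phi xi p y).
Proof.
move=> Up.
have S : inner (G p) (x *m shape_xi p *m phi p) y
       = inner (G p) x (y *m shape_xi p *m phi p).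
  rewrite (gJ (x *m shape_xi p) y Up) (shape_xi_sym x (y *m phi p) Up).
  by rewrite (shape_xi_phi y Up) innerNr opprK.
have L (v w : 'rV[R]_d) : inner (G p) v y = inner (G p) x w ->
    inner (G p) (- v) y = inner (G p) x (- w).
  by move=> E; rewrite innerNl innerNr E.
exact: etrans (f_equal (fun v => inner (G p) v y) (hprimeE x Up))
  (etrans (L _ _ S) (f_equal (inner (G p) x) (esym (hprimeE y Up)))).
Qed.

Lemma hprime_phi p x : U p ->
  hprime phi xi p (x *m phi p) = - (hprime phi xi p x *m phi p).
Proof.
move=> Up; have S := f_equal (fun v => - (v *m phi p)) (shape_xi_phi x Up).
exact: etrans (hprimeE (x *m phi p) Up)
  (etrans S (f_equal (fun v => - (v *m phi p)) (esym (hprimeE x Up)))).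
Qed.

Lemma phi_hprime_sym p x y : U p ->
  inner (G p) (hprime phi xi p x *m phi p) y
  = inner (G p) (hprime phi xi p y *m phi p) x.
Proof.
move=> Up; have L (v w : 'rV[R]_d) : inner (G p) v (y *m phi p) = inner (G p) x (- w) ->
    - inner (G p) v (y *m phi p) = inner (G p) w x.
  by move=> ->; rewrite innerNr opprK; exact: gC.
have S := hprime_sym x (y *m phi p) Up.
exact: etrans (gJ (hprime phi xi p x) y Up)
  (L _ _ (etrans S (f_equal (inner (G p) x) (hprime_phi y Up)))).
Qed.

Context (kappa mu c : R).
Hypothesis riem_xi : forall p x y, U p -> riem G p x y (xi p) =
  kappa *: (evform (eta p) y *: x - evform (eta p) x *: y)
  + mu *: (evform (eta p) y *: hprime phi xi p x
           - evform (eta p) x *: hprime phi xi p y).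
Hypothesis phi_sectional : forall p x, U p ->
  inner (G p) x x = 1 -> inner (G p) x (xi p) = 0 ->
  sectional G p x (x *m phi p) = c.

(** Here [R(x, y) xi = 0]. In [riem_xiE] the cyclic identity merges the two derivatives of [phi]
    into a single one, along [z]. *)
Let nullity p x y z : U p -> inner (G p) x (xi p) = 0 -> inner (G p) y (xi p) = 0 ->
  dphi_form p z x y = dshape_form p x y z - dshape_form p y x z.
Proof.
move=> Up; rewrite !inner_xi// => x0 y0.
have : riem G p x y (xi p) = 0.
  have Z (a b e f : 'rV[R]_d) :
      kappa *: (0 *: a - 0 *: b) + mu *: (0 *: e - 0 *: f) = 0 by mx_linear.
  by have := riem_xi x y Up; rewrite x0 y0 => H; exact: etrans H (Z _ _ _ _).
rewrite (riemE oU sG Gpos _ _ _ Up) (riem_xiE _ _ Up).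
move=> /(f_equal (fun v => inner (G p) v z)).
rewrite inner0l !innerE -/(dphi_form p y x z) -/(dphi_form p x y z).
rewrite -/(dshape_form p y x z) -/(dshape_form p x y z).
have := dphi_form_cyc x y z Up; have := dphi_form_skew y x z Up.
move: (dphi_form p) (dshape_form p) => F S3; lra.
Qed.

Let nullity_xi p x z : U p -> inner (G p) x (xi p) = 0 ->
  kappa * inner (G p) x z + mu * inner (G p) (- (x *m shape_xi p *m phi p)) z
  = inner (G p) (- (x *m shape_xi p + x *m phi p) *m phi p) z
    + inner (G p) (- (x *m shape_xi p + x *m phi p) *m shape_xi p) z
    + dshape_form p (xi p) x z.
Proof.
move=> Up; rewrite inner_xi// => x0; rewrite -nabla_xi_shape -hprimeE//.
have : riem G p x (xi p) (xi p) = kappa *: x + mu *: hprime phi xi p x.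
  have Z (a b e f : 'rV[R]_d) :
      kappa *: (1 *: a - 0 *: b) + mu *: (1 *: e - 0 *: f) = kappa *: a + mu *: e.
    by mx_linear.
  have := riem_xi x (xi p) Up; rewrite x0 (eta_xi Up) => H.
  exact: etrans H (Z _ _ _ _).
rewrite (riemE oU sG Gpos _ _ _ Up) (riem_xiE _ _ Up).
move=> /(f_equal (fun v => inner (G p) v z)).
rewrite (xi_nabla_end _ Up (dphi Up) xi_phi).
rewrite (xi_nabla_end _ Up (differentiable_shape_xi Up) shape_xi_xi).
rewrite !innerE -/(dphi_form p (xi p) x z) -/(dshape_form p (xi p) x z).
rewrite (dphi_form_xi0 _ _ Up) => <-.
move: (inner _ _ _) (inner _ _ _) (dshape_form _ _ _ _) => a b e; ring.
Qed.

Let SD p x y : (x + y) *m shape_xi p = x *m shape_xi p + y *m shape_xi p.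
Proof. exact: mulmxDl. Qed.

Let SZ p k x : (k *: x) *m shape_xi p = k *: (x *m shape_xi p).
Proof. by rewrite scalemxAl. Qed.

Let FDl p x y z w : U p ->
  dphi_form p (x + w) y z = dphi_form p x y z + dphi_form p w y z.
Proof.
move=> Up; rewrite /dphi_form !nabla_endE (derive_dirD _ _ (dphi Up)).
rewrite (christoffel_mxD sG _ _ Up) -innerDl -mulmxDr; congr (inner _ (_ *m _) _).
rewrite !mulmx_linE.
have L (a b e f h k : 'M[R]_d) : a + b + (e + f) - (h + k) = a + e - h + (b + f - k).
  by mx_linear.
exact: L.
Qed.

Let FZl p x y k z : U p -> dphi_form p (k *: x) y z = k * dphi_form p x y z.
Proof.
move=> Up; rewrite /dphi_form !nabla_endE (derive_dirZ _ _ (dphi Up)).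
rewrite (christoffel_mxZ sG _ _ Up) -innerZl scalemxAr; congr (inner _ (_ *m _) _).
by rewrite -scalemxAr -scalemxAl -scalerDr -scalerBr.
Qed.

Let Fxi' p x z : U p -> dphi_form p x (xi p) z
  = - inner (G p) (- (x *m shape_xi p + x *m phi p) *m phi p) z.
Proof. by move=> Up; rewrite -nabla_xi_shape dphi_form_xi. Qed.

Let FJ p x y z : U p ->
  dphi_form p x (y *m phi p) z - dphi_form p x y (z *m phi p) =
  inner (G p) (- (x *m shape_xi p + x *m phi p)) y * inner (G p) (xi p) z
  + inner (G p) y (xi p) * inner (G p) (- (x *m shape_xi p + x *m phi p)) z.
Proof. by move=> Up; rewrite -nabla_xi_shape dphi_form_phi. Qed.

Let S3N p x y z : dshape_form p x y (- z) = - dshape_form p x y z.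
Proof. exact: innerNr. Qed.

Let shape_xi_eq0 p : U p -> kappa = 1 -> shape_xi p = 0.
Proof.
move=> Up k1; apply/row_matrixP => i; rewrite rowE row0; move: (delta_mx 0 i).
apply: (SS_eq0 (g := inner (G p)) (J := fun x => x *m phi p)
  (S := fun x => x *m shape_xi p) (F := dphi_form p) (S3 := dshape_form p)
  (@gD p) (@gZ p) (fun x y => gC x y Up) (g_inj Up) (fun x => J2 x Up)
  (xi_phi Up) (fun x y => gJ x y Up) (@JD p) (@JZ p) (@SD p) (@SZ p)
  (fun x y => shape_xi_sym x y Up) (shape_xi_xi Up) (fun x => shape_xi_phi x Up)
  (@S3N p) (fun x y z => dshape_form_phi x y z Up)
  (fun y z => dphi_form_xi0 y z Up) (fun x z => nullity_xi z Up) k1).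
by move=> x /eqP; apply: contraTeq => /(Gpos Up)/gt_eqF/negbT.
Qed.

(** For [kappa = 1] the field [S] vanishes throughout the chart, and hence so does its
    derivative. *)
Let dshape_form_eq0 p : U p -> kappa = 1 -> forall x y z, dshape_form p x y z = 0.
Proof.
move=> Up k1 x y z; rewrite /dshape_form.
have -> : nabla_end shape_xi p x = nabla_end (cst 0) p x.
  by apply: near_eq_nabla_end; apply: filterS (nearU Up) => q Uq; exact: shape_xi_eq0.
by rewrite nabla_end0 mulmx0 inner0l.
Qed.

Lemma dphi_formE p x y z : U p ->
  dphi_form p x y z =
  inner (G p) (x - x *m shape_xi p *m phi p) y * inner (G p) z (xi p)
  - inner (G p) y (xi p) * inner (G p) (x - x *m shape_xi p *m phi p) z.
Proof.
move=> Up.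
exact: (nabla_phi (g := inner (G p)) (J := fun x => x *m phi p)
  (S := fun x => x *m shape_xi p) (F := dphi_form p) (S3 := dshape_form p)
  (@gD p) (@gZ p) (fun x y => gC x y Up) (g_inj Up) (gxi Up) (fun x => J2 x Up)
  (xi_phi Up) (fun x y => gJ x y Up) (@JD p) (@JZ p) (@SD p) (@SZ p)
  (fun x y => shape_xi_sym x y Up) (shape_xi_xi Up) (fun x => shape_xi_phi x Up)
  (@FDr p) (@FZr p) (fun x y z w => FDl x y z w Up) (fun x y k z => FZl x y k z Up)
  (fun x y z => dphi_form_skew x y z Up) (fun x y z => dphi_form_cyc x y z Up)
  (fun x z => Fxi' x z Up) (fun x y z => FJ x y z Up)
  (@S3N p) (fun x y z => dshape_form_phi x y z Up)
  (fun y z => dphi_form_xi0 y z Up) (fun x y z => @nullity p x y z Up)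
  (fun x z => nullity_xi z Up) (dshape_form_eq0 Up)).
Qed.

Lemma along_mul_end x (V : 'rV[R]_d -> 'rV[R]_d) T p :
  differentiable V p -> differentiable T p ->
  along x (Gam^~ x) (fun q => V q *m T q) p
  = along x (Gam^~ x) V p *m T p + V p *m nabla_end T p x.
Proof.
move=> dV dT; rewrite /along nabla_endE (derive_mulmx x dV dT) !mulmx_linE !mulmxA.
have L (a b e f k : 'rV[R]_d) : a + b + e = a + f + (b + e - f) by mx_linear.
exact: L.
Qed.

(** The operator [x + h' x], written through [S] because this form is visibly differentiable. *)
Let Bm p : 'M[R]_d := 1%:M - shape_xi p *m phi p.

Let BmE p x : x *m Bm p = x - x *m shape_xi p *m phi p.
Proof. by rewrite /Bm mulmxBr mulmx1 mulmxA. Qed.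

Let dBm p y : U p -> differentiable (fun q => y *m Bm q : 'rV[R]_d) p.
Proof.
move=> Up; apply: differentiable_mulmx; first exact: differentiable_cst.
apply: differentiableB; first exact: differentiable_cst.
by apply: differentiable_mulmx; [exact: differentiable_shape_xi|exact: dphi].
Qed.

Let nabla_phiE p y z : U p -> z *m nabla_end phi p y =
  inner (G p) (y *m Bm p) z *: xi p - inner (G p) z (xi p) *: (y *m Bm p).
Proof.
move=> Up; apply: (g_inj Up) => w; have := dphi_formE y z w Up.
rewrite /dphi_form -BmE !innerE (gC (xi p) w Up) mulrC => ->.
by rewrite [X in X - _]mulrC.
Qed.

(** The first derivative is replaced by [nabla_phiE] near [p] before the second is taken. As [w] is
    orthogonal to [xi], the derivative of [I] drops out; as [K] vanishes at [p], so does that of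
    [Bm]. Thus no derivative of [h'] enters. *)
Let along2_phi p x y z w : U p ->
  inner (G p) z (xi p) = 0 -> inner (G p) w (xi p) = 0 ->
  inner (G p) (along x (Gam^~ x) (along y (Gam^~ y) (fun q => z *m phi q)) p) w =
  inner (G p) (y *m Bm p) z * inner (G p) (x *m nabla_xi p) w
  - (inner (G p) (z *m Gam p x) (xi p) + inner (G p) z (x *m nabla_xi p))
    * inner (G p) (y *m Bm p) w
  + inner (G p) ((z *m 'D_x (Gam^~ y) p + z *m Gam p y *m Gam p x) *m phi p) w
  - inner (G p) (z *m Gam p y) (xi p) * inner (G p) (x *m Bm p) w.
Proof.
move=> Up z0 w0.
pose I q := inner (G q) (y *m Bm q) (cst z q).
pose K q := inner (G q) (cst z q) (xi q).
pose W q : 'rV[R]_d := I q *: xi q - K q *: (y *m Bm q).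
pose Y q : 'rV[R]_d := z *m Gam q y *m phi q.
have dz : differentiable (cst z) p by exact: differentiable_cst.
have dI : differentiable I p := differentiable_inner (dG Up) (dBm y Up) dz.
have dK : differentiable K p := differentiable_inner (dG Up) dz (dxi Up).
have dIx := differentiable_scale dI (dxi Up).
have dKB := differentiable_scale dK (dBm y Up).
have dW : differentiable W p by exact: differentiableB.
have dzG : differentiable (fun q => z *m Gam q y : 'rV[R]_d) p.
  by apply: differentiable_mulmx => //; exact: dGam.
have dY : differentiable Y p by apply: differentiable_mulmx => //; exact: dphi.
have E : \near p, along y (Gam^~ y) (fun q => z *m phi q) p = W p + Y p.
  apply: filterS (nearU Up) => q Uq.
  by rewrite (along_mulmx y z (dphi Uq)) (nabla_phiE y z Uq).
have E1 : along x (Gam^~ x) (along y (Gam^~ y) (fun q => z *m phi q)) p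
   = along x (Gam^~ x) W p + along x (Gam^~ x) Y p.
  have L (a b e f : 'rV[R]_d) (C : 'M[R]_d) u : u = b + f -> a + e + u *m C
      = a + b *m C + (e + f *m C).
    by move=> ->; rewrite mulmxDl; mx_linear.
  apply: etrans (L _ _ _ _ _ _ (nbhs_singleton E)).
  apply: (f_equal (fun v => v + _)); apply: etrans (near_eq_derive x E) _.
  by apply: deriveD; exact: diff_derivable.
have DW : 'D_x W p = 'D_x I p *: xi p + I p *: 'D_x xi p
    - ('D_x K p *: (y *m Bm p) + K p *: 'D_x (fun q => y *m Bm q) p).
  apply: etrans (f_equal2 (fun a b => a - b) (derive_scale x dI (dxi Up))
    (derive_scale x dK (dBm y Up))).
  by apply: deriveB; exact: diff_derivable.
have K0 : K p = 0 by exact: z0.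
have DK : 'D_x K p = inner (G p) (z *m Gam p x) (xi p)
    + inner (G p) z (x *m nabla_xi p).
  by rewrite (derive_metric x Up dz (dxi Up)) along_cst nabla_xiE.
have E2 : inner (G p) (along x (Gam^~ x) W p) w =
    inner (G p) (y *m Bm p) z * inner (G p) (x *m nabla_xi p) w
  - 'D_x K p * inner (G p) (y *m Bm p) w.
  have L (a b e k : R) (v1 v2 v3 v4 u : 'rV[R]_d) (C : 'M[R]_d) :
      u = a *: v1 + b *: v2 - (e *: v3 + k *: v4) ->
      k = 0 -> inner (G p) v1 w = 0 ->
      inner (G p) (u + (b *: v1 - k *: v3) *m C) w
      = b * inner (G p) (v2 + v1 *m C) w - e * inner (G p) v3 w.
    move=> -> -> v1w; rewrite !scale0r addr0 subr0 -scalemxAl !innerE v1w; ring.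
  rewrite nabla_xiE//.
  by apply: (L _ _ _ _ _ _ _ _ _ _ DW K0); rewrite gC.
have E3 : along x (Gam^~ x) Y p =
   (z *m 'D_x (Gam^~ y) p + z *m Gam p y *m Gam p x) *m phi p
   + z *m Gam p y *m nabla_end phi p x.
  rewrite (along_mul_end x dzG (dphi Up)) {1}/along.
  by rewrite (derive_mulmxr z x (dGam y Up)).
rewrite E1 E3 innerDl E2 DK innerDl (nabla_phiE x _ Up) innerBl !innerZl.
rewrite (gC (xi p) w Up) w0 mulr0 sub0r.
exact: addrA.
Qed.

Let Bm_h p x : U p -> x *m Bm p = x + hprime phi xi p x.
Proof. by move=> Up; rewrite BmE hprimeE. Qed.

Let Bm_phi p x : U p -> x *m Bm p *m phi p = - (x *m nabla_xi p).
Proof.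
move=> Up; rewrite BmE mulmxBl (J2 (x *m shape_xi p) Up) nabla_xi_shape opprK.
by rewrite (shape_xi_sym _ _ Up) shape_xi_xi// inner0r scale0r addr0 opprK addrC.
Qed.

Let R4 p x y z w := inner (G p) (z *m riem_mx G p x y) w.

(** Antisymmetrizing [along2_phi] in [x] and [y] gives [R(x, y) (phi z) - phi (R(x, y) z)] by the
    Ricci identity; skewness moves the outer [phi] to [w]. *)
Let curv_phi p x y z w : U p ->
  inner (G p) z (xi p) = 0 -> inner (G p) w (xi p) = 0 ->
  R4 p x y (z *m phi p) w + R4 p x y z (w *m phi p) =
  - inner (G p) (y *m Bm p) z * inner (G p) (x *m Bm p *m phi p) w
  + inner (G p) (x *m Bm p *m phi p) z * inner (G p) (y *m Bm p) w
  + inner (G p) (x *m Bm p) z * inner (G p) (y *m Bm p *m phi p) w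
  - inner (G p) (y *m Bm p *m phi p) z * inner (G p) (x *m Bm p) w.
Proof.
move=> Up z0 w0.
have dzphi : \near p, differentiable (fun q => z *m phi q : 'rV[R]_d) p.
  by apply: filterS (nearU Up) => q Uq; apply: differentiable_mulmx => //; exact: dphi.
have dDz v : differentiable ('D_v (fun q => z *m phi q : 'rV[R]_d)) p.
  have dD : differentiable ('D_v phi) p by exact: smooth_differentiable1 Up.
  have dzD := differentiable_mulmx (differentiable_cst z p) dD.
  apply: near_eq_differentiable dzD; apply: filterS (nearU Up) => q Uq.
  exact: esym (derive_mulmxr z v (dphi Uq)).
have RI := ricci_identity dzphi (dDz x) (dDz y) (dGam x Up) (dGam y Up).
have := f_equal (fun v => inner (G p) v w) RI; rewrite /= innerBl.
rewrite (along2_phi x y Up z0 w0) (along2_phi y x Up z0 w0) => H.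
rewrite /R4 /riem_mx -H !Bm_phi// !innerNl.
rewrite -[inner (G p) _ (w *m phi p)]opprK -gJ//.
rewrite (gC (x *m nabla_xi p) z Up) (gC (y *m nabla_xi p) z Up).
have E : z *m conn_curv x y (Gam^~ x) (Gam^~ y) p =
    (z *m 'D_x (Gam^~ y) p + z *m Gam p y *m Gam p x)
    - (z *m 'D_y (Gam^~ x) p + z *m Gam p x *m Gam p y).
  rewrite /conn_curv !mulmx_linE !mulmxA.
  have L (a b e f : 'rV[R]_d) : a - b + e - f = a + e - (b + f) by mx_linear.
  exact: L.
rewrite E mulmxBl innerBl.
have L (Iy ax kx cx b_y d1 ky bx Ix ay cy d2 : R) :
  Iy * ax - (kx + cx) * b_y + d1 - ky * bx
  - (Ix * ay - (ky + cy) * bx + d2 - kx * b_y) - (d1 - d2)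
  = - Iy * - ax + - cx * b_y + Ix * - ay - - cy * bx by ring.
exact: L.
Qed.

(** Both sides are homogeneous of degree four in [x], so [x] is scaled by [r] to unit length; then
    the denominator in [sectional] is 1. *)
Let R4_hol p x : U p -> inner (G p) x (xi p) = 0 ->
  R4 p x (x *m phi p) (x *m phi p) x = c * inner (G p) x x ^+ 2.
Proof.
move=> Up x0; have [->|xn0] := eqVneq x 0.
  by rewrite /R4 !mul0mx !inner0l expr0n mulr0.
have xx := Gpos Up xn0; set k := inner (G p) x x in xx *.
pose r := (Num.sqrt k)^-1; have rk : r ^+ 2 * k = 1.
  by rewrite /r exprVn sqr_sqrtr ?ltW// mulVf// gt_eqF.
have r0 : r != 0 by rewrite invr_eq0 sqrtr_eq0 -ltNge.
have y1 : inner (G p) (r *: x) (r *: x) = 1 by rewrite innerZl innerZr mulrA -expr2 rk.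
have y0 : inner (G p) (r *: x) (xi p) = 0 by rewrite innerZl x0 mulr0.
have := phi_sectional Up y1 y0; rewrite /sectional y1.
have -> : inner (G p) (r *: x) (r *: x *m phi p) = 0.
  have := gJ (r *: x) (r *: x) Up; rewrite (gC (r *: x *m phi p) _ Up).
  by set t := inner _ _ _; lra.
rewrite -[inner (G p) (r *: x *m phi p) (r *: x *m phi p)]opprK.
rewrite -[in X in - X]phi_skew//.
rewrite (J2 (r *: x) Up) y0 scale0r addr0 innerNr opprK y1 mul1r expr0n subr0 divr1.
rewrite (riemE oU sG Gpos _ _ _ Up) -scalemxAl (riem_mxZ oU sG Gpos _ _ _ Up).
rewrite riem_mx_skew (riem_mxZ oU sG Gpos _ _ _ Up) -scalerN -riem_mx_skew.
rewrite -!scalemxAl -!scalemxAr !innerZl innerZr -/(R4 p x (x *m phi p) (x *m phi p) x).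
by move=> <-; rewrite -[LHS]mulr1 -[X in _ * X](expr1n _ 2) -rk; ring.
Qed.

Theorem contact_space_form_curv p x y : U p ->
  inner (G p) (riem G p x y y) x =
  model_curv (inner (G p)) (xi p) (fun v => v *m phi p) (hprime phi xi p)
    kappa mu c x y y x.
Proof.
move=> Up; rewrite (riemE oU sG Gpos _ _ _ Up) -/(R4 p x y y x).
have hD v w : hprime phi xi p (v + w) = hprime phi xi p v + hprime phi xi p w.
  by rewrite !hprimeE// !mulmxDl opprD.
have hZ k v : hprime phi xi p (k *: v) = k *: hprime phi xi p v.
  by rewrite !hprimeE// -!scalemxAl scalerN.
have h_sym v w := hprime_sym v w Up.
have h_xi : hprime phi xi p (xi p) = 0 by rewrite hprimeE// shape_xi_xi// mul0mx oppr0.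
have h_J v := hprime_phi v Up.
have RD v t w z z' : R4 p (v + t) w z z' = R4 p v w z z' + R4 p t w z z'.
  by rewrite /R4 (riem_mxD oU sG Gpos _ _ _ Up) mulmxDr innerDl.
have RZ k v w z z' : R4 p (k *: v) w z z' = k * R4 p v w z z'.
  by rewrite /R4 (riem_mxZ oU sG Gpos _ _ _ Up) -scalemxAr innerZl.
have R12 v w z z' : R4 p w v z z' = - R4 p v w z z'.
  by rewrite /R4 riem_mx_skew mulmxN innerNl.
have R34 v w z z' : R4 p v w z' z = - R4 p v w z z'.
  by rewrite /R4 (riem_inner_skew oU sG Gsym Gpos _ _ _ _ Up) gC.
have Rb v w z z' : R4 p v w z z' + R4 p w z v z' + R4 p z v w z' = 0.
  by rewrite /R4 -!innerDl (riem_bianchi oU sG Gsym Gpos _ _ _ Up) inner0l.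
have Rx v w z : R4 p v w (xi p) z =
    kappa * (inner (G p) w (xi p) * inner (G p) v z
             - inner (G p) v (xi p) * inner (G p) w z)
  + mu * (inner (G p) w (xi p) * inner (G p) (hprime phi xi p v) z
          - inner (G p) v (xi p) * inner (G p) (hprime phi xi p w) z).
  have L (a b : R) (hv hw : 'rV[R]_d) :
      inner (G p) (kappa *: (a *: v - b *: w) + mu *: (a *: hv - b *: hw)) z
      = kappa * (a * inner (G p) v z - b * inner (G p) w z)
        + mu * (a * inner (G p) hv z - b * inner (G p) hw z) by rewrite !innerE.
  rewrite (inner_xi v Up) (inner_xi w Up) /R4 -(riemE oU sG Gpos _ _ _ Up).
  exact: etrans (f_equal (fun t => inner (G p) t z) (riem_xi v w Up))
    (L _ _ (hprime phi xi p v) (hprime phi xi p w)).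
have RJ v w z t : inner (G p) z (xi p) = 0 -> inner (G p) t (xi p) = 0 ->
    R4 p v w (z *m phi p) t + R4 p v w z (t *m phi p) =
    - inner (G p) (w + hprime phi xi p w) z
      * inner (G p) ((v + hprime phi xi p v) *m phi p) t
    + inner (G p) ((v + hprime phi xi p v) *m phi p) z
      * inner (G p) (w + hprime phi xi p w) t
    + inner (G p) (v + hprime phi xi p v) z
      * inner (G p) ((w + hprime phi xi p w) *m phi p) t
    - inner (G p) ((w + hprime phi xi p w) *m phi p) z
      * inner (G p) (v + hprime phi xi p v) t.
  by move=> z0 t0; rewrite (curv_phi v w Up z0 t0) !(Bm_h _ Up).
exact: (space_form_curv (g := inner (G p)) (J := fun v => v *m phi p)
  (@gD p) (@gZ p) (fun x y => gC x y Up) (gxi Up) (fun x => J2 x Up) (xi_phi Up)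
  (fun x y => gJ x y Up) (@JD p) (@JZ p) hD hZ h_sym h_xi h_J RD RZ R12 R34 Rb Rx RJ
  (fun x => @R4_hol p x Up)).
Qed.

End ContactChart.

(** * The Gauss equation *)

Section Gauss.
Context {R : realType} {d n : nat}.
Context (U : set 'rV[R]_d) (G : 'rV[R]_d -> 'M[R]_d).
Context (oU : open U) (sG : smooth_on U G).
Context (Gsym : forall p, U p -> (G p)^T = G p).
Context (Gpos : forall p x, U p -> x != 0 -> 0 < inner (G p) x x).
Context (W : set 'rV[R]_n) (F : 'rV[R]_n -> 'rV[R]_d).
Context (oW : open W) (sF : smooth_on W F) (FU : forall u, W u -> U (F u)).
Context (P : 'rV[R]_d -> 'rV[R]_d) (sP : smooth_on U P) (a b : R).
Implicit Types (u q x y z w : 'rV[R]_n) (V : 'rV[R]_n -> 'rV[R]_d).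

Notation C := (semisym G P a b).
Notation ip q := (inner (G (F q))).
Notation piF q := (pi_form G P (F q)).
Notation cov x := (along x (pull_mx G F x)).

Let nearW u : W u -> \near u, W u.
Proof. by move=> Wu; exact: open_nbhs_nbhs. Qed.

Let dF u : W u -> differentiable F u.
Proof. exact: smooth_differentiable. Qed.

Let dDF y u : W u -> differentiable ('D_y F) u.
Proof. exact: smooth_differentiable1. Qed.

Let dGF u : W u -> differentiable (fun q => G (F q)) u.
Proof.
by move=> Wu; exact: differentiable_comp (dF Wu) (smooth_differentiable sG (FU Wu)).
Qed.

Let dPF u : W u -> differentiable (fun q => P (F q)) u.
Proof.
by move=> Wu; exact: differentiable_comp (dF Wu) (smooth_differentiable sP (FU Wu)).
Qed.

Let DF q x : W q -> 'D_x F q = x *m 'J F q.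
Proof. by move=> Wq; rewrite deriveEjacobian//; exact: dF. Qed.

Let dJF u : W u -> differentiable (fun q => 'J F q : 'M[R]_(n, d)) u.
Proof.
move=> Wu; apply: differentiable_mx => i j.
apply: near_eq_differentiable (differentiable_entry 0 j (dDF (delta_mx 0 i) Wu)).
by apply: filterS (nearW Wu) => q Wq; rewrite DF// -rowE mxE.
Qed.

Lemma inner_induced_metric q x y : W q ->
  inner (induced_metric G F q) x y = ip q ('D_x F q) ('D_y F q).
Proof. by move=> Wq; rewrite !DF// /induced_metric /inner trmx_mul !mulmxA. Qed.

Let dind u : W u -> differentiable (induced_metric G F) u.
Proof.
move=> Wu; apply: differentiable_mulmx; last exact: differentiable_trmx (dJF Wu).
by apply: differentiable_mulmx; [exact: dJF|exact: dGF].
Qed.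

Lemma inner_tancoord q v z : W q -> induced_metric G F q \in unitmx ->
  inner (induced_metric G F q) (tancoord G F q v) z = ip q v ('D_z F q).
Proof.
by move=> Wq Gq; rewrite DF// /tancoord /inner mulmxKV// trmx_mul !mulmxA.
Qed.

Lemma inner_norpart q v z : W q -> induced_metric G F q \in unitmx ->
  ip q (norpart G F q v) ('D_z F q) = 0.
Proof.
move=> Wq Gq; rewrite /norpart /tanpart innerBl -inner_induced_metric//.
by rewrite inner_tancoord// subrr.
Qed.

Lemma differentiable_tancoord V u : W u -> induced_metric G F u \in unitmx ->
  differentiable V u -> differentiable (fun q => tancoord G F q (V q)) u.
Proof.
move=> Wu Gu dV; apply: differentiable_mulmx; last first.
  exact: differentiable_invmx Gu (dind Wu).
apply: differentiable_mulmx; last exact: differentiable_trmx (dJF Wu).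
by apply: differentiable_mulmx => //; exact: dGF.
Qed.

Lemma differentiable_tanpart V u : W u -> induced_metric G F u \in unitmx ->
  differentiable V u -> differentiable (fun q => tanpart G F q (V q)) u.
Proof.
move=> Wu Gu dV.
apply: (@near_eq_differentiable _ _ _ (fun q => tancoord G F q (V q) *m 'J F q)).
  by apply: filterS (nearW Wu) => q Wq; rewrite /tanpart DF.
by apply: differentiable_mulmx; [exact: differentiable_tancoord|exact: dJF].
Qed.

(* The derivative along [F], in the ambient connection, of a field along [F]. *)
Let scov x V q : 'rV[R]_d :=
  cov x V q + (a * piF q ('D_x F q)) *: V q + (b * piF q (V q)) *: 'D_x F q.

Let covd_alongE x (Y : 'rV[R]_n -> 'rV[R]_n) q : W q ->
  covd_along C F (cst x) Y q = scov x (fun q => 'D_(Y q) F q) q.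
Proof.
move=> Wq; rewrite /covd_along /scov /semisym (christoffelE sG _ _ (FU Wq)).
by rewrite !addrA.
Qed.

Let second_ffE u x y : W u -> second_ff G C F u x y = norpart G F u (scov x ('D_y F) u).
Proof. by move=> Wu; rewrite /second_ff covd_alongE. Qed.

Let dcov x y u : W u -> differentiable (cov x ('D_y F)) u.
Proof.
move=> Wu; apply: along_differentiable; first exact: dDF.
  exact: smooth_differentiable2 Wu.
exact: (differentiable_pull_mx sG Gpos oW sF FU).
Qed.

Let dpi V u : W u -> differentiable V u -> differentiable (fun q => piF q (V q)) u.
Proof. by move=> Wu dV; exact: differentiable_inner (dGF Wu) (dPF Wu) dV. Qed.

Let dscov x y u : W u -> differentiable (scov x ('D_y F)) u.
Proof.
move=> Wu; have dX := dDF x Wu; have dY := dDF y Wu.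
apply: differentiableD.
  apply: differentiableD; first exact: dcov.
  by apply: differentiable_scale => //; apply: differentiable_mulrl; exact: dpi.
by apply: differentiable_scale => //; apply: differentiable_mulrl; exact: dpi.
Qed.

Let near_scov x V V' u : (\near u, V u = V' u) -> scov x V u = scov x V' u.
Proof.
move=> VV'; rewrite /scov /along (nbhs_singleton VV').
exact: (f_equal (fun v => v + _ + _ + _) (near_eq_derive x VV')).
Qed.

Let scovB x V V' u : differentiable V u -> differentiable V' u ->
  scov x (fun q => V q - V' q) u = scov x V u - scov x V' u.
Proof.
move=> dV dV'; have -> : scov x (fun q => V q - V' q) u =
    cov x V u - cov x V' u + (a * piF u ('D_x F u)) *: (V u - V' u)
    + (b * (piF u (V u) - piF u (V' u))) *: 'D_x F u.
  by rewrite /scov (alongB x _ dV dV') -innerBr.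
have L (v v' z z' w : 'rV[R]_d) (k p p' : R) :
  v - v' + k *: (z - z') + (b * (p - p')) *: w
  = v + k *: z + (b * p) *: w - (v' + k *: z' + (b * p') *: w) by mx_linear.
exact: L.
Qed.

(** Differentiating the orthogonality of [V] to ['D_z F] moves the Levi-Civita derivative over to
    ['D_z F]. The term with [a] is a multiple of [V] and vanishes; the one with [b] is tangent and
    survives. *)
Let inner_scov_normal x z V u : W u -> differentiable V u ->
  (\near u, ip u (V u) ('D_z F u) = 0) ->
  ip u (scov x V u) ('D_z F u) =
  - ip u (V u) (cov x ('D_z F) u) + b * piF u (V u) * ip u ('D_x F u) ('D_z F u).
Proof.
move=> Wu dV V0; have V0u := nbhs_singleton V0.
have := along_compat oU sG Gsym Gpos sF FU x Wu dV (dDF z Wu).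
have -> : 'D_x (fun q => ip q (V q) ('D_z F q)) u = 0.
  by apply: etrans (near_eq_derive x V0) _; rewrite derive_cst.
rewrite /scov innerDl innerDl !innerZl V0u mulr0 addr0.
have L (e f h : R) : 0 = e + f -> e + h = - f + h by lra.
exact: L.
Qed.

(** The ambient curvature of the semi-symmetric connection. Terms with [a] are multiples of
    ['D_y F], which is orthogonal to ['D_x F], or cancel under antisymmetrization. In those with
    [b], the Levi-Civita derivative of ['D_y F] inside [pi] cancels and the derivative of [P]
    remains. *)
Let inner_scov_tangent x y u : W u ->
  ip u ('D_x F u) ('D_y F u) = 0 -> ip u ('D_x F u) ('D_x F u) = 1 ->
  ip u (scov x (scov y ('D_y F)) u) ('D_x F u)
  - ip u (scov y (scov x ('D_y F)) u) ('D_x F u)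
  = ip u (riem G (F u) ('D_x F u) ('D_y F u) ('D_y F u)) ('D_x F u)
    - b * ip u (cov y (fun q => P (F q)) u) ('D_y F u)
    + b ^+ 2 * piF u ('D_y F u) ^+ 2.
Proof.
move=> Wu XY XX; have Up := FU Wu; have dX := dDF x Wu; have dY := dDF y Wu.
have YX : ip u ('D_y F u) ('D_x F u) = 0 by rewrite innerC ?Gsym.
have dk c z : differentiable (fun q => c * piF q ('D_z F q)) u.
  exact: (differentiable_mulrl c (dpi Wu (dDF z Wu))).
have Dk c v z : 'D_v (fun q => c * piF q ('D_z F q)) u
    = c * 'D_v (fun q => piF q ('D_z F q)) u.
  exact: (derive_mulrl c v (dpi Wu (dDF z Wu))).
have dkV c z v : differentiable (fun q => (c * piF q ('D_z F q)) *: 'D_v F q) u.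
  by apply: differentiable_scale => //; exact: dDF.
have E v w : cov v (scov w ('D_y F)) u = cov v (cov w ('D_y F)) u
    + ((a * 'D_v (fun q => piF q ('D_w F q)) u) *: 'D_y F u
       + (a * piF u ('D_w F u)) *: cov v ('D_y F) u)
    + ((b * 'D_v (fun q => piF q ('D_y F q)) u) *: 'D_w F u
       + (b * piF u ('D_y F u)) *: cov v ('D_w F) u).
  rewrite -!Dk.
  apply: etrans (alongD v _ (differentiableD (dcov w y Wu) (dkV a w y)) (dkV b y w)) _.
  apply: f_equal2; last exact: along_scale (dk b y) (dDF w Wu).
  apply: etrans (alongD v _ (dcov w y Wu) (dkV a w y)) _.
  by apply: f_equal2 => //; exact: along_scale (dk a w) dY.
have nY : \near u, differentiable ('D_y F) u.
  by apply: filterS (nearW Wu) => q; exact: dDF.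
have dDY v : differentiable ('D_v ('D_y F)) u by exact: smooth_differentiable2 Wu.
have dpull v := differentiable_pull_mx sG Gpos oW sF FU v Wu.
have RI := ricci_identity nY (dDY x) (dDY y) (dpull x) (dpull y).
rewrite (conn_curv_pull oU sG Gpos oW sF FU x y Wu) -(riemE oU sG Gpos _ _ _ Up) in RI.
have {}RI := f_equal (fun v => ip u v ('D_x F u)) RI; rewrite /= innerBl in RI.
have S := along_sym oU sG Gsym oW sF FU y x Wu.
have Dpi := along_compat oU sG Gsym Gpos sF FU y Wu (dPF Wu) dY.
have Epi : piF u (scov y ('D_y F) u) = piF u (cov y ('D_y F) u)
    + a * piF u ('D_y F u) * piF u ('D_y F u) + b * piF u ('D_y F u) * piF u ('D_y F u).
  have L (p v v' : 'rV[R]_d) (k : R) : ip u p (v + (a * k) *: v' + (b * k) *: v') =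
      ip u p v + a * k * ip u p v' + b * k * ip u p v' by rewrite !innerE.
  exact: L.
have L (v v' cx cx' cy X Y : 'rV[R]_d) (p q t s s1 d1 d2 d3 al : R) :
    ip u Y X = 0 -> ip u X X = 1 -> d3 = al + t -> cx' = cx ->
    s1 = t + a * q * q + b * q * q ->
    ip u (v + ((a * d1) *: Y + (a * q) *: cx) + ((b * d1) *: Y + (b * q) *: cx)
        + (a * p) *: (cy + (a * q) *: Y + (b * q) *: Y) + (b * s1) *: X) X
    - ip u (v' + ((a * d2) *: Y + (a * p) *: cy) + ((b * d3) *: X + (b * q) *: cx')
        + (a * q) *: (cx + (a * p) *: Y + (b * q) *: X) + (b * s) *: Y) X
    = ip u v X - ip u v' X - b * al + b ^+ 2 * q ^+ 2.
  by move=> YX0 XX1 -> -> ->; rewrite !innerE YX0 XX1; ring.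
rewrite -RI {1 3}/scov !E.
exact: (L _ _ _ _ _ _ _ _ _ _ _ _ _ _ _ _ YX XX Dpi S Epi).
Qed.

(** The induced derivative is the ambient one minus its normal part [N], so a second differentiation
    adds values of [inner_scov_normal]. The last term comes from the multiple of ['D_x F] in the
    derivative of [N y] along [x]. *)
Lemma induced_riem_gauss u x y : W u -> induced_metric G F u \in unitmx ->
  ip u ('D_x F u) ('D_y F u) = 0 -> ip u ('D_x F u) ('D_x F u) = 1 ->
  induced_riem G C F u x y y x
  = ip u (riem G (F u) ('D_x F u) ('D_y F u) ('D_y F u)) ('D_x F u)
    - b * ip u (cov y (fun q => P (F q)) u) ('D_y F u)
    + b ^+ 2 * piF u ('D_y F u) ^+ 2
    + ip u (second_ff G C F u y y) (second_ff G C F u x x)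
    - ip u (second_ff G C F u x y) (second_ff G C F u x y)
    - b * piF u (second_ff G C F u y y).
Proof.
move=> Wu Gu XY XX.
(* Orthogonality of [N] to tangent vectors gets differentiated, so it must hold in a neighbourhood
   of [u]. *)
have nearG : \near u, induced_metric G F u \in unitmx by exact: near_unitmx (dind Wu).
pose N v q := norpart G F q (scov v ('D_y F) q).
have dtan v : differentiable (fun q => tanpart G F q (scov v ('D_y F) q)) u.
  exact: (differentiable_tanpart Wu Gu (dscov v y Wu)).
have dN v : differentiable (N v) u.
  exact: (differentiableB (dscov v y Wu) (dtan v)).
have N0 v z : \near u, ip u (N v u) ('D_z F u) = 0.
  by apply: filterS2 (nearW Wu) nearG => q Wq Gq; exact: inner_norpart.
have conn v w : inner (induced_metric G F u) (induced_conn G C F (cst v)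
      (induced_conn G C F (cst w) (cst y)) u) x
    = ip u (scov v (scov w ('D_y F)) u) ('D_x F u)
      - ip u (scov v (N w) u) ('D_x F u).
  rewrite /induced_conn inner_tancoord// covd_alongE//.
  rewrite -innerBl -(scovB v (dscov w y Wu) (dN w)); congr inner.
  apply: near_scov; apply: filterS (nearW Wu) => q Wq.
  rewrite covd_alongE//.
  by rewrite /N /norpart opprB addrC subrK.
have conn0 : induced_conn G C F (lie_bracket (cst x) (cst y)) (cst y) u = 0.
  rewrite /induced_conn /covd_along lie_bracket_cst !derive0 add0r /semisym.
  have C0 : christoffel G (F u) 0 ('D_y F u) = 0.
    have Z := christoffel_mxZ sG 0 0 (FU Wu); rewrite !scale0r in Z.
    by rewrite (christoffelE sG _ _ (FU Wu)) Z mulmx0.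
  rewrite /= C0 /pi_form inner0r mulr0 scale0r scaler0 !addr0.
  by rewrite /tancoord !mul0mx.
(* The terms of the connection with [a] and [b] are tangent, so against a normal vector only the
   Levi-Civita derivative counts. *)
have NE v w z : ip u (N v u) (second_ff G C F u w z) = ip u (N v u) (cov w ('D_z F) u).
  have N0u v' := nbhs_singleton (N0 v v').
  have L (e X Z t : 'rV[R]_d) (k k' : R) : ip u (N v u) X = 0 ->
      ip u (N v u) Z = 0 -> ip u (N v u) t = 0 ->
      ip u (N v u) (e + k *: Z + k' *: X - t) = ip u (N v u) e.
    by move=> mX mZ mt; rewrite innerBr !innerDr !innerZr mX mZ mt; ring.
  rewrite (second_ffE _ _ Wu); exact: (L _ _ _ _ _ _ (N0u w) (N0u z) (N0u _)).
have sE w : second_ff G C F u w y = N w u := second_ffE w y Wu.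
have T := inner_scov_tangent Wu XY XX.
have n1 := inner_scov_normal x Wu (dN y) (N0 y x).
have n2 := inner_scov_normal y Wu (dN x) (N0 x x).
have D : induced_riem G C F u x y y x =
    ip u (scov x (scov y ('D_y F)) u) ('D_x F u) - ip u (scov x (N y) u) ('D_x F u)
    - (ip u (scov y (scov x ('D_y F)) u) ('D_x F u)
       - ip u (scov y (N x) u) ('D_x F u)).
  have L (v v' v0 : 'rV[R]_n) : v0 = 0 -> inner (induced_metric G F u) (v - v' - v0) x
      = inner (induced_metric G F u) v x - inner (induced_metric G F u) v' x.
    by move=> ->; rewrite subr0 innerBl.
  apply: etrans (L _ _ _ conn0) _.
  exact: (f_equal2 (fun s t => s - t) (conn x y) (conn y x)).
have E1 : ip u (second_ff G C F u y y) (second_ff G C F u x x)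
    = ip u (N y u) (cov x ('D_x F) u).
  exact: etrans (f_equal (fun v => ip u v (second_ff G C F u x x)) (sE y)) (NE y x x).
have E2 : ip u (second_ff G C F u x y) (second_ff G C F u x y)
    = ip u (N x u) (cov y ('D_x F) u).
  apply: etrans (f_equal (fun v => ip u v (second_ff G C F u x y)) (sE x)) _.
  apply: etrans (NE x x y) _.
  exact: (f_equal (ip u (N x u)) (along_sym oU sG Gsym oW sF FU x y Wu)).
have E3 := f_equal (fun v => piF u v) (sE y).
have YX : ip u ('D_y F u) ('D_x F u) = 0.
  exact: etrans (innerC _ _ (Gsym (FU Wu))) XY.
have L (t1 t2 m1 m2 r nx nx' ny ny' p p' q g1 g0 : R) :
   t1 - t2 = r -> m1 = - nx + b * p * g1 -> m2 = - ny + b * q * g0 ->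
   g1 = 1 -> g0 = 0 -> nx' = nx -> ny' = ny -> p' = p ->
   t1 - m1 - (t2 - m2) = r + nx' - ny' - b * p'.
  by move=> <- -> -> -> -> -> -> ->; ring.
exact: etrans D (L _ _ _ _ _ _ _ _ _ _ _ _ _ _ T n1 n2 XX YX E1 E2 E3).
Qed.

(** As [pi = g(P, _)] and the metric is parallel, [(nabla_y pi)(z) = g(nabla_y P, z)]; the chain
    rule expresses this along [F]. *)
Lemma alpha'E u y z : W u -> alpha' G P (F u) ('D_y F u) ('D_z F u) =
  ip u (cov y (fun q => P (F q)) u) ('D_z F u).
Proof.
move=> Wu; have Up := FU Wu; have dP := smooth_differentiable sP Up.
have dc := differentiable_cst ('D_z F u) (F u).
have DG := metric_compat oU sG Gsym Gpos ('D_y F u) Up.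
have D := derive_inner_along (A := (christoffel_mx G)^~ ('D_y F u))
  (smooth_differentiable sG Up) dP dc DG.
have E : covd (christoffel G) (cst ('D_y F u)) (cst ('D_z F u)) (F u) =
    along ('D_y F u) ((christoffel_mx G)^~ ('D_y F u)) (cst ('D_z F u)) (F u).
  by rewrite /covd /along (christoffelE sG _ _ Up).
have E2 : along ('D_y F u) ((christoffel_mx G)^~ ('D_y F u)) P (F u)
    = cov y (fun q => P (F q)) u.
  exact: (f_equal (fun v => v + _) (esym (derive_comp y (dF Wu) dP))).
have L (t1 t2 t3 : R) : t1 = t2 + t3 -> t1 - t3 = t2 by move=> ->; rewrite addrK.
rewrite /alpha' E -E2; exact: L D.
Qed.

End Gauss.

(** * The Ricci inequality at a point *)

Section RicciBound.
Context {R : realFieldType} {V : lmodType R} {n : nat}.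
Context (g : V -> V -> R) (xi P : V) (J h : V -> V) (kappa mu c b : R).
Context (E : 'I_n -> V) (tg : V -> V) (al : 'I_n -> R) (s : 'I_n -> 'I_n -> V).
Context (i1 : 'I_n).
Implicit Types (x y z w : V) (i j : 'I_n).

Hypothesis gDl : forall x y z, g (x + y) z = g x z + g y z.
Hypothesis gZl : forall k x z, g (k *: x) z = k * g x z.
Hypothesis gC : forall x y, g x y = g y x.
Hypothesis g_ge0 : forall x, 0 <= g x x.
Hypothesis gJ : forall x y, g (J x) y = - g x (J y).
Hypothesis h_sym : forall x y, g (h x) y = g x (h y).
Hypothesis Jh_sym : forall x y, g (J (h x)) y = g (J (h y)) x.
Hypothesis gE : forall i j, g (E i) (E j) = (i == j)%:R.
Hypothesis tgE : forall w, tg w = \sum_j g w (E j) *: E j.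

Let g0l z : g 0 z = 0.
Proof. by rewrite -(scale0r 0) gZl mul0r. Qed.

Let g_suml (F : 'I_n -> V) z : g (\sum_j F j) z = \sum_j g (F j) z.
Proof. by apply: (big_morph (g^~ z)) => [x y|]; [exact: gDl | exact: g0l]. Qed.

Let g_tg w z : g z (tg w) = \sum_j g w (E j) * g z (E j).
Proof. by rewrite gC tgE g_suml; apply: eq_bigr => j _; rewrite gZl [g z _]gC. Qed.

Let g_tgE w j : g (E j) (tg w) = g w (E j).
Proof.
rewrite g_tg (bigD1 j)//= gE eqxx mulr1 big1 ?addr0// => i /negbTE ij.
by rewrite gE eq_sym ij mulr0.
Qed.

Let sq_tg w : g (tg w) (tg w) = \sum_j g w (E j) ^+ 2.
Proof.
by rewrite {1}tgE g_suml; apply: eq_bigr => j _; rewrite gZl g_tgE expr2.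
Qed.

Let h_tg x w : g x (h (tg w)) = \sum_j g w (E j) * g (h x) (E j).
Proof. by rewrite -h_sym g_tg. Qed.

(** Arranged so that each summand is a coefficient free of [j] times a quantity whose sum over the
    whole frame is a squared norm, a trace or [g (E i1) (h (tg xi))]. *)
Let curv_term j : j != i1 ->
  model_curv g xi J h kappa mu c (E i1) (E j) (E j) (E i1) =
  (c + 3) / 4 - (c + 3 - 4 * kappa) / 4 * g (E i1) xi ^+ 2 + g (h (E i1)) (E i1)
  + (- ((c + 3 - 4 * kappa) / 4) + (mu - 1) * g (h (E i1)) (E i1)) * (g xi (E j) ^+ 2)
  + 3 * (c - 1) / 4 * g (J (E i1)) (E j) ^+ 2
  + (2^-1 * g (h (E i1)) (E i1) + 1 + (mu - 1) * g (E i1) xi ^+ 2) * g (h (E j)) (E j)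
  + - 2^-1 * g (h (E i1)) (E j) ^+ 2
  + 2^-1 * g (J (h (E i1))) (E j) ^+ 2
  + - (2^-1 * g (J (h (E i1))) (E i1)) * g (J (h (E j))) (E j)
  + (2 - 2 * mu) * g (E i1) xi * (g xi (E j) * g (h (E i1)) (E j)).
Proof.
move=> /negbTE j1; rewrite /model_curv.
rewrite !gE !eqxx j1 [i1 == j]eq_sym j1 (Jh_sym (E j) (E i1)).
have JE : g (J (E j)) (E i1) = - g (J (E i1)) (E j) by rewrite gJ gC.
have JE' : g (E i1) (J (E j)) = - g (J (E i1)) (E j) by rewrite gC JE.
have JEj : g (E j) (J (E j)) = 0.
  by have := gJ (E j) (E j); rewrite gC; lra.
have hE : g (h (E j)) (E i1) = g (h (E i1)) (E j) by rewrite h_sym gC.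
by rewrite JE JE' JEj hE (gC xi (E j)) mulr1n mulr0n; field.
Qed.

(** The two sides differ by the square of [2^-1 *: y - x]. *)
Let sq_half x y : g (y - x) x <= 4^-1 * g y y.
Proof.
have := g_ge0 (2^-1 *: y - x).
have gDr v w z : g z (v + w) = g z v + g z w by rewrite gC gDl !(gC z).
have gZr k v z : g z (k *: v) = k * g z v by rewrite gC gZl gC.
rewrite -(scaleN1r x) !(gDl, gDr, gZl, gZr) (gC x y); lra.
Qed.

Theorem ricci_bound (etX : R) (H : V) :
  g (E i1) xi = etX -> H = n%:R^-1 *: \sum_j s j j ->
  \sum_(j | j != i1) (model_curv g xi J h kappa mu c (E i1) (E j) (E j) (E i1)
    - b * al j + b ^+ 2 * g P (E j) ^+ 2 + g (s j j) (s i1 i1)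
    - g (s i1 j) (s i1 j) - b * g P (s j j)) <=
  (n%:R - 1) * (c + 3) / 4
  + 3 * (c - 1) / 4 * g (tg (J (E i1))) (tg (J (E i1)))
  - (c + 3 - 4 * kappa) / 4 * ((n%:R - 2) * etX ^+ 2 + g (tg xi) (tg xi))
  + 2^-1 * (g (tg (J (h (E i1)))) (tg (J (h (E i1))))
            - g (tg (h (E i1))) (tg (h (E i1)))
            + g (E i1) (h (E i1)) * (\sum_j g (E j) (tg (h (E j))))
            - g (E i1) (J (h (E i1))) * (\sum_j g (E j) (tg (J (h (E j))))))
  + (n%:R - 2 - g (tg xi) (tg xi) + mu * g (tg xi) (tg xi)) * g (E i1) (h (E i1))
  + (1 - etX ^+ 2 + mu * etX ^+ 2) * (\sum_j g (E j) (tg (h (E j))))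
  + (2 - 2 * mu) * etX * g (E i1) (h (tg xi))
  - b * (\sum_j al j) + b * al i1 + b ^+ 2 * g (tg P) (tg P)
  - b ^+ 2 * g P (E i1) ^+ 2 - n%:R * b * g P H + b * g P (s i1 i1)
  + n%:R ^+ 2 / 4 * g H H.
Proof.
move=> etXE HE.
have n0 : n%:R != 0 :> R by rewrite pnatr_eq0 -lt0n; exact: leq_ltn_trans (ltn_ord i1).
have gZr k v z : g z (k *: v) = k * g z v by rewrite gC gZl gC.
set q := \sum_j s j j in HE.
have HP : n%:R * b * g P H = b * g P q by rewrite HE gZr; field.
have HH : n%:R ^+ 2 / 4 * g H H = 4^-1 * g q q by rewrite HE gZr gZl; field.
have gPq : g P q = \sum_j g P (s j j).
  by rewrite gC g_suml; apply: eq_bigr => j _; rewrite gC.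
have le_sff :
    \sum_(j | j != i1) (g (s j j) (s i1 i1) - g (s i1 j) (s i1 j)) <= 4^-1 * g q q.
  apply: le_trans (sq_half (s i1 i1) q).
  have -> : q - s i1 i1 = \sum_(j | j != i1) s j j.
    by rewrite /q (bigD1 i1)//= addrAC subrr add0r.
  rewrite (big_morph (g^~ _) (fun x y => gDl x y _) (g0l _)).
  (* The mixed terms [g (s i1 j) (s i1 j)] are nonnegative and are dropped; apart from [sq_half] no
     other estimate is made. *)
  by apply: ler_sum => j _; rewrite gerBl.
rewrite HP HH.
(* [T] is summed over all indices, where its parts become traces and norms, and [T i1] is subtracted
   afterwards. Its constant part counts [n] times; [T i1] takes away one [(c + 3) / 4], but two
   copies of the terms with [etX ^ 2] and [g (h (E i1)) (E i1)]. Hence the coefficients [n - 1] and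
   [n - 2]. *)
pose T j :=
  ((c + 3) / 4 - (c + 3 - 4 * kappa) / 4 * etX ^+ 2 + g (h (E i1)) (E i1))
  + (- ((c + 3 - 4 * kappa) / 4) + (mu - 1) * g (h (E i1)) (E i1)) * (g xi (E j) ^+ 2)
  + 3 * (c - 1) / 4 * g (J (E i1)) (E j) ^+ 2
  + (2^-1 * g (h (E i1)) (E i1) + 1 + (mu - 1) * etX ^+ 2) * g (h (E j)) (E j)
  + - 2^-1 * g (h (E i1)) (E j) ^+ 2
  + 2^-1 * g (J (h (E i1))) (E j) ^+ 2
  + - (2^-1 * g (J (h (E i1))) (E i1)) * g (J (h (E j))) (E j)
  + (2 - 2 * mu) * etX * (g xi (E j) * g (h (E i1)) (E j))
  + - b * al j + b ^+ 2 * g P (E j) ^+ 2 + - b * g P (s j j).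
have -> : \sum_(j | j != i1) (model_curv g xi J h kappa mu c (E i1) (E j) (E j) (E i1)
    - b * al j + b ^+ 2 * g P (E j) ^+ 2 + g (s j j) (s i1 i1)
    - g (s i1 j) (s i1 j) - b * g P (s j j))
  = (\sum_j T j - T i1)
    + \sum_(j | j != i1) (g (s j j) (s i1 i1) - g (s i1 j) (s i1 j)).
  rewrite [\sum_j T j](bigD1 i1)//= (addrAC (T i1)) subrr add0r -big_split/=.
  by apply: eq_bigr => j j1; rewrite (curv_term j1) /T etXE; ring.
have ET : \sum_j T j =
  n%:R * ((c + 3) / 4 - (c + 3 - 4 * kappa) / 4 * etX ^+ 2 + g (h (E i1)) (E i1))
  + (- ((c + 3 - 4 * kappa) / 4) + (mu - 1) * g (h (E i1)) (E i1)) * g (tg xi) (tg xi)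
  + 3 * (c - 1) / 4 * g (tg (J (E i1))) (tg (J (E i1)))
  + (2^-1 * g (h (E i1)) (E i1) + 1 + (mu - 1) * etX ^+ 2) * (\sum_j g (E j) (tg (h (E j))))
  + - 2^-1 * g (tg (h (E i1))) (tg (h (E i1)))
  + 2^-1 * g (tg (J (h (E i1)))) (tg (J (h (E i1))))
  + - (2^-1 * g (J (h (E i1))) (E i1)) * (\sum_j g (E j) (tg (J (h (E j)))))
  + (2 - 2 * mu) * etX * g (E i1) (h (tg xi))
  + - b * (\sum_j al j) + b ^+ 2 * g (tg P) (tg P) + - b * g P q.
  rewrite /T.
  move: ((c + 3) / 4 - (c + 3 - 4 * kappa) / 4 * etX ^+ 2 + g (h (E i1)) (E i1)) => k0.
  rewrite !sq_tg h_tg gPq !mulr_sumr !big_split/= sumr_const card_ord -[k0 *+ n]mulr_natl.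
  by do ?[congr (_ + _)]; apply: eq_bigr => j _; rewrite g_tgE.
have T1 : T i1 = (c + 3) / 4 - (c + 3 - 4 * kappa) / 4 * (2 * etX ^+ 2)
    + 2 * g (h (E i1)) (E i1) - b * al i1 + b ^+ 2 * g P (E i1) ^+ 2
    - b * g P (s i1 i1).
  have JE : g (J (E i1)) (E i1) = 0 by have := gJ (E i1) (E i1); rewrite (gC (E i1)); lra.
  by rewrite /T JE (gC xi) etXE; field.
rewrite ET T1 (gC (E i1) (h (E i1))) (gC (E i1) (J (h (E i1)))).
move: le_sff; lra.
Qed.

End RicciBound.

(** * The main theorem *)

Section OrthonormalFrame.
Context {R : realType} {d n : nat}.
Context (G : 'rV[R]_d -> 'M[R]_d) (F : 'rV[R]_n -> 'rV[R]_d) (u : 'rV[R]_n).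
Context (e : 'I_n -> 'rV[R]_n).
Hypothesis dF : differentiable F u.
Hypothesis orth : orthonormal_basis (induced_metric G F u) e.

Let M : 'M[R]_n := \matrix_i e i.

(** Orthonormality as a matrix identity, from which the induced metric is invertible with inverse
    [M^T *m M]. *)
Let gram : M *m (induced_metric G F u *m M^T) = 1%:M.
Proof.
apply/matrixP => i j; rewrite mulmxA [RHS]mxE -orth /inner !mxE.
apply: eq_bigr => k _; rewrite !mxE; congr (_ * _).
by apply: eq_bigr => k' _; rewrite !mxE.
Qed.

Lemma orthonormal_unitmx : induced_metric G F u \in unitmx.
Proof.
by have [] := mulmx1_unit (mulmx1C gram); rewrite unitmx_mul => /andP[].
Qed.

Lemma orthonormal_invmx : invmx (induced_metric G F u) = M^T *m M.
Proof.
have E : induced_metric G F u *m (M^T *m M) = 1%:M by rewrite mulmxA (mulmx1C gram).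
by rewrite -[RHS]mul1mx -(mulVmx orthonormal_unitmx) -mulmxA E mulmx1.
Qed.

(** With this inverse, the solution of the normal equations is the expansion in the frame. *)
Lemma tanpart_orthonormal w :
  tanpart G F u w = \sum_j inner (G (F u)) w ('D_(e j) F u) *: 'D_(e j) F u.
Proof.
have DF x : 'D_x F u = x *m 'J F u by exact: deriveEjacobian.
rewrite /tanpart DF /tancoord orthonormal_invmx mulmxA [_ *m M]mulmx_sum_row mulmx_suml.
apply: eq_bigr => j _; rewrite -scalemxAl rowK DF; congr (_ *: _).
rewrite /inner trmx_mul !mulmxA [LHS]mxE [RHS]mxE; apply: eq_bigr => k _.
by rewrite !mxE.
Qed.

End OrthonormalFrame.

Lemma rep_dom_open (R : realType) (n d : nat) (M : smoothManifold R n)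
    (N : smoothManifold R d) (f : M -> N) k l :
  continuous f -> open (rep_dom f k l).
Proof.
move=> cf; rewrite openE => u [ku lu].
have c : {for u, continuous (f \o cinv (atlas k))}.
  by apply: continuous_comp; [exact: cinv_continuous | exact: cf].
have A : \near u, cim (atlas k) u by apply: open_nbhs_nbhs; split=> //; exact: cim_open.
have B : \near u, cdom (atlas l) ((f \o cinv (atlas k)) u).
  by apply: c; apply: open_nbhs_nbhs; split=> //; exact: cdom_open.
by apply: filterS2 A B.
Qed.

Lemma inner_ge0 (R : realType) (d : nat) (G : 'M[R]_d) (x : 'rV[R]_d) :
  (forall y, y != 0 -> 0 < inner G y y) -> 0 <= inner G x x.
Proof. by move=> Gpos; have [->|/Gpos/ltW//] := eqVneq x 0; rewrite inner0l. Qed.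

Theorem theorem4p2 (R : realType) (m n : nat) (kappa mu c a b : R)
    (N : smoothManifold R (2 * m + 1)) (phi : endoField N)
    (xi : vectorField N) (eta : oneForm N) (g : metric N)
    (P : vectorField N) (M : smoothManifold R n) (f : M -> N) :
  (3 <= n)%N ->
  kappa_mu_space_form phi xi eta g kappa mu c ->
  immersion f ->
  forall (x : M) (k : chart_index M) (l : chart_index N),
    cdom (atlas k) x -> cdom (atlas l) (f x) ->
  let u := cmap (atlas k) x in
  let F := local_rep f k l in
  let p := F u in
  let ip := inner (g l p) in
  let et := evform (eta l p) in
  let ph := fun w : 'rV[R]_(2 * m + 1) => w *m phi l p in
  let h' := hprime (phi l) (xi l) p in
  let piP := pi_form (g l) (P l) p in
  let al := alpha' (g l) (P l) p in
  let tg := tanpart (g l) F u in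
  let C := semisym (g l) (P l) a b in
  let sff := second_ff (g l) C F u in
  forall (v : 'rV[R]_n) (e : 'I_n -> 'rV[R]_n) (i1 : 'I_n),
    inner (induced_metric (g l) F u) v v = 1 ->
    orthonormal_basis (induced_metric (g l) F u) e -> e i1 = v ->
  let E := fun i => 'D_(e i) F u in
  let X := 'D_v F u in
  let sq := fun w => ip w w in
  let xiT := tg (xi l p) in
  let PT := tg (P l p) in
  let trh := \sum_(i < n) ip (E i) (tg (h' (E i))) in
  let trph := \sum_(i < n) ip (E i) (tg (ph (h' (E i)))) in
  let lambda' := \sum_(i < n) al (E i) (E i) in
  let H := mean_curvature (g l) C F u e in
  ricci (g l) C F u e i1 <=
    (n%:R - 1) * (c + 3) / 4
    + 3 * (c - 1) / 4 * sq (tg (ph X))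
    - (c + 3 - 4 * kappa) / 4 * ((n%:R - 2) * et X ^+ 2 + sq xiT)
    + 2^-1 * (sq (tg (ph (h' X))) - sq (tg (h' X))
              + ip X (h' X) * trh - ip X (ph (h' X)) * trph)
    + (n%:R - 2 - sq xiT + mu * sq xiT) * ip X (h' X)
    + (1 - et X ^+ 2 + mu * et X ^+ 2) * trh
    + (2 - 2 * mu) * et X * ip X (h' xiT)
    - b * lambda' + b * al X X + b ^+ 2 * sq PT
    - b ^+ 2 * piP X ^+ 2 - n%:R * b * piP H + b * piP (sff v v)
    + n%:R ^+ 2 / 4 * sq H.
Proof.
move=> _ [[[acm d_eta] riem_xi] phi_sec] [cf sf _] x k l kx lx u F p ip et ph h'
  piP al tg C sff v e i1 _ orth ev.
lazy zeta; pose E i := 'D_(e i) F u; pose H := mean_curvature (g l) C F u e.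
have oW : open (rep_dom f k l) by exact: rep_dom_open.
have Wu : rep_dom f k l u by split; [exact: cmap_cim | rewrite /u cmapK].
have sF : smooth_on (rep_dom f k l) F by exact: sf.
have FU q : rep_dom f k l q -> cim (atlas l) (F q) by case=> _; exact: cmap_cim.
have Up : cim (atlas l) p by exact: FU.
have dF := smooth_differentiable sF Wu.
have oU : open (cim (atlas l)) by exact: cim_open.
have sG : smooth_on (cim (atlas l)) (g l) by exact: mcomp_smooth.
have sP : smooth_on (cim (atlas l)) (P l) by exact: vcomp_smooth.
have Gsym := @mcomp_sym _ _ _ g l; have Gpos := @mcomp_pos _ _ _ g l.
have phi2 q y : cim (atlas l) q ->
    y *m phi l q *m phi l q = - y + evform (eta l q) y *: xi l q.
  by move=> /acm[].
have eta_xi q : cim (atlas l) q -> evform (eta l q) (xi l q) = 1 by move=> /acm[].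
have xi_phi q : cim (atlas l) q -> xi l q *m phi l q = 0 by move=> /acm[].
have phi_skew q y z : cim (atlas l) q ->
    inner (g l q) y (z *m phi l q) = - inner (g l q) (y *m phi l q) z.
  by move=> /acm[_ _ _ _ []].
have inner_xi q y : cim (atlas l) q -> inner (g l q) y (xi l q) = evform (eta l q) y.
  by move=> /acm[_ _ _ _ []].
have sphi : smooth_on (cim (atlas l)) (phi l) by exact: ecomp_smooth.
have sxi : smooth_on (cim (atlas l)) (xi l) by exact: vcomp_smooth.
have seta : smooth_on (cim (atlas l)) (eta l) by exact: ocomp_smooth.
have h_sym y z := hprime_sym oU sG Gsym Gpos sphi sxi seta phi2 eta_xi xi_phi
  phi_skew inner_xi (fun q y z => d_eta l q y z) y z Up.
have Jh_sym y z := phi_hprime_sym oU sG Gsym Gpos sphi sxi seta phi2 eta_xi xi_phi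
  phi_skew inner_xi (fun q y z => d_eta l q y z) y z Up.
have curvE y z := contact_space_form_curv oU sG Gsym Gpos sphi sxi seta phi2 eta_xi
  xi_phi phi_skew inner_xi (fun q y z => d_eta l q y z)
  (fun q y z => riem_xi l q y z) (fun q y => phi_sec l q y) y z Up.
have ind := orthonormal_unitmx orth.
have ipE i j : ip (E i) (E j) = (i == j)%:R.
  exact: etrans (esym (inner_induced_metric (g l) sF (e i) (e j) Wu)) (orth i j).
have tgE w : tg w = \sum_j ip w (E j) *: E j := tanpart_orthonormal dF orth w.
have phJ y z : ip (ph y) z = - ip y (ph z).
  have L (r s : R) : s = - r -> r = - s by move=> ->; rewrite opprK.
  exact: L _ _ (phi_skew p y z Up).
have bound := ricci_bound (g := ip) (xi := xi l p) (P l p) (J := ph) (h := h') kappa mu c b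
  (E := E) (tg := tg) (fun j => al (E j) (E j)) (s := fun i j => sff (e i) (e j)) (i1 := i1)
  (fun x y z => innerDl (g l p) x y z) (fun k x z => innerZl (g l p) k x z)
  (fun x y => innerC x y (Gsym p Up)) (fun x => inner_ge0 x (fun y => Gpos p y Up))
  phJ h_sym Jh_sym ipE tgE (inner_xi p (E i1) Up) (erefl H).
(* Termwise Gauss equation, with the ambient curvature replaced by the model tensor and the
   derivative of [P] by [alpha']. *)
have ric : ricci (g l) C F u e i1 = \sum_(j | j != i1)
    (model_curv ip (xi l p) ph h' kappa mu c (E i1) (E j) (E j) (E i1)
     - b * al (E j) (E j) + b ^+ 2 * ip (P l p) (E j) ^+ 2
     + ip (sff (e j) (e j)) (sff (e i1) (e i1)) - ip (sff (e i1) (e j)) (sff (e i1) (e j))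
     - b * ip (P l p) (sff (e j) (e j))).
  apply: eq_bigr => j /negbTE j1.
  have E0 : ip (E i1) (E j) = 0 by rewrite ipE eq_sym j1.
  have E1 : ip (E i1) (E i1) = 1 by rewrite ipE eqxx.
  have L (r r' s s' t1 t2 t3 t4 : R) : r = r' -> s' = s ->
      r - b * s + t1 + t2 - t3 - t4 = r' - b * s' + t1 + t2 - t3 - t4 by move=> -> ->.
  exact: etrans (induced_riem_gauss oU sG Gsym Gpos oW sF FU sP a b Wu ind E0 E1)
    (L _ _ _ _ _ _ _ _ (curvE (E i1) (E j))
      (alpha'E oU sG Gsym Gpos sF FU sP (e j) (e j) Wu)).
by rewrite ric; subst v; exact: bound.
Qed.
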